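(* Let $d\in\mathbb N^+$, $\lambda,\mu>0$, $\alpha=\lambda$ and $\mu\neq\lambda$. Let $F(z,t)$, $z\in[0,1]$, $t\ge 0$, be the probability generating function of the process $\mathcal N$ (defined in the context). For $t<\log(\mu/\lambda)/(\mu-\lambda)$, $$F(z,t)=1-d+\frac{d(\mu-\lambda)}{\mu-\lambda z-\lambda(1-z)e^{-(\mu-\lambda)t}}-\frac{d(d-1)(\mu-\lambda)^2}{\mu-\lambda z}\left[-\lambda g_1(z)+\sum_{n=2}^{+\infty}\frac{(-\lambda)^n}{n!}g_n(z)\,\theta_n\right],$$ where, if $\mu>\lambda$, $$\begin{aligned}g_k(z)=\frac{1}{(\lambda-\mu)^{k+1}}\Bigg\{&\lambda(1-z)(\lambda-\mu)^{k-1}t^k+k!\left[\mathrm{Li}_k\!\left(\tfrac{\lambda(1-z)e^{-(\mu-\lambda)t}}{\mu-\lambda z}\right)-\mathrm{Li}_k\!\left(\tfrac{\lambda(1-z)}{\mu-\lambda z}\right)\right]\\&-\sum_{r=1}^{k-1}\frac{k!}{r!}[(\lambda-\mu)t]^r\,\mathrm{Li}_{k-r}\!\left(\tfrac{\lambda(1-z)}{\mu-\lambda z}\right)\Bigg\},\end{aligned}$$ and, if $\mu<\lambda$, $$\begin{aligned}g_k(z)=\frac{1}{(\mu-\lambda)^{k+1}}\Bigg\{&(\mu-\lambda z)(\mu-\lambda)^{k-1}t^k+k!\left[\mathrm{Li}_k\!\left(\tfrac{(\mu-\lambda z)e^{-(\lambda-\mu)t}}{\lambda(1-z)}\right)-\mathrm{Li}_k\!\left(\tfrac{\mu-\lambda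 z}{\lambda(1-z)}\right)\right]\\&-\sum_{r=1}^{k-1}\frac{k!}{r!}[(\mu-\lambda)t]^r\,\mathrm{Li}_{k-r}\!\left(\tfrac{\mu-\lambda z}{\lambda(1-z)}\right)\Bigg\},\end{aligned}$$ and where $$\mathrm{Li}_k(z)=\sum_{j=1}^{+\infty}\frac{z^j}{j^k}$$ is the polylogarithm function. Here $$\theta_n=\sum_{i=1}^{n-2}(d-1)^i\sum_{j=1}^{n-i-1}\binom{i+1}{j}Q_{j,j+n-i-1}+A_n\!\left(\frac{\mu}{\lambda}\right)+(d-1)^{n-1},\qquad Q_{j,m}=\sum_{\substack{s_1,\ldots,s_j\ge2\\ s_1+\cdots+s_j=m}}A_{s_1}\!\left(\frac{\mu}{\lambda}\right)\cdots A_{s_j}\!\left(\frac{\mu}{\lambda}\right),$$ with $A_n$ the $n$-th Eulerian polynomial.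
   Context: Let $D=\{1,\ldots,d\}$. $\mathcal N=\{(N(t),J(t)),t\ge 0\}$ is the (nonexplosive) continuous-time Markov chain on $S=\{(0,0)\}\cup(\mathbb N^+\times D)$ whose only nonzero off-diagonal transition rates are, for $k\in\mathbb N^+$ and $j\in D$: from $(0,0)$ to $(1,j)$ at rate $\alpha$; from $(k,j)$ to $(k+1,j)$ at rate $\alpha+\lambda k$; from $(k,j)$ to $(k-1,j)$ at rate $\mu k$, where $(0,j)$ is identified with $(0,0)$ for every $j$. The initial state is $0:=(0,0)$. Put $p(0,t)=\mathbb P\{(N(t),J(t))=0\mid (N(0),J(0))=0\}$, $p(k,j,t)=\mathbb P\{(N(t),J(t))=(k,j)\mid (N(0),J(0))=0\}$, $P(k,t)=\sum_{j=1}^d p(k,j,t)$ for $k\in\mathbb N^+$, and $F(z,t)=p(0,t)+\sum_{k\ge1}z^kP(k,t)$ for $z\in[0,1]$, $t\ge0$. The Eulerian polynomials $A_n(x)$ are normalized by $\sum_{n\ge0}A_n(x)\frac{u^n}{n!}=\frac{x-1}{x-e^{u(x-1)}}$, so that $A_0(x)=A_1(x)=1$, $A_2(x)=1+x$, $A_3(x)=1+4x+x^2$. Empty sums are $0$.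
   Formalization: For μ<λ the formula is undefined at z=μ/λ and z=1 (zero denominators) and the series Li_k diverges for arguments below −1; Li_k is taken as its analytic continuation to (−∞,1), and at these two z the formula is read as its limit within [0,1]. *)

(* Defs.v *)
From HB Require Import structures.
From mathcomp Require Import all_boot all_order all_algebra.
From mathcomp Require Import all_classical all_reals all_analysis.

Set Implicit Arguments.
Unset Strict Implicit.
Unset Printing Implicit Defensive.

Import Order.TTheory GRing.Theory Num.Theory.
Import numFieldNormedType.Exports.

Local Open Scope classical_set_scope.
Local Open Scope ring_scope.

Section MarkovChains.
Context {R : realType} {S : countType}.

(* Only the values at times s, t >= 0 are meaningful. The total mass 1 is
   where nonexplosion enters. *)
Record transition_function (p : R -> S -> S -> R) : Prop := {
  tf_ge0 : forall t x y, 0 <= t -> 0 <= p t x y ;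
  tf_mass1 : forall t x, 0 <= t -> \esum_(y in setT) (p t x y)%:E = 1%E ;
  tf_init : forall x y, p 0 x y = (x == y)%:R ;
  tf_semigroup : forall s t x z, 0 <= s -> 0 <= t ->
    (p (s + t) x z)%:E = \esum_(y in setT) (p s x y * p t y z)%:E }.

(* q x y is the transition rate from x to y != x; the diagonal of q is
   irrelevant, the total rate of leaving x being the sum of the q x y. *)
Definition has_transition_rates (p : R -> S -> S -> R) (q : S -> S -> R) :=
  (forall x y, x != y -> p h x y / h @[h --> 0^'+] --> q x y) /\
  (forall x, ((1 - p h x x) / h)%:E @[h --> 0^'+] -->
             \esum_(y in [set y | y != x]) (q x y)%:E).

Context {disp : measure_display} {Omega : measurableType disp}.

(* H lists finitely many (time, state) pairs. *)
Definition past_event (X : R -> Omega -> S) (H : seq (R * S)) : set Omega :=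
  [set w | forall us, us \in H -> X us.1 w = us.2].

Definition markov_property (P : probability Omega R) (X : R -> Omega -> S)
    (p : R -> S -> S -> R) :=
  forall (H : seq (R * S)) (s t : R) (x y : S),
    0 <= s -> 0 <= t -> (forall us, us \in H -> 0 <= us.1 <= s) ->
    P (past_event X H `&` [set w | X s w = x] `&` [set w | X (s + t) w = y]) =
    (P (past_event X H `&` [set w | X s w = x]) * (p t x y)%:E)%E.

(* X is only considered at times t >= 0. *)
Definition nonexplosive_ctmc (P : probability Omega R) (X : R -> Omega -> S)
    (q : S -> S -> R) :=
  (forall t x, 0 <= t -> measurable [set w | X t w = x]) /\
  exists p, [/\ transition_function p, has_transition_rates p q
              & markov_property P X p].

End MarkovChains.

Definition in_state (d : nat) (x : nat * nat) : bool :=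
  (x == (0, 0)%N) || ((0 < x.1)%N && (1 <= x.2 <= d)%N).

Definition state (d : nat) := {x : nat * nat | in_state d x}.

Definition rate {R : realType} (d : nat) (alpha lambda mu : R)
    (x y : state d) : R :=
  let: (k, i) := val x in
  let: (l, j) := val y in
  if k == 0%N then (if l == 1%N then alpha else 0)
  else if (l == k.+1) && (i == j) then alpha + lambda * k%:R
  else if (k == l.+1) && ((l == 0%N) || (i == j)) then mu * k%:R
  else 0.

Section GeneratingFunction.
Context {R : realType} {disp : measure_display} {Omega : measurableType disp}.
Variables (P : probability Omega R) (d : nat) (X : R -> Omega -> state d).

Definition cond_pr (A B : set Omega) : R := fine (P (A `&` B)) / fine (P B).

Definition at_state (t : R) (x : nat * nat) : set Omega :=
  [set w | val (X t w) = x].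

Definition starts_at_0 := P (at_state 0 (0, 0)%N) = 1%E.

Definition p_zero (t : R) : R :=
  cond_pr (at_state t (0, 0)%N) (at_state 0 (0, 0)%N).

Definition p_pos (k j : nat) (t : R) : R :=
  cond_pr (at_state t (k, j)) (at_state 0 (0, 0)%N).

Definition P_level (k : nat) (t : R) : R := \sum_(1 <= j < d.+1) p_pos k j t.

Definition pgf (z t : R) : R :=
  p_zero t + limn (fun n => \sum_(1 <= k < n) z ^+ k * P_level k t).

End GeneratingFunction.

Section Formula.
Context {R : realType}.

Definition eulerian (A : nat -> {poly R}) :=
  forall x : R, x != 1 ->
    \forall u \near (0 : R),
      (fun n => \sum_(0 <= i < n) (A i).[x] * u ^+ i / i`!%:R) @ \oo -->
        (x - 1) / (x - expR (u * (x - 1))).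

(* The arguments of Li_k in the formula are real, < 1, and unbounded below
   when mu < lambda and z is close to 1; for arguments below -1 the series
   diverges and Li_k denotes, as usual, its (unique) analytic continuation. *)
Definition polylog (k : nat) (L : R -> R) :=
  (forall x, `|x| < 1 ->
     (fun n => \sum_(1 <= j < n) x ^+ j / j%:R ^+ k) @ \oo --> L x) /\
  (forall x0 : R, x0 < 1 -> exists a : nat -> R,
     \forall x \near x0,
       (fun n => \sum_(0 <= i < n) a i * (x - x0) ^+ i) @ \oo --> L x).

Variables (A : nat -> {poly R}) (Li : nat -> R -> R).
Variables (d : nat) (lambda mu : R).

(* Each s_i is at most m, hence the bounded range. *)
Definition Q (j m : nat) : R :=
  \sum_(s : {ffun 'I_j -> 'I_m.+1}
        | [forall i, (2 <= s i)%N] && (\sum_(i < j) s i == m)%N)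
    \prod_(i < j) (A (s i)).[mu / lambda].

Definition theta (n : nat) : R :=
  \sum_(1 <= i < n.-1) (d%:R - 1) ^+ i *
     (\sum_(1 <= j < n - i) 'C(i.+1, j)%:R * Q j (j + n - i - 1))
  + (A n).[mu / lambda] + (d%:R - 1) ^+ n.-1.

Definition g_subcritical (k : nat) (z t : R) : R :=
  ((lambda - mu) ^+ k.+1)^-1 *
  (lambda * (1 - z) * (lambda - mu) ^+ k.-1 * t ^+ k
   + k`!%:R *
     (Li k (lambda * (1 - z) * expR (- (mu - lambda) * t) / (mu - lambda * z))
      - Li k (lambda * (1 - z) / (mu - lambda * z)))
   - \sum_(1 <= r < k) k`!%:R / r`!%:R * ((lambda - mu) * t) ^+ r *
       Li (k - r)%N (lambda * (1 - z) / (mu - lambda * z))).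

Definition g_supercritical (k : nat) (z t : R) : R :=
  ((mu - lambda) ^+ k.+1)^-1 *
  ((mu - lambda * z) * (mu - lambda) ^+ k.-1 * t ^+ k
   + k`!%:R *
     (Li k ((mu - lambda * z) * expR (- (lambda - mu) * t)
              / (lambda * (1 - z)))
      - Li k ((mu - lambda * z) / (lambda * (1 - z))))
   - \sum_(1 <= r < k) k`!%:R / r`!%:R * ((mu - lambda) * t) ^+ r *
       Li (k - r)%N ((mu - lambda * z) / (lambda * (1 - z)))).

Definition g (k : nat) (z t : R) : R :=
  if lambda < mu then g_subcritical k z t else g_supercritical k z t.

Definition series_term (z t : R) (n : nat) : R :=
  (- lambda) ^+ n / n`!%:R * g n z t * theta n.

Definition pgf_formula (z t : R) : R :=
  1 - d%:R
  + d%:R * (mu - lambda) /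
      (mu - lambda * z - lambda * (1 - z) * expR (- (mu - lambda) * t))
  - d%:R * (d%:R - 1) * (mu - lambda) ^+ 2 / (mu - lambda * z) *
      (- lambda * g 1 z t
       + limn (fun n => \sum_(2 <= i < n) series_term z t i)).

End Formula.

(* Main.v *)
Require Import Defs.
From HB Require Import structures.
From mathcomp Require Import all_boot all_order all_algebra.
From mathcomp Require Import all_classical all_reals all_analysis.
From mathcomp Require Import ring lra zify.
Import Order.TTheory GRing.Theory Num.Theory.
Import numFieldNormedType.Exports.
Local Open Scope classical_set_scope.
Local Open Scope ring_scope.
Set Implicit Arguments.
Unset Strict Implicit.
Unset Printing Implicit Defensive.

(** For [d = 1] the process is a linear birth-death process with immigration,
    whose generating function [G(z, t)] is explicit: the functions
    [w_t(k) = G(z, t) phi(z, t)^k] satisfy its backward equation. For general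
    [d] the generator differs only at the origin, so that
    [M(s) = E w_(t-s)(N(s))] has right derivative
    [(d - 1) p(0, s) G'(z, t - s)], whence
    [F(z, t) = G(z, t) + (d - 1) int_0^t p(0, s) G'(z, t - s) ds].
    To differentiate [M] one compares [P_h w_a] with [w_(a+h)] uniformly in the
    initial state, by a maximum principle for the backward equation; this needs
    neither the forward equations nor boundedness of the rates.

    At [z = 0] this is a Volterra equation for [p(0, t)]. Since
    [G(0, t) = sum_n A_n(mu / lambda) (- lambda t)^n / n!], it is solved by
    [p(0, t) = sum_n c_n (- lambda t)^n / n!], where the formal series
    [c = sum_n c_n X^n] and [a = sum_n A_n(mu / lambda) X^n] satisfy
    [c = a + (d - 1) (a - 1) c]; expanding the powers of [a - 1] gives
    [c_n = d theta_n] for [n >= 2]. Both series converge up to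
    [log (mu / lambda) / (mu - lambda)] because their coefficients are
    nonnegative and their partial sums are dominated by solutions of
    differential inequalities. Finally [g_n] is, up to a factor, the
    convolution of [t^n] with [G'(z, t)], as both satisfy [g_n' = n g_(n-1)]
    and [g_n(0) = 0]; for the continued polylogarithm this uses
    [x Li_(k+1)'(x) = Li_k(x)], which propagates from the unit disc by the
    identity theorem. *)

(** * Differential inequalities *)

(** The rates are one-sided derivatives of [p] at time 0, so the semigroup property yields right
    derivatives only, state by state. Estimates in time are therefore comparisons of functions with
    a controlled upper right Dini derivative and no upward jump from the left. The increment
    [M (s + h) - M s] is [T s] applied to [T h w_(t-s-h) - w_(t-s)], and [T s] may charge infinitely
    many states; this is why derivatives at single states do not suffice. No integral of [p(0, s)]
    is formed: [duhamel] receives an explicit primitive of a truncated integrand and a primitive of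
    the error. The Volterra kernel is at most [(d - 1) la] in absolute value, so iterating the error
    estimate gains the factor [((d - 1) la t)^k / k!], which identifies [p(0, t)] with the series.
    The generating function of the Eulerian values has its real pole at some [rho > 0] and is
    evaluated at [- la t]: the bound on [t] is a radius of convergence, dictated by a singularity at
    the negative time [- rho / la]. *)

Lemma real_induction {R : realType} (T : R) (P : R -> Prop) :
  0 <= T -> P 0 ->
  (forall s, 0 <= s < T -> (forall r, 0 <= r <= s -> P r) ->
     \forall h \near 0^'+, P (s + h)) ->
  (forall s, 0 < s <= T -> (forall r, 0 <= r < s -> P r) -> P s) ->
  P T.
Proof.
move=> T0 P0 Pright Pleft.
(* [A] collects the ends of the initial segments on which [P] holds; its supremum belongs to [A] by
   the left hypothesis and is [T] by the right one. *)
pose A := [set s | 0 <= s <= T /\ forall r, 0 <= r <= s -> P r].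
have A0 : A 0.
  by split=> [|r /andP[r0 r1]]; [rewrite lexx|rewrite (_ : r = 0)//; lra].
have ubA : ubound A T by move=> s [/andP[]].
have supA : has_sup A by split; [exists 0|exists T].
set m := sup A.
have m0 : 0 <= m by apply: ub_le_sup => //; exists T.
have mT : m <= T by apply: ge_sup => //; exists 0.
have Pm r : 0 <= r < m -> P r.
  move=> /andP[r0 rm].
  have [s [_ As] rs] := @sup_adherent _ A (m - r) ltac:(lra) supA.
  apply: As; rewrite r0 /=; move: rs; rewrite -/m; lra.
have {}Pm r : 0 <= r <= m -> P r.
  move=> /andP[r0 rm]; have [rm'|rm'] := ltP r m; first by apply: Pm; rewrite r0.
  have -> : r = m by lra.
  have [->//|m0'] := eqVneq m 0.
  by apply: Pleft => //; rewrite mT lt_neqAle eq_sym m0' m0.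
have [mltT|Tm] := ltP m T; last by apply: Pm; rewrite T0.
have /= := Pright m ltac:(lra) Pm.
move=> [e /= e0 He].
have Am : A (m + Num.min (e / 2) (T - m)).
  split.
    by rewrite addr_ge0 ?le_min//=; [have := ge_min (T - m) (e / 2) (T - m); lra|lra].
  move=> r /andP[r0 rle].
  have [rm|rm] := leP r m; first by apply: Pm; rewrite r0.
  have -> : r = m + (r - m) by ring.
  have : Num.min (e / 2) (T - m) <= e / 2 by rewrite ge_min lexx.
  move=> H; apply: He => /=; last by rewrite subr_gt0.
  by rewrite sub0r normrN gtr0_norm; lra.
have : m + Num.min (e / 2) (T - m) <= m by apply: ub_le_sup => //; exists T.
have : 0 < Num.min (e / 2) (T - m) by rewrite lt_min; apply/andP; split; lra.
lra.
Qed.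

(** An upper bound for the upper right Dini derivative. *)
Definition dini_le {R : realType} (f : R -> R) (s l : R) :=
  forall e, 0 < e -> \forall h \near 0^'+, f (s + h) - f s <= h * (l + e).

(** Excludes an upward jump on arrival at [s], so that an upper bound valid before [s] persists at
    [s]. *)
Definition left_lsc {R : realType} (f : R -> R) (s : R) :=
  forall e, 0 < e -> \forall h \near 0^'+, f s - f (s - h) <= e.

Lemma near_scale_le {R : realType} (a b : R) :
  0 < b -> \forall h \near 0^'+, h * a <= b.
Proof.
move=> b0; near=> h.
have h0 : 0 < h by [].
have : h < b / (`|a| + 1) by near: h; apply: nbhs_right_lt; rewrite divr_gt0 ?ltr_wpDl.
rewrite ltr_pdivlMr ?ltr_wpDl// => /ltW; apply: le_trans.
by rewrite ler_pM2l// (le_trans (ler_norm a))// lerDl.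
Unshelve. all: by end_near. Qed.

(** Along real induction the slack [e * s] absorbs the error allowed by the Dini bound; it is then
    sent to 0. *)
Lemma dini_le_le {R : realType} (f : R -> R) (T : R) :
  0 <= T -> (forall s, 0 < s <= T -> left_lsc f s) ->
  (forall s, 0 <= s < T -> dini_le f s 0) -> f T <= f 0.
Proof.
move=> T0 fl fr; apply/ler_addgt0Pr => e e0.
suff : forall e, 0 < e -> f T <= f 0 + e * T.
  move=> /(_ (e / (T + 1))) H.
  have T1 : 0 < T + 1 by rewrite ltr_wpDl.
  apply: (le_trans (H _)); first by rewrite divr_gt0.
  by rewrite lerD2l -mulrA ger_pMr// ler_pdivrMl// mulr1 lerDl.
move=> {e0}e e0.
apply: (@real_induction _ T (fun s => f s <= f 0 + e * s)) => //.
- by rewrite mulr0 addr0.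
- move=> s sT Hs; near=> h.
  have : f (s + h) - f s <= h * (0 + e) by near: h; exact: fr.
  have := Hs s; rewrite lexx; lra.
- move=> s /andP[s0 sT] Hs; apply/ler_addgt0Pr => a a0.
  near (0 : R)^'+ => h.
  have h0 : 0 < h by [].
  have hs : h <= s by near: h; exact: nbhs_right_le.
  have : f s - f (s - h) <= a by near: h; apply: fl => //; rewrite s0.
  have := Hs (s - h) ltac:(lra).
  have : 0 < e * h by rewrite mulr_gt0.
  lra.
Unshelve. all: by end_near. Qed.

(* The Lyapunov function [V] confines a violation of [v <= a V] to finitely
   many states, where the generator [L] pushes it back. *)
Lemma generator_comparison {R : realType} (S : eqType)
    (L : (S -> R) -> S -> R) (V : S -> R) (c T M : R) (v : R -> S -> R) :
  (forall f g y, (forall x, f x <= g x) -> f y = g y -> L f y <= L g y) ->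
  (forall a y, 0 < a -> L (fun x => a * V x) y <= a * (c * V y)) ->
  (forall y, 0 < V y) ->
  (forall K, exists l : seq S, forall y, V y <= K -> y \in l) ->
  0 <= c -> 0 <= T ->
  (forall s y, 0 <= s <= T -> v s y <= M) ->
  (forall y, v 0 y <= 0) ->
  (forall s y, 0 < s <= T -> left_lsc (v ^~ y) s) ->
  (forall s y, 0 <= s < T -> dini_le (v ^~ y) s (L (v s) y)) ->
  forall y, v T y <= 0.
Proof.
move=> Lmono LV V0 Vfin c0 T0 vM v0 vl vr y.
suff H e : 0 < e -> v T y <= e * expR ((c + 1) * T) * V y.
  apply/ler_addgt0Pr => a a0; rewrite add0r.
  have K0 : 0 < expR ((c + 1) * T) * V y by rewrite mulr_gt0 ?expR_gt0.
  apply: (le_trans (H (a / (expR ((c + 1) * T) * V y)) _)).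
    by rewrite divr_gt0.
  by rewrite -mulrA divfK// gt_eqF.
move=> e0; move: y.
(* The exponent exceeds the Lyapunov rate [c] by 1; the margin absorbs the error of the Dini bound
   at a contact point. *)
pose a s := e * expR ((c + 1) * s).
have a0 s : 0 < a s by rewrite mulr_gt0 ?expR_gt0.
have aD s h : 0 <= h -> a s * (1 + (c + 1) * h) <= a (s + h).
  move=> h0; rewrite {2}/a (mulrDr (c + 1)) expRD mulrA -/(a s) ler_pM2l//; exact: expR_ge1Dx.
have amono s h : 0 <= h -> a s <= a (s + h).
  move=> h0; apply: le_trans (aD _ _ h0).
  by rewrite -[leLHS]mulr1 ler_pM2l// lerDl mulr_ge0// addr_ge0.
apply: (@real_induction _ T (fun s => forall y, v s y <= a s * V y)) => //.
- by move=> y; apply: (le_trans (v0 y)); rewrite mulr_ge0// ltW.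
- move=> s sT Hs; have [l Vl] := Vfin (M / e).
  have sT' : 0 <= s <= T by lra.
  have {Hs}Hs y : v s y <= a s * V y by apply: Hs; lra.
  have near1 y : \forall h \near 0^'+, v (s + h) y <= a (s + h) * V y.
    (* At a contact point the maximum principle bounds the generator; elsewhere the strict
       inequality survives for a short time. *)
    have [eqs|nes] := eqVneq (v s y) (a s * V y).
      have aV : 0 < a s * V y by rewrite mulr_gt0.
      near=> h; have h0 : 0 < h by [].
      have : v (s + h) y - v s y <= h * (L (v s) y + a s * V y).
        by near: h; exact: vr.
      have : L (v s) y <= a s * (c * V y).
        by apply: le_trans (LV _ _ (a0 s)); exact: Lmono.
      rewrite -(ler_pM2l h0) => H1 H2.
      have : a s * (1 + (c + 1) * h) * V y <= a (s + h) * V y.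
        by rewrite ler_pM2r ?V0// aD// ltW.
      rewrite eqs in H2; lra.
    have lts : 0 < a s * V y - v s y by rewrite subr_gt0 lt_neqAle nes Hs.
    near=> h; have h0 : 0 < h by [].
    have : v (s + h) y - v s y <= h * (L (v s) y + 1) by near: h; exact: vr.
    have : h * (L (v s) y + 1) <= a s * V y - v s y.
      by near: h; exact: near_scale_le.
    have : a s * V y <= a (s + h) * V y by rewrite ler_pM2r ?V0// amono// ltW.
    lra.
  have nearl : \forall h \near 0^'+,
      forall y, y \in l -> v (s + h) y <= a (s + h) * V y.
    elim: l {Vl} => [|x l IH]; first by near=> h.
    near=> h => y; rewrite inE => /orP[/eqP ->|]; first by near: h; exact: near1.
    by move: y; near: h; exact: IH.
  near=> h => y; have h0 : 0 < h by [].
  have [yl|yl] := boolP (y \in l).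
    by move: y yl; near: h; exact: nearl.
  have MV : M < e * V y.
    rewrite mulrC -ltr_pdivrMr// ltNge; apply: contra yl; exact: Vl.
  have shT : s + h <= T.
    by rewrite -lerBrDl; near: h; apply: nbhs_right_le; lra.
  have := vM (s + h) y ltac:(lra).
  have : e * V y <= a (s + h) * V y.
    rewrite ler_pM2r ?V0// /a ler_peMr ?ltW// expR_gt1 mulr_gt0//; lra.
  lra.
- move=> s /andP[s0 sT] Hs y; apply/ler_addgt0Pr => b b0.
  near (0 : R)^'+ => h; have h0 : 0 < h by [].
  have hs : h <= s by near: h; exact: nbhs_right_le.
  have : v s y - v (s - h) y <= b.
    by near: h; apply: vl => //; rewrite s0.
  have := Hs (s - h) ltac:(lra) y.
  have : a (s - h) * V y <= a s * V y.
    rewrite ler_pM2r ?V0//; have := amono (s - h) h (ltW h0).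
    by rewrite subrK.
  lra.
Unshelve. all: by end_near. Qed.

(** * Transition semigroups *)

Lemma ge0_esumZl {R : realType} (T : choiceType) (I : set T) (a : T -> \bar R)
    (c : R) : 0 <= c -> (forall i, I i -> (0 <= a i)%E) ->
  \esum_(i in I) (c%:E * a i)%E = (c%:E * \esum_(i in I) a i)%E.
Proof.
move=> c0 a0; rewrite /esum -ereal_supZl//; last first.
  by apply/set0P; exists (\sum_(x \in set0) a x)%E, set0 => //; exact: fsets_set0.
rewrite image_comp; congr ereal_sup; apply: eq_imagel => A [finA AI] /=.
rewrite !fsbig_finite// [LHS]big_seq [in RHS]big_seq ge0_sume_distrr// => i.
by rewrite in_fset_set// inE => /AI/a0.
Qed.

(** For bounded nonnegative [f] the sum is finite by the total mass 1; an infinite sum would be sent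
    to 0 by [fine]. *)
Definition semigroup_op {R : realType} {S : countType} (p : R -> S -> S -> R)
    (h : R) (f : S -> R) (x : S) : R :=
  fine (\esum_(y in setT) (p h x y * f y)%:E).

Section SemigroupOp.
Context {R : realType} {S : countType} (p : R -> S -> S -> R).
Hypothesis tf : transition_function p.
Local Notation T := (semigroup_op p).

Lemma semigroup_opE h f M x : 0 <= h -> (forall y, 0 <= f y <= M) ->
  (T h f x)%:E = \esum_(y in setT) (p h x y * f y)%:E.
Proof.
move=> h0 f0; rewrite /T fineK// ge0_fin_numE; last first.
  apply: esum_ge0 => y _; rewrite lee_fin mulr_ge0//; first exact: (tf_ge0 tf).
  by case/andP: (f0 y).
have M0 : 0 <= M by case/andP: (f0 x) => /le_trans; apply.
apply: (@le_lt_trans _ _ (\esum_(y in setT) (M%:E * (p h x y)%:E))%E).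
  apply: le_esum => y _; rewrite -EFinM lee_fin mulrC ler_wpM2r//.
    exact: (tf_ge0 tf).
  by case/andP: (f0 y).
rewrite ge0_esumZl//; first by rewrite (tf_mass1 tf)// mule1 ltry.
by move=> y _; rewrite lee_fin (tf_ge0 tf).
Qed.

Lemma semigroup_op_ge0 h f x : 0 <= h -> (forall y, 0 <= f y) -> 0 <= T h f x.
Proof.
move=> h0 f0; apply/fine_ge0/esum_ge0 => y _.
by rewrite lee_fin mulr_ge0// (tf_ge0 tf).
Qed.

Lemma semigroup_op_le h f g M x : 0 <= h -> (forall y, 0 <= f y) ->
  (forall y, f y <= g y) -> (forall y, g y <= M) -> T h f x <= T h g x.
Proof.
move=> h0 f0 fg gM; rewrite -lee_fin.
rewrite (semigroup_opE (f := f) (M := M))//; last first.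
  by move=> y; rewrite f0 (le_trans (fg y)).
rewrite (semigroup_opE (f := g) (M := M))//; last first.
  by move=> y; rewrite gM (le_trans (f0 y)).
by apply: le_esum => y _; rewrite lee_fin ler_wpM2l// (tf_ge0 tf).
Qed.

Lemma semigroup_opD h f g M N x : 0 <= h -> (forall y, 0 <= f y <= M) ->
  (forall y, 0 <= g y <= N) -> T h (fun y => f y + g y) x = T h f x + T h g x.
Proof.
move=> h0 f0 g0; apply: EFin_inj; rewrite EFinD.
rewrite (semigroup_opE x h0 f0) (semigroup_opE x h0 g0).
rewrite (semigroup_opE (M := M + N))//; last first.
  by move=> y; move: (f0 y) (g0 y); lra.
rewrite -esumD.
- by apply: eq_esum => y _; rewrite mulrDr EFinD.
- by move=> y _; rewrite lee_fin mulr_ge0 ?(tf_ge0 tf)//; case/andP: (f0 y).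
- by move=> y _; rewrite lee_fin mulr_ge0 ?(tf_ge0 tf)//; case/andP: (g0 y).
Qed.

Lemma semigroup_opZ h c f M x : 0 <= h -> 0 <= c -> (forall y, 0 <= f y <= M) ->
  T h (fun y => c * f y) x = c * T h f x.
Proof.
move=> h0 c0 f0; apply: EFin_inj; rewrite EFinM.
rewrite (semigroup_opE x h0 f0) (semigroup_opE (M := c * M))//; last first.
  by move=> y; case/andP: (f0 y) => ? ?; rewrite mulr_ge0//= ler_wpM2l.
rewrite -ge0_esumZl//.
  by apply: eq_esum => y _; rewrite -EFinM mulrCA.
by move=> y _; rewrite lee_fin mulr_ge0 ?(tf_ge0 tf)//; case/andP: (f0 y).
Qed.

Lemma semigroup_op_cst h c x : 0 <= h -> 0 <= c -> T h (fun=> c) x = c.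
Proof.
move=> h0 c0; apply: EFin_inj; rewrite (semigroup_opE (M := c))//; last first.
  by move=> _; rewrite c0 lexx.
rewrite (eq_esum (b := fun y => c%:E * (p h x y)%:E)%E)//; last first.
  by move=> y _; rewrite -EFinM mulrC.
rewrite ge0_esumZl// ?(tf_mass1 tf)// ?mule1//.
by move=> y _; rewrite lee_fin (tf_ge0 tf).
Qed.

Lemma semigroup_op_le_cst h f M x : 0 <= h -> (forall y, 0 <= f y <= M) ->
  T h f x <= M.
Proof.
move=> h0 f0; have M0 : 0 <= M by case/andP: (f0 x) => /le_trans; apply.
rewrite -[leRHS](semigroup_op_cst x h0 M0).
by apply: (semigroup_op_le (M := M)) => // y; case/andP: (f0 y).
Qed.

Lemma semigroup_op_delta h x z : 0 <= h ->
  T h (fun y => (y == z)%:R) x = p h x z.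
Proof.
move=> h0; apply: EFin_inj; rewrite (semigroup_opE (M := 1))//; last first.
  by move=> y; case: eqP; rewrite ?lexx ?ler01.
rewrite -[RHS](@esum_set1 _ _ z (fun y => (p h x y)%:E)); last first.
  by rewrite lee_fin (tf_ge0 tf).
rewrite [RHS]esum_mkcond; apply: eq_esum => y _.
have [->|yz] := eqVneq y z; first by rewrite mem_set// mulr1.
by rewrite mulr0 ifF//; apply/negbTE; rewrite notin_setE /=; exact/eqP.
Qed.

Lemma semigroup_op0 f M x : (forall y, 0 <= f y <= M) -> T 0 f x = f x.
Proof.
move=> f0; apply: EFin_inj; rewrite (semigroup_opE (M := M))//.
have fx : 0 <= f x by case/andP: (f0 x).
rewrite -[RHS](@esum_set1 _ _ x (fun y => (f y)%:E)) ?lee_fin//.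
rewrite [RHS]esum_mkcond; apply: eq_esum => y _; rewrite (tf_init tf) eq_sym.
have [->|yx] := eqVneq y x; first by rewrite mem_set// mul1r.
by rewrite mul0r ifF//; apply/negbTE; rewrite notin_setE /=; exact/eqP.
Qed.

Lemma semigroup_op_comp s t f M x : 0 <= s -> 0 <= t ->
  (forall y, 0 <= f y <= M) -> T (s + t) f x = T s (T t f) x.
Proof.
move=> s0 t0 f0; have f0' y : 0 <= f y by case/andP: (f0 y).
have pf0 r y z : 0 <= r -> 0 <= p r y z * f z by move=> ?; rewrite mulr_ge0// (tf_ge0 tf).
apply: EFin_inj; rewrite (semigroup_opE x (addr_ge0 s0 t0) f0).
rewrite (semigroup_opE (M := M))//; last first.
  by move=> y; rewrite semigroup_op_ge0//= semigroup_op_le_cst.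
transitivity (\esum_(z in [set: S]) \esum_(y in [set: S])
    (p s x y * (p t y z * f z))%:E).
  apply: eq_esum => z _.
  have -> : (p (s + t) x z * f z)%:E = ((f z)%:E * (p (s + t) x z)%:E)%E.
    by rewrite -EFinM mulrC.
  rewrite (tf_semigroup tf)// -ge0_esumZl//.
    by apply: eq_esum => y _; rewrite -EFinM; congr EFin; ring.
  by move=> y _; rewrite lee_fin mulr_ge0// (tf_ge0 tf).
transitivity (\esum_(y in [set: S]) \esum_(z in [set: S])
    (p s x y * (p t y z * f z))%:E); last first.
  apply: eq_esum => y _; rewrite EFinM (semigroup_opE y t0 f0).
  rewrite -ge0_esumZl ?(tf_ge0 tf)//; last by move=> z _; rewrite lee_fin pf0.
rewrite esum_esum; last by move=> *; rewrite lee_fin mulr_ge0 ?pf0 ?(tf_ge0 tf).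
rewrite esum_esum; last by move=> *; rewrite lee_fin mulr_ge0 ?pf0 ?(tf_ge0 tf).
rewrite [RHS](@reindex_esum R _ _ ([set: S] `*`` (fun=> [set: S])) _
  (fun u => (u.2, u.1)))//; last first.
  by split=> [[]//|[a b] [c d] _ _ [-> ->]//|[a b] _]; exists (b, a).
Qed.

Lemma semigroup_op_ge_sum h g M x (l : seq S) : 0 <= h -> uniq l ->
  (forall y, 0 <= g y <= M) -> \sum_(y <- l) p h x y * g y <= T h g x.
Proof.
move=> h0 ul g0; rewrite -lee_fin (semigroup_opE x h0 g0).
apply: esum_ge; exists [set` l]; first by split=> //; exact: finite_seq.
by rewrite -fsbig_seq// sumEFin.
Qed.

(** The lower bound applied to [M - g], the total mass being 1. *)
Lemma semigroup_op_le_sum h g M x (l : seq S) : 0 <= h -> uniq l ->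
  (forall y, 0 <= g y <= M) ->
  T h g x <= \sum_(y <- l) p h x y * g y + M * (1 - \sum_(y <- l) p h x y).
Proof.
move=> h0 ul g0; have M0 : 0 <= M by case/andP: (g0 x) => /le_trans; apply.
have g0' y : 0 <= M - g y <= M by move: (g0 y); lra.
have := semigroup_op_ge_sum x h0 ul g0'.
have := semigroup_opD x h0 g0 g0'.
rewrite (_ : (fun y => _) = fun=> M); last by apply/funext => y; ring.
rewrite semigroup_op_cst// => eqM.
under eq_bigr do rewrite mulrBr.
rewrite sumrB -mulr_suml; lra.
Qed.

End SemigroupOp.

(** * The backward equation at a state with finitely many neighbours *)

Section BackwardEquation.
Context {R : realType} {S : countType} (p : R -> S -> S -> R) (q : S -> S -> R).
Hypotheses (tf : transition_function p) (rates : has_transition_rates p q).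
Variables (x : S) (nb : seq S).
Hypotheses (nb_uniq : uniq nb) (x_nb : x \notin nb).
Hypothesis q_ge0 : forall y, 0 <= q x y.
Hypothesis q_nb : forall y, y != x -> y \notin nb -> q x y = 0.
Local Notation T := (semigroup_op p).

Lemma exit_rate : (1 - p h x x) / h @[h --> 0^'+] --> \sum_(y <- nb) q x y.
Proof.
have := rates.2 x.
rewrite (_ : \esum_(y in _) _ = (\sum_(y <- nb) q x y)%:E); first exact: fine_cvg.
transitivity (\esum_(y in [set` nb]) (q x y)%:E); last first.
  rewrite (esum_fset (finite_seq nb)); last by move=> y _; rewrite lee_fin.
  by rewrite -fsbig_seq// sumEFin.
rewrite esum_mkcond [RHS]esum_mkcond; apply: eq_esum => y _.
have [->|yx] := eqVneq y x.
  rewrite !ifF//; apply/negbTE; rewrite notin_setE /=; first exact/negP.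
  by rewrite eqxx.
rewrite [in LHS]mem_set//; have [ynb|ynb] := boolP (y \in nb).
  by rewrite mem_set.
by rewrite q_nb// if_same.
Qed.

Lemma cvg_seq_sum (l : seq S) (F : S -> R -> R) (a : S -> R) (c : S -> R) :
  (forall y, y \in l -> F y h @[h --> 0^'+] --> a y) ->
  \sum_(y <- l) F y h * c y @[h --> 0^'+] --> \sum_(y <- l) a y * c y.
Proof.
elim: l => [|y l IH] Fa.
  by under eq_fun do rewrite big_nil; rewrite big_nil; exact: cvg_cst.
under eq_fun do rewrite big_cons; rewrite big_cons.
apply: cvgD; first by apply: cvgMl; apply: Fa; rewrite mem_head.
by apply: IH => z zl; apply: Fa; rewrite inE zl orbT.
Qed.

Lemma rate_nb_cvg (c : S -> R) :
  \sum_(y <- nb) p h x y / h * c y @[h --> 0^'+] --> \sum_(y <- nb) q x y * c y.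
Proof.
apply: (cvg_seq_sum (F := fun y h => p h x y / h)) => y ynb.
by apply: rates.1; apply: contraNneq x_nb => ->.
Qed.

(** The probability of being neither at [x] nor in [nb] at time [h] is o(h), because the exit rate
    of [x] is the sum of the rates towards [nb]; a bounded [g] is thus averaged over [x :: nb] only,
    up to o(h). *)
Lemma semigroup_op_generator g M e : (forall y, 0 <= g y <= M) -> 0 < e ->
  \forall h \near 0^'+,
    `|T h g x - g x - h * \sum_(y <- nb) q x y * (g y - g x)| <= h * e.
Proof.
move=> g0 e0; have M0 : 0 <= M by case/andP: (g0 x) => /le_trans; apply.
(* The errors are [d] for the sum with [g], [M d] for the exit rate and [2 M d] for the mass outside
   [x :: nb]. *)
pose d := e / (3 * M + 1).
have d0 : 0 < d by rewrite divr_gt0//; lra.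
have dE : d * (3 * M + 1) = e by rewrite divfK// gt_eqF//; lra.
near=> h; have h0 : 0 < h by [].
have H1 : `|\sum_(y <- nb) q x y - (1 - p h x x) / h| <= d.
  by near: h; have /cvgrPdist_le := exit_rate; exact.
have H2 : `|\sum_(y <- nb) q x y * 1 - \sum_(y <- nb) p h x y / h * 1| <= d.
  by near: h; have /cvgrPdist_le := rate_nb_cvg (c := fun=> 1); exact.
have H3 : `|\sum_(y <- nb) q x y * g y - \sum_(y <- nb) p h x y / h * g y| <= d.
  by near: h; have /cvgrPdist_le := rate_nb_cvg (c := g); exact.
have ul : uniq (x :: nb) by rewrite /= x_nb.
have := semigroup_op_ge_sum tf x (ltW h0) ul g0.
have := semigroup_op_le_sum tf x (ltW h0) ul g0.
rewrite !big_cons.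
have E1 c : \sum_(y <- nb) p h x y * c y = h * \sum_(y <- nb) p h x y / h * c y.
  by rewrite mulr_sumr; apply: eq_bigr => y _; field; rewrite gt_eqF.
have E2 : \sum_(y <- nb) p h x y = h * \sum_(y <- nb) p h x y / h * 1.
  by rewrite -E1; apply: eq_bigr => y _; rewrite mulr1.
have E3 : p h x x = 1 - h * ((1 - p h x x) / h) by field; rewrite gt_eqF.
have E4 : \sum_(y <- nb) q x y * 1 = \sum_(y <- nb) q x y.
  by apply: eq_bigr => y _; rewrite mulr1.
have E5 : \sum_(y <- nb) q x y * (g y - g x) =
    \sum_(y <- nb) q x y * g y - (\sum_(y <- nb) q x y) * g x.
  by rewrite mulr_suml -sumrB; apply: eq_bigr => y _; rewrite mulrBr.
rewrite (E1 g) E2 E3 E5; move: H1 H2 H3; rewrite E4.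
set A := (1 - _) / h; set B := \sum_(y <- nb) _ / h * 1.
set C := \sum_(y <- nb) _ / h * g y; set Q := \sum_(y <- nb) q x y.
set D := \sum_(y <- nb) q x y * g y.
move=> H1 H2 H3 H4 H5.
have H6 : `|(Q - A) * g x| <= d * M.
  rewrite normrM ler_pM// ger0_norm; first by case/andP: (g0 x).
  by case/andP: (g0 x).
have H7 : M * (A - B) <= M * (2 * d).
  rewrite ler_wpM2l//; move: H1 H2; rewrite !ler_norml; lra.
rewrite -dE; move: H3 H6; rewrite !ler_norml => H3 H6.
have : h * (C - D + (Q - A) * g x + M * (A - B)) <= h * (d * (3 * M + 1)).
  rewrite ler_pM2l//; lra.
have : h * - (d * (3 * M + 1)) <= h * (C - D + (Q - A) * g x).
  rewrite ler_pM2l//; have : 0 <= d * M by rewrite mulr_ge0// ltW.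
  lra.
lra.
Unshelve. all: by end_near. Qed.

(** Writing [T (s + h) f = T h (T s f)] makes the right derivative at [s] that of [T h] at 0 on the
    bounded function [T s f]. *)
Lemma semigroup_op_dini f M s : 0 <= s -> (forall y, 0 <= f y <= M) ->
  dini_le (fun r => T r f x) s
    (\sum_(y <- nb) q x y * (T s f y - T s f x)) /\
  dini_le (fun r => - T r f x) s
    (- \sum_(y <- nb) q x y * (T s f y - T s f x)).
Proof.
move=> s0 f0.
have g0 y : 0 <= T s f y <= M.
  rewrite semigroup_op_ge0// ?(semigroup_op_le_cst tf)// => z.
  by case/andP: (f0 z).
split=> e e0; have H := semigroup_op_generator g0 e0; near=> h;
  (have : `|T h (T s f) x - T s f x -
     h * \sum_(y <- nb) q x y * (T s f y - T s f x)| <= h * e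
    by near: h; exact: H);
  have h0 : 0 < h by [];
  rewrite (addrC s h) (semigroup_op_comp tf x (ltW h0) s0 f0) ler_norml; lra.
Unshelve. all: by end_near. Qed.

(** Here [T s f = T h (T (s - h) f)] with an inner function depending on [h], so only its bound [M]
    is used: the change is at most [M] times the probability of not being at [x] at time [h], which
    is O(h). *)
Lemma semigroup_op_left_lsc f M s : 0 < s -> (forall y, 0 <= f y <= M) ->
  left_lsc (fun r => T r f x) s /\ left_lsc (fun r => - T r f x) s.
Proof.
move=> s0 f0; have M0 : 0 <= M by case/andP: (f0 x) => /le_trans; apply.
suff H e : 0 < e -> \forall h \near 0^'+, `|T s f x - T (s - h) f x| <= e.
  split=> e e0; near=> h;
    (have : `|T s f x - T (s - h) f x| <= e by near: h; exact: H);
    rewrite ler_norml; lra.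
move=> e0; near=> h; have h0 : 0 < h by [].
have hs : 0 <= s - h by rewrite subr_ge0; near: h; exact: nbhs_right_le.
have g0 y : 0 <= T (s - h) f y <= M.
  rewrite semigroup_op_ge0// ?(semigroup_op_le_cst tf)// => z.
  by case/andP: (f0 z).
have H1 : `|\sum_(y <- nb) q x y - (1 - p h x x) / h| <= 1.
  by near: h; have /cvgrPdist_le := exit_rate; apply.
have := semigroup_op_ge_sum tf x (ltW h0) (isT : uniq [:: x]) g0.
have := semigroup_op_le_sum tf x (ltW h0) (isT : uniq [:: x]) g0.
rewrite !big_seq1 -(semigroup_op_comp tf x (ltW h0) hs f0) (addrC h) subrK.
set t := T _ f x => H2 H3.
have p1 : 0 <= 1 - p h x x.
  have := semigroup_op_ge_sum tf x (M := 1) (g := fun=> 1) (ltW h0)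
    (isT : uniq [:: x]) (fun=> ltac:(by rewrite ler01 lexx)).
  by rewrite big_seq1 mulr1 (semigroup_op_cst tf)// ?subr_ge0// ltW.
have H4 : h * (M * (\sum_(y <- nb) q x y + 1)) <= e.
  by near: h; exact: near_scale_le.
have H5 : M * (1 - p h x x) <= e.
  apply: le_trans H4; rewrite mulrCA ler_wpM2l// mulrC -ler_pdivrMr//.
  move: H1; rewrite ler_norml; lra.
have : (1 - p h x x) * T (s - h) f x <= (1 - p h x x) * M.
  by rewrite ler_wpM2l//; case/andP: (g0 x).
have : 0 <= (1 - p h x x) * T (s - h) f x.
  by rewrite mulr_ge0//; case/andP: (g0 x).
rewrite ler_norml; move: H2 H3 H5; rewrite -/t; lra.
Unshelve. all: by end_near. Qed.

End BackwardEquation.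

Lemma dini_le_trans {R : realType} (f : R -> R) s l l' :
  l <= l' -> dini_le f s l -> dini_le f s l'.
Proof.
move=> ll' H e e0; near=> h; have h0 : 0 < h by [].
have : f (s + h) - f s <= h * (l + e) by near: h; exact: H.
have : h * (l + e) <= h * (l' + e) by rewrite ler_pM2l// lerD2r.
lra.
Unshelve. all: by end_near. Qed.

Lemma dini_leD {R : realType} (f g : R -> R) s l m :
  dini_le f s l -> dini_le g s m -> dini_le (fun r => f r + g r) s (l + m).
Proof.
move=> Hf Hg e e0; near=> h.
have : f (s + h) - f s <= h * (l + e / 2) by near: h; apply: Hf; lra.
have : g (s + h) - g s <= h * (m + e / 2) by near: h; apply: Hg; lra.
lra.
Unshelve. all: by end_near. Qed.

Lemma left_lscD {R : realType} (f g : R -> R) s :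
  left_lsc f s -> left_lsc g s -> left_lsc (fun r => f r + g r) s.
Proof.
move=> Hf Hg e e0; near=> h.
have : f s - f (s - h) <= e / 2 by near: h; apply: Hf; lra.
have : g s - g (s - h) <= e / 2 by near: h; apply: Hg; lra.
lra.
Unshelve. all: by end_near. Qed.

Lemma is_derive_dini_le {R : realType} (f : R -> R) (s l : R) :
  is_derive s 1 f l -> dini_le f s l.
Proof.
move=> [df fl] e e0.
have := df; rewrite /derivable => /cvg_ex[l' Hl'].
have El : l' = l.
  by rewrite -fl /derive; apply/esym/cvg_lim => //; exact: Hl'.
move/cvgrPdist_le : Hl' => /(_ e e0) [r /= r0 Hr].
exists r => //= h /= hr h0.
have := Hr h hr (lt0r_neq0 h0); rewrite El /= scaler1 distrC => /ler_normlW.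
by rewrite lerBlDl -[_ *: _]/(_ * _) (addrC h s) ler_pdivrMl.
Qed.

Lemma derivable_left_lsc {R : realType} (f : R -> R) (s : R) :
  derivable f s 1 -> left_lsc f s.
Proof.
move=> /derivable1_diffP/differentiable_continuous /cvgrPdist_le fc e e0.
have [r /= r0 Hr] := fc e e0.
exists r => //= h /= hr h0.
apply: le_trans (ler_norm _) _; apply: Hr => /=.
by move: hr; rewrite sub0r normrN opprB addrC subrK.
Qed.

(** * The generator of the chain *)

Section Generator.
Context {R : realType}.
Variables (d : nat) (la mu : R).

Definition origin : state d := exist (in_state d) (0, 0)%N isT.

(* Total: pairs that are not states, such as [(0, j)] with [0 < j], give the
   origin. *)
Definition mkstate (k j : nat) : state d := insubd origin (k, j).

Definition level (y : state d) : nat := (val y).1.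

Lemma val_mkstate k j : (0 < k)%N -> (1 <= j <= d)%N ->
  val (mkstate k j) = (k, j).
Proof. by move=> k0 jd; rewrite /mkstate insubdK// /in_state unfold_in /= k0 jd orbT. Qed.

Lemma mkstate0 j : mkstate 0 j = origin.
Proof.
apply: val_inj; rewrite /mkstate val_insubd /in_state /= orbF.
by case: ifP => // /eqP ->.
Qed.

Lemma mkstate_val (y : state d) : mkstate (val y).1 (val y).2 = y.
Proof. by apply: val_inj; rewrite /mkstate -surjective_pairing valKd. Qed.

Lemma level0 y : (level y == 0%N) = (y == origin).
Proof.
apply/idP/eqP => [/eqP|->//]; rewrite /level; case: y => -[k j] H /= k0.
by apply: val_inj => /=; have := H; rewrite k0 /in_state /= orbF => /eqP.
Qed.

Lemma val2_range (y : state d) : (0 < level y)%N -> (1 <= (val y).2 <= d)%N.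
Proof.
rewrite /level; case: y => -[k j] /= H k0; have := H.
by rewrite /in_state /= k0 xpair_eqE gtn_eqF.
Qed.

Lemma level_mkstate k j : (1 <= j <= d)%N -> level (mkstate k j) = k.
Proof.
move=> jd; case: k => [|k]; first by rewrite mkstate0.
by rewrite /level val_mkstate.
Qed.

Definition gen (f : state d -> R) (y : state d) : R :=
  let: (k, j) := val y in
  if k == 0%N then la * \sum_(1 <= i < d.+1) (f (mkstate 1 i) - f y)
  else (la + la * k%:R) * (f (mkstate k.+1 j) - f y)
       + mu * k%:R * (f (mkstate k.-1 j) - f y).

Definition neighbours (y : state d) : seq (state d) :=
  let: (k, j) := val y in
  if k == 0%N then [seq mkstate 1 i | i <- index_iota 1 d.+1]
  else [:: mkstate k.+1 j; mkstate k.-1 j].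

Local Notation q := (@rate R d la la mu).

Lemma neighbours_uniq y : uniq (neighbours y).
Proof.
rewrite /neighbours; case Ey: (val y) => [k j]; case: eqP => k0.
  rewrite map_inj_in_uniq ?iota_uniq// => i1 i2; rewrite !mem_index_iota => h1 h2.
  by move=> /(congr1 val); rewrite !val_mkstate// => -[].
have k1 : (0 < level y)%N by rewrite /level Ey /=; case: k k0 {Ey}.
have jd := val2_range k1; rewrite Ey /= in jd.
rewrite /= andbT inE; apply/eqP => /(congr1 level).
by rewrite !level_mkstate//; lia.
Qed.

Lemma notin_neighbours y : y \notin neighbours y.
Proof.
rewrite /neighbours; case Ey: (val y) => [k j]; case: eqP => k0.
  apply/mapP => -[i]; rewrite mem_index_iota => hi /(congr1 level).
  by rewrite level_mkstate// /level Ey /= k0.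
have k1 : (0 < level y)%N by rewrite /level Ey /=; case: k k0 {Ey}.
have jd := val2_range k1; rewrite Ey /= in jd.
rewrite !inE; apply/negP => /orP[] /eqP /(congr1 level);
  rewrite level_mkstate// /level Ey /=; lia.
Qed.

Lemma rate_notin_neighbours x y : y != x -> y \notin neighbours x -> q x y = 0.
Proof.
move=> yx; rewrite /neighbours /rate; case Ex: (val x) => [k i].
case Ey: (val y) => [l j]; have Hy := mkstate_val y; rewrite Ey /= in Hy.
case: eqP => k0.
  case: eqP => // l1; apply: contraNeq => _; apply/mapP; exists j.
    rewrite mem_index_iota ltnS.
    by have := @val2_range y; rewrite /level Ey l1; apply.
  by rewrite -Hy l1.
rewrite !inE negb_or => /andP[n1 n2].
case: ifP => [/andP[/eqP lk /eqP ij]|_]; first by rewrite -lk ij Hy eqxx in n1.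
case: ifP => // /andP[/eqP kl]; case: eqP => [l0 _|l0 /= /eqP ij].
  by move: n2; rewrite -Hy kl l0 /= !mkstate0 eqxx.
by move: n2; rewrite kl ij /= Hy eqxx.
Qed.

Lemma genE f y : gen f y = \sum_(x <- neighbours y) q y x * (f x - f y).
Proof.
rewrite /gen /neighbours /rate; case Ey: (val y) => [k j]; case: eqP => k0.
  rewrite big_map mulr_sumr !big_seq; apply: eq_bigr => i.
  by rewrite mem_index_iota => hi; rewrite val_mkstate.
have k1 : (0 < level y)%N by rewrite /level Ey /=; case: k k0 {Ey}.
have jd := val2_range k1; rewrite Ey /= in jd.
rewrite big_cons big_seq1 val_mkstate// !eqxx /=; congr (_ + _ * _).
case: k k0 k1 {Ey} => // -[|k] _ _; first by rewrite mkstate0.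
rewrite val_mkstate//= !eqxx; case: eqP => //; lia.
Qed.

Lemma genD f g y : gen (fun x => f x + g x) y = gen f y + gen g y.
Proof. by rewrite !genE -big_split; apply: eq_bigr => x _; rewrite /=; ring. Qed.

Lemma genZ c f y : gen (fun x => c * f x) y = c * gen f y.
Proof. by rewrite !genE mulr_sumr; apply: eq_bigr => x _; ring. Qed.

Lemma gen_cst c y : gen (fun=> c) y = 0.
Proof. by rewrite !genE big1// => x _; rewrite subrr mulr0. Qed.

(** On functions of the level the number [d] of types is seen only at the origin, which is left at
    total rate [la * d]. *)
Lemma gen_level (F : nat -> R) y :
  gen (fun x => F (level x)) y =
  if level y == 0%N then la * d%:R * (F 1%N - F 0%N)
  else (la + la * (level y)%:R) * (F (level y).+1 - F (level y))
       + mu * (level y)%:R * (F (level y).-1 - F (level y)).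
Proof.
rewrite /gen; case Ey: (val y) => [k j].
have Ek : level y = k by rewrite /level Ey.
rewrite Ek; case: eqP => k0.
  rewrite -mulrA; congr (_ * _); rewrite big_seq.
  rewrite (eq_bigr (fun=> F 1%N - F 0%N)); last first.
    move=> i; rewrite mem_index_iota => hi.
    by rewrite level_mkstate// k0.
  by rewrite -big_seq sumr_const_nat subn1 mulr_natl.
have jd := @val2_range y; rewrite Ek Ey in jd.
by rewrite !level_mkstate//; apply: jd; rewrite lt0n; exact/eqP.
Qed.

(** Makes [level + 1] an admissible Lyapunov function in [generator_comparison]. *)
Lemma finite_levels (K : R) :
  exists l : seq (state d), forall y, (level y).+1%:R <= K -> y \in l.
Proof.
exists [seq mkstate k i | k <- iota 0 (Num.bound K), i <- iota 0 d.+1] => y yK.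
apply/allpairsP; exists (val y); rewrite mkstate_val; split => //.
  rewrite mem_iota /= add0n.
  have : K < (Num.bound K)%:R by rewrite archi_boundP// (le_trans _ yK).
  by move/(le_lt_trans yK); rewrite ltr_nat; exact: ltn_trans.
rewrite mem_iota /=; have [y0|y0] := eqVneq (level y) 0%N.
  by move/eqP: y0; rewrite level0 => /eqP ->.
by have := @val2_range y; rewrite lt0n y0 => /(_ isT) /andP[_].
Qed.

Hypotheses (la_gt0 : 0 < la) (mu_gt0 : 0 < mu).

Lemma rate_ge0 (x y : state d) : 0 <= q x y.
Proof.
rewrite /rate; case: (val x) => k i; case: (val y) => l j.
have := ltW la_gt0; have := ltW mu_gt0; have : 0 <= k%:R :> R by [].
by move=> *; repeat case: ifP => // _; rewrite ?addr_ge0 ?mulr_ge0.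
Qed.

Lemma gen_mono f g y : (forall x, f x <= g x) -> f y = g y -> gen f y <= gen g y.
Proof.
move=> fg fgy; rewrite !genE; apply: ler_sum => x _.
by rewrite ler_wpM2l ?rate_ge0// fgy lerD2r.
Qed.

End Generator.

(* Pointwise forms of the differentiation rules, which the library states for
   the ring operations on functions. *)
Section DerivativeRules.
Context {R : realType}.
Implicit Types (f g : R -> R) (x a b c : R).

Lemma derive_cst c x : is_derive x 1 (fun=> c) 0.
Proof. exact: is_derive_cst. Qed.

Lemma derive_id x : is_derive x 1 (fun r => r) 1.
Proof. exact: is_derive_id. Qed.

Lemma derive_add f g x a b : is_derive x 1 f a -> is_derive x 1 g b ->
  is_derive x 1 (fun r => f r + g r) (a + b).
Proof. by move=> fa gb; exact: (is_deriveD (f := f) (g := g)). Qed.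

Lemma derive_sub f g x a b : is_derive x 1 f a -> is_derive x 1 g b ->
  is_derive x 1 (fun r => f r - g r) (a - b).
Proof. by move=> fa gb; exact: (is_deriveB (f := f) (g := g)). Qed.

Lemma derive_opp f x a : is_derive x 1 f a -> is_derive x 1 (fun r => - f r) (- a).
Proof. by move=> fa; exact: (is_deriveN (f := f)). Qed.

Lemma derive_mul f g x a b : is_derive x 1 f a -> is_derive x 1 g b ->
  is_derive x 1 (fun r => f r * g r) (a * g x + f x * b).
Proof.
move=> fa gb; have := is_deriveM (f := f) (g := g) (x := x) (v := 1).
by move=> /(_ _ _ fa gb); rewrite addrC [g x *: a]mulrC.
Qed.

Lemma derive_scale c f x a : is_derive x 1 f a ->
  is_derive x 1 (fun r => c * f r) (c * a).
Proof. by move=> fa; exact: (is_deriveZ (f := f)). Qed.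

Lemma derive_inv f x a : f x != 0 -> is_derive x 1 f a ->
  is_derive x 1 (fun r => (f r)^-1) (- a * (f x)^-1 ^+ 2).
Proof.
move=> fx fa; have := is_deriveV (f := f) fx fa; rewrite /GRing.scale/= mulrC.
by rewrite exprVn mulrN mulNr.
Qed.

Lemma derive_pow f n x a : is_derive x 1 f a ->
  is_derive x 1 (fun r => f r ^+ n) (n%:R * f x ^+ n.-1 * a).
Proof.
move=> fa; suff <- : f ^+ n = (fun r => f r ^+ n) by exact: is_deriveX.
by elim: n => [|n IH]; apply/funext => r //; rewrite !exprS IH.
Qed.

Lemma derive_comp f g x a b : is_derive (g x) 1 f a -> is_derive x 1 g b ->
  is_derive x 1 (fun r => f (g r)) (a * b).
Proof. by move=> fa gb; exact: (is_derive1_comp (f := f) (g := g)). Qed.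

Lemma derive_eq f x a b : is_derive x 1 f a -> a = b -> is_derive x 1 f b.
Proof. by move=> + <-. Qed.

Lemma derive_shift f a s l :
  is_derive (a + s) 1 f l -> is_derive s 1 (fun r => f (a + r)) l.
Proof.
move=> fl; apply: derive_eq (derive_comp (g := fun r => a + r) fl
  (derive_add (derive_cst a s) (derive_id s))) _.
by rewrite add0r mulr1.
Qed.

Lemma derive_linear c x : is_derive x 1 (fun r => c * r) c.
Proof. by apply: derive_eq (derive_scale c (derive_id x)) _; rewrite mulr1. Qed.

Lemma derive_expR c x :
  is_derive x 1 (fun r => expR (c * r)) (c * expR (c * x)).
Proof.
by apply: derive_eq (derive_comp (is_derive_expR _) (derive_linear c x)) (mulrC _ _).
Qed.

Lemma natfact_neq0 n : (n`!%:R : R) != 0.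
Proof. by rewrite pnatr_eq0 -lt0n fact_gt0. Qed.

Lemma derive_exp_fact n x :
  is_derive x 1 (fun r => r ^+ n.+1 / n.+1`!%:R) (x ^+ n / n`!%:R).
Proof.
apply: (derive_eq (derive_mul (derive_pow n.+1 (derive_id x))
  (derive_cst (n.+1`!%:R)^-1 x))).
rewrite factS natrM mulr0 addr0 mulr1 /=.
have := natfact_neq0 n; have := pnatr_eq0 R n.+1.
by move: (n.+1%:R : R) (n`!%:R : R) => u v u0 v0; field; rewrite v0 u0.
Qed.

Lemma derive_sum_nat (F : nat -> R -> R) (l : nat -> R) x m n :
  (forall i, (m <= i < n)%N -> is_derive x 1 (F i) (l i)) ->
  is_derive x 1 (fun v => \sum_(m <= i < n) F i v) (\sum_(m <= i < n) l i).
Proof.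
elim: n => [|n IH] H.
  by rewrite big_geq//; under eq_fun do rewrite big_geq//; exact: derive_cst.
have [mn|mn] := leqP m n.
  rewrite big_nat_recr//=; under eq_fun do rewrite big_nat_recr//=.
  apply: derive_add; last by apply: H; rewrite mn /=.
  by apply: IH => i /andP[mi ilt]; apply: H; rewrite mi ltnW.
by rewrite big_geq//; under eq_fun do rewrite big_geq//; exact: derive_cst.
Qed.

End DerivativeRules.

(** * The linear process *)

Section LinearGrowth.
Context {R : realType}.
Variables (la mu : R).
Hypotheses (la_gt0 : 0 < la) (mu_gt0 : 0 < mu) (mu_neq : mu != la).

(* [growth t] is the integral of [exp (- (mu - la) s)] over [0, t]. [bd_pgf z]
   is the generating function of the linear birth-death process started from
   one individual, and [imm_pgf z] that of the process with immigration at rate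
   [la] started from the empty population. *)
Definition growth (t : R) : R := (1 - expR (- (mu - la) * t)) / (mu - la).

Definition imm_pgf (z t : R) : R := (1 + la * (1 - z) * growth t)^-1.

Definition bd_pgf (z t : R) : R :=
  1 - (1 - z) * (1 - (mu - la) * growth t) * imm_pgf z t.

(** The time derivative of [imm_pgf z], in the form [la (w_t(1) - w_t(0))] that the generator takes
    at the origin for [d = 1]. *)
Definition imm_pgf' (z t : R) : R := la * (bd_pgf z t - 1) * imm_pgf z t.

Lemma mula_neq0 : mu - la != 0. Proof. by rewrite subr_eq0. Qed.

Lemma expR_growth t : 1 - (mu - la) * growth t = expR (- (mu - la) * t).
Proof. by rewrite /growth mulrC divfK ?mula_neq0//; ring. Qed.

Lemma growth0 : growth 0 = 0.
Proof. by rewrite /growth mulr0 expR0 subrr mul0r. Qed.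

Lemma growth_ge0 t : 0 <= t -> 0 <= growth t.
Proof.
move=> t0; rewrite /growth.
have [ml|ml] := ltP la mu.
  apply: divr_ge0; last by rewrite subr_ge0 ltW.
  rewrite subr_ge0 -expR0 ler_expR mulNr oppr_le0 mulr_ge0//.
  by rewrite subr_ge0 ltW.
rewrite -mulrNN mulr_ge0//.
  by rewrite opprB subr_ge0 -expR0 ler_expR mulr_ge0// oppr_ge0 subr_le0.
by rewrite -invrN invr_ge0 opprB subr_ge0.
Qed.

Lemma imm_pgf_den_gt0 z t : z <= 1 -> 0 <= t -> 0 < 1 + la * (1 - z) * growth t.
Proof.
move=> z1 t0; by rewrite ltr_pwDl// mulr_ge0 ?growth_ge0// mulr_ge0 ?subr_ge0// ltW.
Qed.

Lemma imm_pgf_gt0 z t : z <= 1 -> 0 <= t -> 0 < imm_pgf z t.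
Proof. by move=> z1 t0; rewrite invr_gt0 imm_pgf_den_gt0. Qed.

Lemma imm_pgf_le1 z t : z <= 1 -> 0 <= t -> imm_pgf z t <= 1.
Proof.
move=> z1 t0; rewrite invf_le1 ?imm_pgf_den_gt0// lerDl.
by rewrite mulr_ge0 ?growth_ge0// mulr_ge0 ?subr_ge0// ltW.
Qed.

Lemma bd_pgf_le1 z t : z <= 1 -> 0 <= t -> bd_pgf z t <= 1.
Proof.
move=> z1 t0; rewrite gerBl mulr_ge0 ?(ltW (imm_pgf_gt0 z1 t0))//.
by rewrite expR_growth mulr_ge0 ?expR_ge0// subr_ge0.
Qed.

Lemma bd_pgf_ge0 z t : 0 <= z <= 1 -> 0 <= t -> 0 <= bd_pgf z t.
Proof.
move=> /andP[z0 z1] t0; rewrite /bd_pgf subr_ge0.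
have D0 := imm_pgf_den_gt0 z1 t0.
rewrite /imm_pgf ler_pdivrMr// mul1r.
have g0 := growth_ge0 t0.
have : 0 <= (1 - z) * (mu * growth t).
  apply: mulr_ge0; first by rewrite subr_ge0.
  by rewrite mulr_ge0// ltW.
lra.
Qed.

Lemma imm_pgf'_le0 z t : z <= 1 -> 0 <= t -> imm_pgf' z t <= 0.
Proof.
move=> z1 t0; apply: mulr_le0_ge0; last exact: (ltW (imm_pgf_gt0 z1 t0)).
by apply: mulr_ge0_le0; [exact: (ltW la_gt0)|rewrite subr_le0; exact: (bd_pgf_le1 z1 t0)].
Qed.

Lemma imm_pgf'_ge z t : 0 <= z <= 1 -> 0 <= t -> - la <= imm_pgf' z t.
Proof.
move=> z01 t0; have /andP[z0 z1] := z01.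
have G0 := ltW (imm_pgf_gt0 z1 t0); have G1 := imm_pgf_le1 z1 t0.
have p0 := bd_pgf_ge0 z01 t0; have p1 := bd_pgf_le1 z1 t0.
rewrite /imm_pgf' -mulrA -[leLHS]mulrN1 ler_pM2l//.
have : (1 - bd_pgf z t) * imm_pgf z t <= 1 by rewrite mulr_ile1//; lra.
lra.
Qed.

Lemma imm_pgf0 z : imm_pgf z 0 = 1.
Proof. by rewrite /imm_pgf growth0 mulr0 addr0 invr1. Qed.

Lemma bd_pgf0 z : bd_pgf z 0 = z.
Proof. by rewrite /bd_pgf imm_pgf0 growth0; ring. Qed.

Lemma derive_growth (t : R) : is_derive t 1 growth (1 - (mu - la) * growth t).
Proof.
rewrite expR_growth; apply: (derive_eq
  (derive_mul (derive_sub (derive_cst 1 t) (derive_expR (- (mu - la)) t))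
     (derive_cst (mu - la)^-1 t))).
by field; rewrite mula_neq0.
Qed.

Lemma derive_imm_pgf z (t : R) : z <= 1 -> 0 <= t ->
  is_derive t 1 (imm_pgf z) (imm_pgf' z t).
Proof.
move=> z1 t0; have D0 := lt0r_neq0 (imm_pgf_den_gt0 z1 t0).
apply: (derive_eq (derive_inv (f := fun r => 1 + la * (1 - z) * growth r) D0 (derive_add (derive_cst 1 t)
  (derive_scale (la * (1 - z)) (derive_growth t))))).
by rewrite /imm_pgf' /bd_pgf /imm_pgf; ring.
Qed.

Lemma derive_bd_pgf z (t : R) : z <= 1 -> 0 <= t ->
  is_derive t 1 (bd_pgf z) ((bd_pgf z t - 1) * (la * bd_pgf z t - mu)).
Proof.
move=> z1 t0.
apply: (derive_eq (derive_sub (derive_cst 1 t) (derive_mul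
  (derive_scale (1 - z) (derive_sub (derive_cst 1 t)
     (derive_scale (mu - la) (derive_growth t))))
  (derive_imm_pgf z1 t0)))).
by rewrite /imm_pgf' /bd_pgf; ring.
Qed.

End LinearGrowth.

(** * The semigroup on the functions [imm_fun], uniformly in the state *)

Section Chain.
Context {R : realType}.
Variables (d : nat) (la mu : R).
Hypotheses (d_gt0 : (0 < d)%N) (la_gt0 : 0 < la) (mu_gt0 : 0 < mu) (mu_neq : mu != la).
Variable p : R -> state d -> state d -> R.
Hypotheses (tf : transition_function p).
Hypothesis rates : has_transition_rates p (rate la la mu).
Variable z : R.
Hypothesis z01 : 0 <= z <= 1.

Local Notation T := (semigroup_op p).
Local Notation gen := (gen la mu).
Local Notation G := (imm_pgf la mu).
Local Notation G' := (imm_pgf' la mu).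
Local Notation phi := (bd_pgf la mu).

Let z1 : z <= 1. Proof. by case/andP: z01. Qed.

Definition imm_fun (t : R) (y : state d) : R := G z t * phi z t ^+ level y.
Local Notation w := imm_fun.

(* By how much [gen] exceeds, at the origin, the generator of the case [d = 1]
   applied to [imm_fun t]; the two agree elsewhere. *)
Definition excess (t : R) : R := (d%:R - 1) * G' z t.
Local Notation b := excess.

Let d1 : 0 <= d%:R - 1 :> R. Proof. by rewrite subr_ge0 ler1n. Qed.

Lemma imm_fun_01 (t : R) y : 0 <= t -> 0 <= w t y <= 1.
Proof.
move=> t0; have := bd_pgf_ge0 la_gt0 mu_gt0 z01 t0.
have := bd_pgf_le1 la_gt0 mu_neq z1 t0.
have := imm_pgf_gt0 mu la_gt0 z1 t0; have := imm_pgf_le1 mu la_gt0 z1 t0.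
move=> G1 G0 p1 p0; rewrite mulr_ge0 ?exprn_ge0 ?(ltW G0)//=.
by rewrite mulr_ile1 ?exprn_ge0 ?exprn_ile1// ltW.
Qed.

Lemma excess_le0 (t : R) : 0 <= t -> b t <= 0.
Proof.
move=> t0; apply: mulr_ge0_le0 => //; exact: imm_pgf'_le0.
Qed.

Lemma excess_ge (t : R) : 0 <= t -> - ((d%:R - 1) * la) <= b t.
Proof.
by move=> t0; rewrite -mulrN ler_wpM2l//; exact: imm_pgf'_ge.
Qed.

Lemma excess_continuous (t : R) : 0 <= t -> {for t, continuous b}.
Proof.
move=> t0; apply: differentiable_continuous; apply/derivable1_diffP.
have := derive_scale (d%:R - 1) (derive_mul (derive_scale la (derive_sub
  (derive_bd_pgf la_gt0 mu_neq z1 t0) (derive_cst 1 t)))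
  (derive_imm_pgf la_gt0 mu_neq z1 t0)).
by case.
Qed.

(** From level [k > 0] this is the backward equation with birth rate [la (k + 1)]; at level 0 the
    time derivative is [G'] while [gen] gives [d G'], and the difference is [excess]. *)
Lemma derive_imm_fun (t : R) y : 0 <= t ->
  is_derive t 1 (fun r => w r y) (gen (w t) y - (y == origin d)%:R * b t).
Proof.
move=> t0.
apply: (derive_eq (derive_mul (derive_imm_pgf la_gt0 mu_neq z1 t0)
  (derive_pow (level y) (derive_bd_pgf la_gt0 mu_neq z1 t0)))).
rewrite (gen_level la mu (fun k => G z t * phi z t ^+ k)) -level0 /excess /imm_pgf'.
case: (level y) => [|k] /=.
  by rewrite !expr0 expr1; ring.
by rewrite !exprS -natr1; ring.
Qed.

(** Only levels 0 and 1 contribute, with values [- la d] and [mu]; this controls the generator on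
    the correction term of [semigroup_imm_fun]. *)
Lemma gen_origin_le y : `|gen (fun x => (x == origin d)%:R) y| <= la * d%:R + mu.
Proof.
have -> : (fun x => (x == origin d)%:R) = (fun x => (level x == 0%N)%:R) :> (_ -> R).
  by apply/funext => x; rewrite level0.
have l0 : 0 <= la * d%:R by rewrite mulr_ge0// ltW.
rewrite (gen_level la mu (fun k => (k == 0%N)%:R)).
case: (level y) => [|[|k]] /=.
- rewrite sub0r mulrN1 normrN ger0_norm//; have := ltW mu_gt0; lra.
- rewrite subrr mulr0 add0r !mulr1 subr0 mulr1 gtr0_norm//; lra.
- rewrite !subrr !mulr0 addr0 normr0; have := ltW mu_gt0; lra.
Qed.

(** For [c = 1] and [c = - 1], the function [c (T s w_a - w_(a+s) - s beta 1_origin) - eps s] has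
    its Dini derivative below its own generator: the defects are [b (a + s) - beta] at the origin
    and the generator of [s beta 1_origin], both paid for by [eps]. Starting from 0, it stays below
    0 at every state at once. *)
Lemma semigroup_imm_fun (a h beta eps : R) : 0 <= a -> 0 <= h ->
  (forall s, a <= s <= a + h -> `|b s - beta| + h * `|beta| * (la * d%:R + mu) <= eps) ->
  forall y, `|T h (w a) y - w (a + h) y - h * beta * (y == origin d)%:R| <= eps * h.
Proof.
move=> a0 h0 Heps.
have w01 : forall y, 0 <= w a y <= 1 by move=> y; exact: imm_fun_01.
have Tw s y : 0 <= s -> 0 <= T s (w a) y <= 1.
  move=> s0; rewrite semigroup_op_ge0//=; first exact: (semigroup_op_le_cst tf).
  by move=> x; case/andP: (w01 x).
suff H c : c = 1 \/ c = - 1 -> forall y,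
    c * T h (w a) y + (- c) * w (a + h) y + (- (c * beta * (y == origin d)%:R + eps)) * h <= 0.
  by move=> y; rewrite ler_norml; have := H 1 (or_introl erefl) y;
    have := H (- 1) (or_intror erefl) y; lra.
move=> c1.
have cn x : `|c * x| = `|x|.
  by case: c1 => ->; rewrite ?mul1r// mulN1r normrN.
(* The generator raises [level + 1] by [la d] at the origin and by at most [la (k + 1)] at level
   [k], hence by at most [la d] times itself. *)
apply: (@generator_comparison R (state d) gen (fun y => (level y).+1%:R) (la * d%:R) h
   (2 + `|beta| * h + `|eps| * h)
   (fun s y => c * T s (w a) y + (- c) * w (a + s) y +
               (- (c * beta * (y == origin d)%:R + eps)) * s)) => //.
- exact: gen_mono.
- move=> k y k0; rewrite genZ ler_pM2l//.
  rewrite (gen_level la mu (fun k => k.+1%:R)).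
  case: (level y) => [|n] /=; first by rewrite mulr1 -natrB//= mulr1.
  rewrite -!natr1.
  have : la * (n%:R + 1 + 1) <= la * d%:R * (n%:R + 1 + 1).
    by rewrite -mulrA ler_pM2l// ler_peMl ?ler1n// -!natrD.
  have : 0 <= mu * (n%:R + 1) by rewrite mulr_ge0 ?ltW// ltr_wpDl.
  lra.
- exact: finite_levels.
- by rewrite mulr_ge0// ltW.
- move=> s y /andP[s0 sh].
  have := Tw s y s0; have := imm_fun_01 y (addr_ge0 a0 s0).
  have : `|c * beta * (y == origin d)%:R| <= `|beta|.
    rewrite -mulrA cn normrM ler_piMr//; case: eqP => _; rewrite ?normr1 ?normr0//.
  move=> H1 H2 H3.
  have H4 : `|c * beta * (y == origin d)%:R + eps| <= `|beta| + `|eps|.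
    by apply: le_trans (ler_normD _ _) _; rewrite lerD2r.
  have H5 : - (c * beta * (y == origin d)%:R + eps) * s <= (`|beta| + `|eps|) * h.
    apply: le_trans (ler_norm _) _; rewrite normrM normrN ler_pM//.
    by rewrite ger0_norm.
  by case: c1 H5 => ->; lra.
- move=> y; rewrite addr0 (semigroup_op0 tf y w01); lra.
- move=> s y /andP[s0 sh].
  apply: left_lscD; last first.
    apply: derivable_left_lsc; case: (derive_linear (- (c * beta * (y == origin d)%:R + eps)) s) => //.
  apply: left_lscD; last first.
    apply: derivable_left_lsc.
    by have [] := derive_scale (- c) (derive_shift (derive_imm_fun y (addr_ge0 a0 (ltW s0)))).
  have [H1 H2] := semigroup_op_left_lsc tf rates (neighbours_uniq y) (notin_neighbours y)
    (rate_ge0 la_gt0 mu_gt0 y) (@rate_notin_neighbours R d la mu y) s0 w01.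
  by case: c1 => ->; [under eq_fun do rewrite mul1r|under eq_fun do rewrite mulN1r].
- move=> s y /andP[s0 sh].
  have [H1 H2] := semigroup_op_dini tf rates (neighbours_uniq y) (notin_neighbours y)
    (rate_ge0 la_gt0 mu_gt0 y) (@rate_notin_neighbours R d la mu y) s0 w01.
  have D1 : dini_le (fun r => c * T r (w a) y) s (c * gen (T s (w a)) y).
    rewrite genE; case: c1 => ->; [under eq_fun do rewrite mul1r|under eq_fun do rewrite mulN1r].
    - by rewrite mul1r.
    - by rewrite mulN1r.
  have D2 := is_derive_dini_le (derive_scale (- c) (derive_shift (derive_imm_fun y (addr_ge0 a0 s0)))).
  have D3 := is_derive_dini_le (derive_linear (- (c * beta * (y == origin d)%:R + eps)) s).
  apply: dini_le_trans (dini_leD (dini_leD D1 D2) D3).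
  rewrite !genD !genZ.
  have -> : gen (fun x => - (c * beta * (x == origin d)%:R + eps) * s) y =
      - s * (c * beta) * gen (fun x => (x == origin d)%:R) y.
    rewrite -genZ -[RHS]addr0 -(gen_cst la mu (- eps * s) y) -genD.
    by congr gen; apply/funext => x; ring.
  have := Heps (a + s) ltac:(lra).
  have := gen_origin_le y; set g0 := gen _ y => Hg.
  have H3 : s * (c * beta) * g0 <= h * `|beta| * (la * d%:R + mu).
    rewrite (_ : s * _ * _ = c * (s * beta * g0)); last by ring.
    apply: le_trans (ler_norm _) _; rewrite cn !normrM (ger0_norm s0).
    apply: ler_pM => //; first exact: mulr_ge0.
    by rewrite ler_wpM2r// ltW.
  have H4 : c * (y == origin d)%:R * (b (a + s) - beta) <= `|b (a + s) - beta|.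
    apply: le_trans (ler_norm _) _; rewrite -mulrA cn normrM ler_piMl//.
    by case: eqP => _; rewrite ?normr1 ?normr0.
  lra.
Qed.

End Chain.

Lemma ler_norm_sub {R : realType} (A B C E : R) :
  `|A - B - C| <= E -> A - C <= B + E /\ B <= A - C + E.
Proof. by rewrite ler_norml; lra. Qed.

Lemma ler_norm_subr {R : realType} (A B C E : R) :
  A - C <= B + E -> B <= A - C + E -> `|A - B - C| <= E.
Proof. by rewrite ler_norml; lra. Qed.

(** * The perturbation formula at the origin *)

Section Duhamel.
Context {R : realType}.
Variables (d : nat) (la mu : R).
Hypotheses (d_gt0 : (0 < d)%N) (la_gt0 : 0 < la) (mu_gt0 : 0 < mu) (mu_neq : mu != la).
Variable p : R -> state d -> state d -> R.
Hypotheses (tf : transition_function p).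
Hypothesis rates : has_transition_rates p (rate la la mu).
Variables (z t : R).
Hypotheses (z01 : 0 <= z <= 1) (t0 : 0 <= t).

Local Notation T := (semigroup_op p).
Local Notation w := (imm_fun la mu z).
Local Notation b := (excess d la mu z).
Local Notation o := (origin d).

Let M (s : R) : R := T s (w (t - s)) o.

(** [T s] averages the uniform estimate over the states and turns the indicator of the origin into
    [p s o o]. As [beta <= 0], the correction is carried as [h * - beta], for the rules on [T s]
    concern nonnegative functions. *)
Let M_step (s h beta eps : R) : 0 <= s -> 0 <= h -> s + h <= t -> beta <= 0 ->
  (forall r, t - s - h <= r <= t - s ->
     `|b r - beta| + h * `|beta| * (la * d%:R + mu) <= eps) ->
  `|M (s + h) - M s - h * beta * p s o o| <= eps * h.
Proof.
move=> s0 h0 sht beta0 Heps.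
have a0 : 0 <= t - s - h by lra.
have K0 : 0 <= h * `|beta| * (la * d%:R + mu).
  apply: mulr_ge0; first exact: mulr_ge0.
  by rewrite addr_ge0 ?(ltW mu_gt0)// mulr_ge0// ltW.
have eps0 : 0 <= eps.
  have := Heps (t - s) ltac:(lra); have := normr_ge0 (b (t - s) - beta); lra.
have step := semigroup_imm_fun d_gt0 la_gt0 mu_gt0 mu_neq tf rates z01 a0 h0 (beta := beta) (eps := eps).
rewrite subrK in step; have {}step := step Heps.
have w01 := fun y : state d => imm_fun_01 la_gt0 mu_gt0 mu_neq z01 y a0.
have w01' : forall y : state d, 0 <= w (t - s) y <= 1.
  by move=> y; apply: imm_fun_01 => //; lra.
have T01 (y : state d) : 0 <= T h (w (t - s - h)) y <= 1.
  rewrite semigroup_op_ge0// ?(semigroup_op_le_cst tf)// => x.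
  by case/andP: (w01 x).
have delta01 (y : state d) : 0 <= ((y == o)%:R : R) <= 1 by case: eqP; rewrite ?lexx ler01.
have hb0 : 0 <= h * - beta by rewrite mulr_ge0// oppr_ge0.
have eh0 : 0 <= eps * h by rewrite mulr_ge0.
have ME : M (s + h) = T s (T h (w (t - s - h))) o.
  by rewrite /M opprD addrA (semigroup_op_comp tf _ s0 h0 w01).
have hd01 (y : state d) : 0 <= h * - beta * (y == o)%:R <= h * - beta.
  by rewrite mulr_ge0 ?ler_piMr//; case/andP: (delta01 y).
have ceh (y : state d) : 0 <= eps * h <= eps * h by rewrite eh0 lexx.
have Thd : T s (fun y => h * - beta * (y == o)%:R) o = h * - beta * p s o o.
  by rewrite (semigroup_opZ tf _ s0 hb0 delta01) semigroup_op_delta.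
have E1 := semigroup_opD tf o s0 T01 hd01.
have E2 := semigroup_opD tf o s0 w01' ceh.
have Thd01 (y : state d) : 0 <= T h (w (t - s - h)) y + h * - beta * (y == o)%:R <= 1 + h * - beta.
  case/andP: (T01 y) => ? ?; case/andP: (hd01 y) => ? ?.
  by rewrite addr_ge0//= lerD.
have E3 := semigroup_opD tf o s0 Thd01 ceh.
rewrite semigroup_op_cst// in E2 E3.
have L1 : T s (fun y => T h (w (t - s - h)) y + h * - beta * (y == o)%:R) o <=
          T s (fun y => w (t - s) y + eps * h) o.
  apply: (semigroup_op_le tf (M := 1 + eps * h)) => // y.
  - by case/andP: (Thd01 y).
  - by rewrite mulrN mulNr; case: (ler_norm_sub (step y)).
  - by rewrite lerD2r; case/andP: (w01' y).
have L2 : T s (w (t - s)) o <=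
    T s (fun y => T h (w (t - s - h)) y + h * - beta * (y == o)%:R + eps * h) o.
  apply: (semigroup_op_le tf (M := 1 + h * - beta + eps * h)) => // y.
  - by case/andP: (w01' y).
  - by rewrite mulrN mulNr; case: (ler_norm_sub (step y)).
  - by rewrite lerD2r; case/andP: (Thd01 y).
by move: L1 L2; rewrite ME E1 E2 E3 E1 Thd mulrN mulNr; exact: ler_norm_subr.
Qed.

Let sup_excess : 0 <= (d%:R - 1) * la.
Proof. by rewrite mulr_ge0 ?subr_ge0 ?ler1n// ltW. Qed.

Let M_left_lsc (c s : R) : c = 1 \/ c = -1 -> 0 < s <= t -> left_lsc (fun r => c * M r) s.
Proof.
move=> c1 /andP[s0 st] e e0; near=> h; have h0 : 0 < h by [].
have hs : h <= s by near: h; exact: nbhs_right_le.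
have he : h * ((d%:R - 1) * la) <= e by near: h; exact: near_scale_le.
(* With [beta = 0] the estimate is a Lipschitz bound, [excess] being at most [(d - 1) la] in
   absolute value. *)
have := @M_step (s - h) h 0 ((d%:R - 1) * la) _ (ltW h0).
rewrite subrK => /(_ _ st (lexx _)); rewrite mulr0 mul0r subr0 => H.
have : `|M s - M (s - h)| <= (d%:R - 1) * la * h.
  apply: H; first by rewrite subr_ge0.
  move=> r Hr; have r0 : 0 <= r by lra.
  rewrite subr0 normr0 mulr0 mul0r addr0 ler_norml.
  have := excess_le0 d_gt0 la_gt0 mu_neq z01 r0.
  have := excess_ge d_gt0 la_gt0 mu_gt0 mu_neq z01 r0.
  move: sup_excess; lra.
rewrite ler_norml; case: (c1) => ->; lra.
Unshelve. all: by end_near. Qed.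

(** Here [beta] is the value of [excess] at [t - s]: its continuity costs half of [e], the term of
    order [h] the other half. *)
Let M_dini (c s : R) : c = 1 \/ c = -1 -> 0 <= s < t ->
  dini_le (fun r => c * M r) s (c * (p s o o * b (t - s))).
Proof.
move=> c1 /andP[s0 st] e e0.
have ts0 : 0 <= t - s by lra.
have /cvgrPdist_le /(_ (e / 2)) := excess_continuous (d := d) la_gt0 mu_neq z01 ts0.
case; first by rewrite divr_gt0.
move=> r /= r0 Hr; near=> h; have h0 : 0 < h by [].
have ht : h <= t - s by near: h; apply: nbhs_right_le; lra.
have hr : h < r by near: h; exact: nbhs_right_lt.
have hb : h * (`|b (t - s)| * (la * d%:R + mu)) <= e / 2.
  by near: h; apply: near_scale_le; rewrite divr_gt0.
have := @M_step s h (b (t - s)) e s0 (ltW h0) _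
  (excess_le0 d_gt0 la_gt0 mu_neq z01 ts0).
move=> H; have : `|M (s + h) - M s - h * b (t - s) * p s o o| <= e * h.
  apply: H; first lra.
  move=> x Hx; rewrite -mulrA.
  have : `|b (t - s) - b x| <= e / 2.
    apply: Hr => /=; rewrite ger0_norm; lra.
  rewrite distrC; lra.
rewrite ler_norml; case: (c1) => ->; lra.
Unshelve. all: by end_near. Qed.

(* [Psi] plays the role of a primitive of [p s o o * b (t - s)], up to an error
   controlled by [eta]. *)
Lemma duhamel (Psi psi eta eta' : R -> R) :
  (forall s, 0 <= s <= t -> is_derive s 1 Psi (psi s)) ->
  (forall s, 0 <= s <= t -> is_derive s 1 eta (eta' s)) ->
  (forall s, 0 <= s < t -> `|p s o o * b (t - s) - psi s| <= eta' s) ->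
  `|T t (fun y => z ^+ level y) o - imm_pgf la mu z t - (Psi t - Psi 0)|
    <= eta t - eta 0.
Proof.
move=> dPsi deta H.
have Mt : M t = T t (fun y => z ^+ level y) o.
  have -> : (fun y : state d => z ^+ level y) = w 0.
    by apply/funext => y; rewrite /imm_fun imm_pgf0 bd_pgf0 mul1r.
  by rewrite /M subrr.
have M0 : M 0 = imm_pgf la mu z t.
  rewrite /M subr0 (semigroup_op0 tf (M := 1)); first by rewrite /imm_fun expr0 mulr1.
  by move=> y; exact: imm_fun_01.
suff Hc (c : R) : c = 1 \/ c = - 1 ->
    c * M t + (- c) * Psi t + (- 1) * eta t <= c * M 0 + (- c) * Psi 0 + (- 1) * eta 0.
  have := Hc 1 (or_introl erefl); have := Hc (-1) (or_intror erefl).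
  by rewrite -Mt -M0 ler_norml; lra.
move=> c1; apply: (@dini_le_le R
  (fun s => c * M s + (- c) * Psi s + (- 1) * eta s)) => // s Hs.
  have Hs' : 0 <= s <= t by lra.
  apply: left_lscD; last first.
    by apply: derivable_left_lsc; case: (derive_scale (- 1) (deta s Hs')).
  apply: left_lscD; last first.
    by apply: derivable_left_lsc; case: (derive_scale (- c) (dPsi s Hs')).
  exact: M_left_lsc.
have Hs' : 0 <= s <= t by lra.
apply: dini_le_trans (dini_leD (dini_leD (M_dini c1 Hs)
  (is_derive_dini_le (derive_scale (- c) (dPsi s Hs'))))
  (is_derive_dini_le (derive_scale (- 1) (deta s Hs')))).
have := H s Hs; rewrite ler_norml; case: (c1) => ->; lra.
Qed.

End Duhamel.

(** * The generating function of the process *)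

Section PgfSemigroup.
Context {R : realType} {disp : measure_display} {Omega : measurableType disp}.
Variables (P : probability Omega R) (d : nat) (X : R -> Omega -> state d).
Variable p : R -> state d -> state d -> R.
Hypotheses (tf : transition_function p) (mk : markov_property P X p).
Hypothesis start : starts_at_0 P X.

Local Notation T := (semigroup_op p).
Local Notation o := (origin d).

(** The Markov property from time 0 with an empty past; the conditioning event has probability 1. *)
Lemma cond_pr_at_state t y : 0 <= t ->
  cond_pr P (at_state X t (val y)) (at_state X 0 (0, 0)%N) = p t o y.
Proof.
move=> t0; have at_stateE s (x : state d) : at_state X s (val x) = [set w | X s w = x].
  by apply/seteqP; split=> w; [exact: val_inj|rewrite /at_state /= => ->].
have past0 : past_event X [::] = setT by apply/seteqP; split.
have := mk (H := [::]) o y (lexx 0) t0 (fun us => ltac:(by rewrite in_nil)).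
rewrite past0 !setTI add0r -!at_stateE /cond_pr setIC => ->.
by rewrite (start : P (at_state X 0 (val o)) = 1%E) mul1e /= divr1.
Qed.

Definition states_below (n : nat) : seq (state d) :=
  o :: [seq mkstate d k j | k <- index_iota 1 n, j <- index_iota 1 d.+1].

Lemma states_below_uniq n : uniq (states_below n).
Proof.
rewrite /states_below cons_uniq; apply/andP; split.
  apply/allpairsP => -[[k j] [/=]]; rewrite !mem_index_iota => kn jd /(congr1 (@level d)).
  by rewrite level_mkstate//; rewrite /level /=; lia.
apply: allpairs_uniq; rewrite ?iota_uniq// => -[k j] [k' j'].
move=> /allpairsP[[a b] [/= +  + [-> ->]]] /allpairsP[[a' b'] [/= + + [-> ->]]] /=.
rewrite !mem_index_iota => ha hb ha' hb' /(congr1 val).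
by rewrite !val_mkstate//; [case: (andP ha') => ->|case: (andP ha) => ->].
Qed.

Lemma mem_states_below n y : (level y < n)%N -> y \in states_below n.
Proof.
move=> yn; rewrite inE; have [y0|y0] := posnP (level y).
  by move/eqP : y0; rewrite level0 => ->.
apply/orP; right; apply/allpairsP; exists (val y); rewrite mkstate_val.
by have := val2_range y0; rewrite !mem_index_iota -/(level y) y0 yn ltnS.
Qed.

Lemma sum_states_below n (F : state d -> R) :
  \sum_(y <- states_below n) F y =
  F o + \sum_(1 <= k < n) \sum_(1 <= j < d.+1) F (mkstate d k j).
Proof. by rewrite /states_below big_cons big_allpairs_dep. Qed.

(** By nonexplosion the total mass is 1: a finite set of states carries all but [e] of it, and lies
    below some level. *)
Lemma mass_states_below (t e : R) : 0 <= t -> 0 < e ->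
  \forall n \near \oo, 1 - e <= \sum_(y <- states_below n) p t o y.
Proof.
move=> t0 e0; have := tf_mass1 tf o t0; rewrite /esum => E.
have : ((1 - e)%:E < ereal_sup
    [set \sum_(x \in A) (p t o x)%:E | A in fsets [set: state d]])%E.
  by rewrite [X in (_ < X)%E]E lte_fin; lra.
move=> /ereal_sup_gt[_ [A [finA _] <-]].
rewrite fsbig_finite// sumEFin lte_fin => Ae.
have := finmap.fset_uniq (fset_set A); move: Ae.
set l : seq (state d) := finmap.enum_fset _ => Ae ul.
exists (\max_(x <- l) (level x).+1)%N => // n /= Nn; apply: (le_trans (ltW Ae)).
have sub : {subset l <= states_below n}.
  move=> y yl; apply: mem_states_below; apply: leq_trans Nn.
  exact: (@leq_bigmax_seq _ l xpredT (fun x => (level x).+1) y yl).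
rewrite [leRHS](bigID (fun y => y \in l)) /= -[leLHS]addr0.
apply: lerD; last by apply: sumr_ge0 => y _; exact: (tf_ge0 tf).
rewrite -[leRHS]big_filter le_eqVlt; apply/orP; left; apply/eqP.
apply: perm_big; apply: uniq_perm; rewrite ?filter_uniq ?states_below_uniq// => y.
by rewrite mem_filter; apply/idP/andP => [yA|[]//]; split=> //; exact: sub.
Qed.

Lemma pgf_partial_sum z t n : 0 <= t ->
  p_zero P X t + \sum_(1 <= k < n) z ^+ k * P_level P X k t =
  \sum_(y <- states_below n) p t o y * z ^+ level y.
Proof.
move=> t0; rewrite sum_states_below /p_zero (cond_pr_at_state o t0) expr0 mulr1.
congr (_ + _); rewrite !big_seq; apply: eq_bigr => k; rewrite mem_index_iota => kn.
rewrite /P_level mulr_sumr !big_seq; apply: eq_bigr => j; rewrite mem_index_iota => jd.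
rewrite level_mkstate// mulrC -cond_pr_at_state// val_mkstate//.
by case/andP: kn.
Qed.

Let pow01 (z : R) (y : state d) : 0 <= z <= 1 -> 0 <= z ^+ level y <= 1.
Proof. by move=> /andP[z0 z1]; rewrite exprn_ge0//= exprn_ile1. Qed.

Lemma pgf_cvg (z t e : R) : 0 <= z <= 1 -> 0 <= t -> 0 < e -> \forall n \near \oo,
  \sum_(y <- states_below n) p t o y * z ^+ level y <=
  T t (fun y => z ^+ level y) o <=
  \sum_(y <- states_below n) p t o y * z ^+ level y + e.
Proof.
move=> z01 t0 e0; have := mass_states_below t0 e0; apply: filterS => n Hn.
have f01 := fun y : state d => pow01 y z01.
rewrite (semigroup_op_ge_sum tf _ t0 (states_below_uniq n) f01)/=.
have := semigroup_op_le_sum tf o t0 (states_below_uniq n) f01.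
rewrite mul1r => /le_trans; apply; rewrite lerD2l; lra.
Qed.

Lemma pgf_semigroup_op (z t : R) : 0 <= z <= 1 -> 0 <= t ->
  pgf P X z t = T t (fun y => z ^+ level y) o.
Proof.
move=> z01 t0; rewrite /pgf.
suff H : (fun n => \sum_(1 <= k < n) z ^+ k * P_level P X k t) @ \oo -->
    T t (fun y => z ^+ level y) o - p_zero P X t.
  by rewrite (cvg_lim _ H)// addrC subrK.
apply/cvgrPdist_le => e e0; have := pgf_cvg z01 t0 e0.
apply: filterS => n; rewrite -pgf_partial_sum// ler_norml; lra.
Qed.

(** The tail of the series is at most the mass outside a finite set of states, whatever [z], so the
    approximation by polynomials is uniform on [0, 1]. This reaches the removable singularities. *)
Lemma pgf_continuous (z t : R) : 0 <= z <= 1 -> 0 <= t ->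
  pgf P X x t @[x --> within `[0, 1] (nbhs z)] --> pgf P X z t.
Proof.
move=> z01 t0; apply/cvgrPdist_le => e e0.
have e2 : 0 < e / 2 by rewrite divr_gt0.
have := mass_states_below t0 e2.
case=> n _ /(_ n (leqnn n)) Hn.
pose S (x : R) := \sum_(y <- states_below n) p t o y * x ^+ level y.
have SP x : 0 <= x <= 1 -> S x <= pgf P X x t <= S x + e / 2.
  move=> x01; rewrite pgf_semigroup_op//.
  have f01 := fun y : state d => pow01 y x01.
  rewrite (semigroup_op_ge_sum tf _ t0 (states_below_uniq n) f01)/=.
  have := semigroup_op_le_sum tf o t0 (states_below_uniq n) f01.
  rewrite mul1r => /le_trans; apply; rewrite lerD2l; lra.
have Sc : S x @[x --> z] --> S z.
  rewrite /S; elim: (states_below n) => [|y l IH].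
    by under eq_fun do rewrite big_nil; rewrite big_nil; exact: cvg_cst.
  under eq_fun do rewrite big_cons; rewrite big_cons.
  apply: cvgD; last exact: IH.
  by apply: cvgMr; exact: exprn_continuous.
move/cvgrPdist_le : Sc => /(_ _ e2) Sc.
rewrite near_withinE; near=> x => /=; rewrite in_itv /= => x01.
have : `|S z - S x| <= e / 2 by near: x.
have := SP x x01; have := SP z z01; rewrite !ler_norml; lra.
Unshelve. all: by end_near. Qed.

End PgfSemigroup.

(** * Power series *)

Section PowerSeries.
Context {R : realType}.
Implicit Types (a b : nat -> R) (r y l : R).

Definition cvg_on a r := forall y, `|y| < r -> cvgn (pseries a y).

Definition psum a y := limn (pseries a y).

Definition cauchy_prod a b n := \sum_(0 <= i < n.+1) a i * b (n - i)%N.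

Lemma cvg_on_psum a r y : cvg_on a r -> `|y| < r -> pseries a y @ \oo --> psum a y.
Proof. by move=> Ca yr; apply: Ca. Qed.

Lemma cvg_on_norm a r y : cvg_on a r -> `|y| < r ->
  cvgn (pseries (fun i => `|a i|) `|y|).
Proof.
move=> Ca yr; have y0 := normr_ge0 y.
have r0 : 0 < r by exact: le_lt_trans yr.
have Cm : cvgn (pseries a ((`|y| + r) / 2)) by apply: Ca; rewrite ger0_norm; lra.
apply: is_cvg_pseries_inside_norm Cm _; rewrite normr_id [ltRHS]ger0_norm; lra.
Qed.

Lemma cvgn_norm_le (u v : R^nat) : (forall n, `|u n| <= v n) ->
  cvgn (series v) -> cvgn (series u).
Proof.
move=> u_v cv; apply: normed_cvg.
apply: series_le_cvg cv => [n|n|n]; [exact: normr_ge0| |exact: u_v].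
exact: le_trans (normr_ge0 _) (u_v n).
Qed.

Lemma sum_geometric_deriv (q : R) n : 0 <= q < 1 ->
  \sum_(0 <= i < n) i.+1%:R * q ^+ i <= ((1 - q) ^+ 2)^-1.
Proof.
move=> /andP[q0 q1]; have d0 : 0 < (1 - q) ^+ 2 by rewrite exprn_gt0// subr_gt0.
rewrite -[leRHS]mul1r ler_pdivlMr// mulrC.
have -> : (1 - q) ^+ 2 * \sum_(0 <= i < n) i.+1%:R * q ^+ i =
    1 - n.+1%:R * q ^+ n + n%:R * q ^+ n.+1.
  elim: n => [|n IH]; first by rewrite big_nil expr0 expr1; ring.
  by rewrite big_nat_recr//= mulrDr IH !exprS -!natr1; ring.
have qn := exprn_ge0 n q0.
have : q * q ^+ n <= q ^+ n by rewrite ler_piMl// ltW.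
have : n%:R * (q * q ^+ n) <= n%:R * q ^+ n.
  by rewrite ler_wpM2l// ler_piMl// ltW.
rewrite exprS -natr1; lra.
Qed.

(** Convergence at an intermediate [s] bounds [|a n| s ^ n], and the differentiated series is
    dominated by that of [(n + 1) q ^ n] with [q = |y| / s < 1]. *)
Lemma cvg_on_diffs a r : cvg_on a r -> cvg_on (pseries_diffs a) r.
Proof.
move=> Ca y yr; have y0 := normr_ge0 y.
pose s := (`|y| + r) / 2.
have ys : `|y| < s by rewrite /s; lra.
have s0 : 0 < s by rewrite (le_lt_trans y0).
have Cs : cvgn (pseries a s) by apply: Ca; rewrite ger0_norm /s; lra.
have [K [_ HK]] := cvg_series_bounded Cs.
have {}HK n : `|a n * s ^+ n| <= `|K| + 1.
  by apply: HK => //; rewrite (le_lt_trans (ler_norm K))// ltrDl.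
have K0 : 0 <= `|K| + 1 by rewrite addr_ge0.
pose q := `|y| / s.
have q01 : 0 <= q < 1 by rewrite divr_ge0 ?(ltW s0)//= ltr_pdivrMr// mul1r.
apply: (@cvgn_norm_le _ (fun i => (`|K| + 1) / s * (i.+1%:R * q ^+ i))).
  move=> n; rewrite /pseries_diffs normrM normrM normrX (ger0_norm (ler0n _ _)).
  have -> : (`|K| + 1) / s * (n.+1%:R * q ^+ n) =
      n.+1%:R * ((`|K| + 1) / s ^+ n.+1) * `|y| ^+ n.
    by rewrite /q exprMn exprVn exprS; field; rewrite expf_neq0 !gt_eqF.
  rewrite ler_wpM2r ?exprn_ge0// ler_wpM2l// ler_pdivlMr ?exprn_gt0//.
  by rewrite -(gtr0_norm (exprn_gt0 n.+1 s0)) -normrM.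
apply: nondecreasing_is_cvgn.
  apply/nondecreasing_seqP => n; rewrite /series /= big_nat_recr//= lerDl.
  case/andP: q01 => q0 _.
  apply: mulr_ge0; first by rewrite divr_ge0// ltW.
  by rewrite mulr_ge0// exprn_ge0.
exists ((`|K| + 1) / s * ((1 - q) ^+ 2)^-1) => _ [n _ <-] /=.
rewrite /series /= -mulr_sumr; apply: ler_wpM2l; last exact: sum_geometric_deriv.
by rewrite divr_ge0// ltW.
Qed.

Lemma derive_psum a r y : cvg_on a r -> `|y| < r ->
  is_derive y 1 (psum a) (psum (pseries_diffs a) y).
Proof.
move=> Ca yr; have y0 := normr_ge0 y.
pose s := (`|y| + r) / 2.
have sr : `|s| < r by rewrite /s ger0_norm; lra.
have ys : `|y| < `|s| by rewrite /s [ltRHS]ger0_norm; lra.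
apply: (pseries_snd_diffs (K := s)) => //; first exact: Ca.
  exact: (cvg_on_diffs Ca).
exact: (cvg_on_diffs (cvg_on_diffs Ca)).
Qed.

Lemma psum0 a : psum a 0 = a 0%N.
Proof.
apply: cvg_lim => //; rewrite -(cvg_shiftS (pseries a 0)).
rewrite (_ : (fun n => _) = (fun=> a 0%N)); first exact: cvg_cst.
apply/funext => n; rewrite /pseries /series /= big_nat_recl//= expr0 mulr1.
by rewrite big1 ?addr0// => i _; rewrite exprS mul0r mulr0.
Qed.

Lemma psum_continuous a r y : cvg_on a r -> `|y| < r -> {for y, continuous (psum a)}.
Proof.
move=> Ca yr; apply: differentiable_continuous; apply/derivable1_diffP.
by case: (derive_psum Ca yr).
Qed.

Lemma pseries_shift a y n :
  pseries a y n.+1 = a 0%N + y * pseries (fun i => a i.+1) y n.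
Proof.
rewrite /pseries /series /= big_nat_recl//= expr0 mulr1 mulr_sumr; congr (_ + _).
by apply: eq_bigr => i _; rewrite exprS; ring.
Qed.

Lemma pseries_cvg0_head a r : 0 < r ->
  (forall y, 0 < y < r -> pseries a y @ \oo --> 0) -> a 0%N = 0.
Proof.
move=> r0 Ha.
have Ca : cvg_on a (r / 2).
  move=> y yr; have Cm : cvgn (pseries a (r / 2)).
    by apply/cvg_ex; exists 0; apply: Ha; lra.
  apply: is_cvg_pseries_inside Cm _; rewrite [ltRHS]ger0_norm; lra.
have Cc : psum a x @[x --> 0^'+] --> psum a 0.
  apply: cvg_at_right_filter; apply: (psum_continuous Ca).
  by rewrite normr0; lra.
rewrite -psum0; apply/esym.
suff H : psum a x @[x --> 0^'+] --> 0 by exact: (cvg_unique _ H Cc).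
apply: cvg_near_cst; near=> x.
have x0 : 0 < x by [].
have xr : x < r by near: x; exact: nbhs_right_lt.
by apply: cvg_lim => //; apply: Ha; rewrite x0.
Unshelve. all: by end_near. Qed.

(** Continuity at 0 gives the constant coefficient, and dividing by [y] passes to the shifted
    sequence. *)
Lemma pseries_cvg0_eq0 a r : 0 < r ->
  (forall y, 0 < y < r -> pseries a y @ \oo --> 0) -> forall n, a n = 0.
Proof.
move=> r0 Ha n; elim: n a Ha => [|n IH] a Ha; first exact: pseries_cvg0_head Ha.
apply: (IH (fun i => a i.+1)) => y /[dup] yr /andP[y0 _].
have a0 := pseries_cvg0_head r0 Ha.
have H : pseries a y n.+1 @[n --> \oo] --> 0 by rewrite cvg_shiftS; exact: Ha.
have -> : pseries (fun i => a i.+1) y = (fun m => y^-1 * pseries a y m.+1).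
  by apply/funext => m; rewrite pseries_shift a0 add0r mulKf// gt_eqF.
by rewrite -(mulr0 y^-1); exact: cvgMr H.
Qed.

Lemma sum_conv (u v : R^nat) N :
  \sum_(0 <= n < N) \sum_(0 <= i < n.+1) u i * v (n - i)%N =
  \sum_(0 <= i < N) u i * series v (N - i)%N.
Proof.
elim: N => [|N IH]; first by rewrite !big_nil.
rewrite big_nat_recr//= IH [RHS]big_nat_recr//= [in LHS]big_nat_recr//= addrA.
rewrite !subnn subSnn; congr (_ + _); last by rewrite /series /= big_nat1.
rewrite -big_split; apply: eq_big_nat => i /andP[_ iN] /=.
by rewrite subSn ?(ltnW iN)// /series /= big_nat_recr//= mulrDr.
Qed.

(** The gap to the product is the convolution of [u] with [series v - V]: its early terms are small
    by convergence of [v], its late ones by the absolutely summable tail of [u]. *)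
Lemma mertens (u v : R^nat) : cvgn [normed series u] -> cvgn (series v) ->
  series (fun n => \sum_(0 <= i < n.+1) u i * v (n - i)%N) @ \oo -->
  limn (series u) * limn (series v).
Proof.
move=> cu cv; set V := limn (series v).
have Cu : series u @ \oo --> limn (series u) by exact: normed_cvg.
have Cv : series v @ \oo --> V by [].
suff H : \sum_(0 <= i < N) u i * (series v (N - i)%N - V) @[N --> \oo] --> 0.
  rewrite (_ : series _ = (fun N =>
      \sum_(0 <= i < N) u i * (series v (N - i)%N - V) + series u N * V)).
    by rewrite -[X in _ --> X]add0r; apply: cvgD H _; exact: cvgMl.
  apply/funext => N; rewrite [LHS]/series /= sum_conv /=.
  by rewrite /series /= mulr_suml -big_split; apply: eq_bigr => i _ /=; ring.
pose A N := \sum_(0 <= i < N) `|u i|.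
have {}cu : cvgn A by exact: cu.
have Amono : nondecreasing_seq A.
  by apply/nondecreasing_seqP => n; rewrite /A big_nat_recr//= lerDl.
set W := limn A.
have WN N : A N <= W by exact: nondecreasing_cvgn_le.
have W_ge0 : 0 <= W by apply: le_trans (WN 0%N); rewrite /A sumr_ge0.
have CvV : (fun n => series v n - V) @ \oo --> 0.
  by rewrite -(subrr V); apply: cvgB Cv _; exact: cvg_cst.
have [B [_ HB]] := cvg_seq_bounded (cvgP _ CvV).
have {}HB n : `|series v n - V| <= `|B| + 1.
  by apply: HB => //; rewrite (le_lt_trans (ler_norm B))// ltrDl.
have B0 : 0 < `|B| + 1 by rewrite ltr_wpDl.
apply/cvgrPdist_le => e e0.
have d0 : 0 < e / 2 / (W + 1) by rewrite !divr_gt0// ltr_wpDl.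
have [K _ HK] : \forall n \near \oo, `|series v n - V| <= e / 2 / (W + 1).
  by move/cvgr0Pnorm_le : CvV; apply.
have f0 : 0 < e / 2 / (`|B| + 1) by rewrite !divr_gt0.
have [N1 _ HN1] : \forall n \near \oo,
    `|W - A n| <= e / 2 / (`|B| + 1).
  by move/cvgrPdist_le : (cu : A @ \oo --> W); apply.
exists (N1 + K)%N => // N /= NK; rewrite sub0r normrN.
apply: le_trans (ler_norm_sum _ _ _) _.
rewrite (@big_cat_nat _ _ _ N1)//=; last by apply: leq_trans NK; rewrite leq_addr.
rewrite (splitr e); apply: lerD.
  apply: (@le_trans _ _ (\sum_(0 <= i < N1) `|u i| * (e / 2 / (W + 1)))).
    apply: ler_sum_nat => i /andP[_ iN]; rewrite normrM ler_wpM2l//.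
    by apply: HK => /=; lia.
  rewrite -mulr_suml -/(A N1).
  have -> : A N1 * (e / 2 / (W + 1)) = e / 2 * (A N1 / (W + 1)) by ring.
  rewrite ger_pMr ?divr_gt0// ler_pdivrMr ?ltr_wpDl// mul1r.
  by rewrite (le_trans (WN N1))// lerDl.
apply: (@le_trans _ _ (\sum_(N1 <= i < N) `|u i| * (`|B| + 1))).
  by apply: ler_sum_nat => i _; rewrite normrM ler_wpM2l.
rewrite -mulr_suml -ler_pdivlMr//.
have := HN1 N1 (leqnn _); rewrite ger0_norm ?subr_ge0//; apply: le_trans.
have := WN N; rewrite /A (@big_cat_nat _ _ _ N1)//=; last first.
  by apply: leq_trans NK; rewrite leq_addr.
by rewrite lerBrDl.
Unshelve. all: by end_near. Qed.

Lemma sum_cauchy_prodE a b y N :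
  pseries (cauchy_prod a b) y N = \sum_(0 <= n < N) \sum_(0 <= i < n.+1)
    (a i * y ^+ i) * (b (n - i)%N * y ^+ (n - i)).
Proof.
rewrite /pseries /series /=; apply: eq_bigr => n _.
rewrite /cauchy_prod mulr_suml; apply: eq_big_nat => i /andP[_ ij].
have <- : y ^+ i * y ^+ (n - i) = y ^+ n by rewrite -exprD subnKC.
by ring.
Qed.

Lemma pseries_cauchy_prod a b r y : cvg_on a r -> cvg_on b r -> `|y| < r ->
  pseries (cauchy_prod a b) y @ \oo --> psum a y * psum b y.
Proof.
move=> Ca Cb yr.
have := @mertens (fun i => a i * y ^+ i) (fun i => b i * y ^+ i).
rewrite (_ : series _ = pseries (cauchy_prod a b) y); last first.
  by apply/funext => n; rewrite sum_cauchy_prodE.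
apply; last exact: Cb.
have := cvg_on_norm Ca yr; rewrite /pseries /normed_series_of /series /=.
by under eq_fun do under eq_bigr do rewrite -normrX -normrM.
Qed.

Lemma sum_conv_le (u v : R^nat) N : (forall i, 0 <= u i) -> (forall i, 0 <= v i) ->
  \sum_(0 <= n < N) \sum_(0 <= i < n.+1) u i * v (n - i)%N <=
  series u N * series v N.
Proof.
move=> u0 v0; rewrite sum_conv /series /= mulr_suml; apply: ler_sum => i _.
rewrite ler_wpM2l// [leRHS](@big_cat_nat _ _ _ (N - i)) ?leq_subr//= lerDl.
by apply: sumr_ge0.
Qed.

Lemma pseries_cauchy_prod_le a b y N : (forall i, 0 <= a i) ->
  (forall i, 0 <= b i) -> 0 <= y ->
  pseries (cauchy_prod a b) y N <= pseries a y N * pseries b y N.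
Proof.
move=> a0 b0 y0; rewrite sum_cauchy_prodE.
by apply: sum_conv_le => i; rewrite mulr_ge0// exprn_ge0.
Qed.

Lemma derive_pseries a N y :
  is_derive y 1 (fun w => pseries a w N.+1) (pseries (pseries_diffs a) y N).
Proof.
rewrite /pseries /series /=; elim: N => [|N IH].
  rewrite big_nil; under eq_fun do rewrite big_nat1 expr0; exact: derive_cst.
rewrite big_nat_recr//=; under eq_fun do rewrite big_nat_recr//=.
apply: derive_eq (derive_add IH
  (derive_scale (a N.+1) (derive_pow N.+1 (derive_id y)))) _.
by rewrite /pseries_diffs /=; ring.
Qed.

Lemma pseries_ge0 a y N : (forall i, 0 <= a i) -> 0 <= y -> 0 <= pseries a y N.
Proof. by move=> a0 y0; apply: sumr_ge0 => i _; rewrite mulr_ge0// exprn_ge0. Qed.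

Lemma pseries_sub a y K M : (K <= M)%N ->
  pseries a y M - pseries a y K = \sum_(K <= i < M) a i * y ^+ i.
Proof.
move=> KM; rewrite /pseries /series /= (@big_cat_nat _ _ _ K 0 M)//=.
by rewrite addrAC subrr add0r.
Qed.

Lemma pseries_mono a y : (forall i, 0 <= a i) -> 0 <= y ->
  nondecreasing_seq (pseries a y).
Proof.
move=> a0 y0; apply/nondecreasing_seqP => n.
by rewrite /pseries /series /= big_nat_recr//= lerDl mulr_ge0// exprn_ge0.
Qed.

Lemma cvg_on_ge0 a r (F : R -> R) : (forall i, 0 <= a i) ->
  (forall N y, 0 <= y < r -> pseries a y N <= F y) -> cvg_on a r.
Proof.
move=> a0 aF y yr; apply: (@cvgn_norm_le _ (fun i => a i * `|y| ^+ i)).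
  by move=> n; rewrite normrM normrX ger0_norm.
apply: nondecreasing_is_cvgn; first by apply: pseries_mono.
by exists (F `|y|) => _ [n _ <-]; apply: aF; rewrite normr_ge0.
Qed.

End PowerSeries.

(** * Eulerian polynomials and the coefficients theta *)

Section EulerianSeries.
Context {R : realType}.
Variables (x : R) (E : nat -> R).
Hypotheses (x_gt0 : 0 < x) (x_neq1 : x != 1).

Let x1 : x - 1 != 0. Proof. by rewrite subr_eq0. Qed.

(* The reciprocal of the generating function of the Eulerian polynomials at
   [x], and its coefficients. *)
Definition recip (u : R) := (x - expR ((x - 1) * u)) / (x - 1).
Definition recip_coef (n : nat) := (x *+ (n == 0%N) - (x - 1) ^+ n / n`!%:R) / (x - 1).

(** The unique zero of [recip], positive whether [x < 1] or [x > 1]. *)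
Definition eulerian_radius := ln x / (x - 1).
Local Notation rho := eulerian_radius.

Definition euler_coef n := E n / n`!%:R.
Local Notation a := euler_coef.

Lemma pseries_recip u : pseries recip_coef u @ \oo --> recip u.
Proof.
rewrite -(cvg_shiftS (pseries recip_coef u)).
have -> : (fun n => pseries recip_coef u n.+1) =
    (fun n => (x - pseries (fun n => n`!%:R^-1) ((x - 1) * u) n.+1) / (x - 1)).
  apply/funext => n; rewrite /pseries /series /= !big_nat_recl//=.
  have -> : \sum_(0 <= i < n) recip_coef i.+1 * u ^+ i.+1 =
      - (\sum_(0 <= i < n) (i.+1)`!%:R^-1 * ((x - 1) * u) ^+ i.+1) / (x - 1).
    rewrite mulNr mulr_suml -sumrN; apply: eq_bigr => i _.
    rewrite /recip_coef mulr0n exprMn; field.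
    by rewrite x1 pnatr_eq0 -lt0n fact_gt0.
  by rewrite /recip_coef mulr1n !expr0 fact0; field.
apply: cvgMl; apply: cvgB; first exact: cvg_cst.
rewrite (cvg_shiftS (pseries _ _)) expRE.
have := is_cvg_series_exp_coeff ((x - 1) * u).
by rewrite exp_coeffE.
Qed.

Lemma cvg_on_recip r : cvg_on recip_coef r.
Proof. by move=> u _; apply/cvg_ex; exists (recip u); exact: pseries_recip. Qed.

Lemma psum_recip u : psum recip_coef u = recip u.
Proof. by apply: cvg_lim => //; exact: pseries_recip. Qed.

Lemma eulerian_radius_gt0 : 0 < rho.
Proof.
rewrite /eulerian_radius; have [xlt1|xgt1] := ltP x 1.
  by rewrite nmulr_rgt0 ?ln_lt0 ?x_gt0// invr_lt0 subr_lt0.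
have x1' : 1 < x by rewrite lt_neqAle eq_sym x_neq1.
by rewrite divr_gt0 ?ln_gt0// subr_gt0.
Qed.

Lemma recip_gt0 u : u < rho -> 0 < recip u.
Proof.
rewrite /eulerian_radius /recip; have [xlt1|xgt1] := ltP x 1.
  rewrite ltr_ndivlMr ?subr_lt0// => ux.
  rewrite nmulr_lgt0 ?invr_lt0 ?subr_lt0// -{1}(@lnK _ x) ?posrE//.
  by rewrite ltr_expR mulrC.
have x1' : 1 < x by rewrite lt_neqAle eq_sym x_neq1.
rewrite ltr_pdivlMr ?subr_gt0// => ux.
rewrite divr_gt0 ?subr_gt0// -{2}(@lnK _ x) ?posrE//.
by rewrite ltr_expR mulrC.
Qed.

Lemma recip_le1 u : 0 <= u -> recip u <= 1.
Proof.
move=> u0; rewrite /recip; have [xlt1|xgt1] := ltP x 1.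
  rewrite ler_ndivrMr ?subr_lt0// mul1r lerD2l lerN2 -[leRHS]expR0 ler_expR.
  by rewrite mulr_le0_ge0// subr_le0 ltW.
have x1' : 1 < x by rewrite lt_neqAle eq_sym x_neq1.
rewrite ler_pdivrMr ?subr_gt0// mul1r lerD2l lerN2 -[leLHS]expR0 ler_expR.
by rewrite mulr_ge0// subr_ge0.
Qed.

Lemma derive_recip (u : R) : is_derive u 1 recip ((x - 1) * recip u - x).
Proof.
apply: (derive_eq (derive_mul (derive_sub (derive_cst x u) (derive_expR (x - 1) u))
  (derive_cst (x - 1)^-1 u))).
by rewrite /recip; field.
Qed.

Lemma derive_recipV (u : R) : u < rho -> is_derive u 1 (fun v => (recip v)^-1)
  ((recip u)^-1 * (1 + x * ((recip u)^-1 - 1))).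
Proof.
move=> ur; have g0 := lt0r_neq0 (recip_gt0 ur).
apply: (derive_eq (derive_inv g0 (derive_recip u))).
by field.
Qed.

Hypothesis eulerian_ratio_gf : \forall u \near (0 : R),
  (fun n => \sum_(0 <= i < n) E i * u ^+ i / i`!%:R) @ \oo -->
    (x - 1) / (x - expR (u * (x - 1))).

Lemma euler_near : exists2 r, 0 < r <= rho &
  forall u, `|u| < r -> pseries a u @ \oo --> (recip u)^-1.
Proof.
case: eulerian_ratio_gf => r /= r0 Hr; exists (Num.min r rho).
  by rewrite lt_min r0 eulerian_radius_gt0 ge_min lexx orbT.
move=> u; rewrite lt_min => /andP[ur _].
have -> : (recip u)^-1 = (x - 1) / (x - expR (u * (x - 1))).
  by rewrite /recip invf_div (mulrC u).
have : ball_ Num.norm 0 r u by rewrite /= sub0r normrN.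
move=> /Hr; rewrite (_ : (fun n => _) = pseries a u)//.
apply/funext => n; rewrite /pseries /series /=.
by apply: eq_bigr => i _; rewrite /euler_coef; ring.
Qed.

(** The generating function is given near 0 only; turned into an identity between coefficients, the
    product relation with [recip] can be used again on the whole disc of convergence. *)
Lemma euler_coef_recip n : cauchy_prod a recip_coef n = (n == 0%N)%:R.
Proof.
have [r /andP[r0 rr] Hr] := euler_near.
have Ca : cvg_on a r by move=> u /Hr/cvgP.
apply/eqP; rewrite -subr_eq0; apply/eqP; move: n.
apply: (@pseries_cvg0_eq0 _ (fun n => cauchy_prod a recip_coef n - (n == 0%N)%:R) r r0).
move=> y /andP[y0 yr].
have yr' : `|y| < r by rewrite gtr0_norm.
have := pseries_cauchy_prod Ca (@cvg_on_recip r) yr'.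
have psa : psum a y = (recip y)^-1 by apply: cvg_lim => //; exact: Hr.
rewrite psum_recip psa mulVf; last first.
  by rewrite gt_eqF// recip_gt0// (lt_le_trans yr).
rewrite -(cvg_shiftS (pseries (cauchy_prod _ _) _)) => H.
rewrite -(cvg_shiftS (pseries _ _)).
have -> : (fun n => pseries (fun n => cauchy_prod a recip_coef n - (n == 0%N)%:R) y n.+1) =
   (fun n => pseries (cauchy_prod a recip_coef) y n.+1 - 1).
  apply/funext => n; rewrite /pseries /series /= !big_nat_recl//=.
  under eq_bigr do rewrite subr0.
  by rewrite expr0; ring.
have : (fun n => pseries (cauchy_prod a recip_coef) y n.+1 - 1) @ \oo --> (1 - 1 : R).
  by apply: cvgB H _; exact: cvg_cst.
by rewrite subrr.
Qed.

(** The Riccati equation [f' = f (1 + x (f - 1))] of [f = 1 / recip], read on coefficients. *)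
Lemma euler_coefS n :
  n.+1%:R * a n.+1 = a n + x * (cauchy_prod a a n - a n).
Proof.
have [r /andP[r0 rr] Hr] := euler_near.
have Ca : cvg_on a r by move=> u /Hr/cvgP.
apply/eqP; rewrite -subr_eq0; apply/eqP; move: n.
apply: (@pseries_cvg0_eq0 _ (fun n => n.+1%:R * a n.+1 -
  (a n + x * (cauchy_prod a a n - a n))) r r0).
move=> y /andP[y0 yr].
have yr' : `|y| < r by rewrite gtr0_norm.
have yrho : y < rho by exact: lt_le_trans yr rr.
have psa u : `|u| < r -> psum a u = (recip u)^-1 by move=> /Hr /(cvg_lim _); apply.
have H1 := cvg_on_psum Ca yr'.
have H2 := cvg_on_psum (cvg_on_diffs Ca) yr'.
have H3 := pseries_cauchy_prod Ca Ca yr'.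
have D : psum (pseries_diffs a) y = (recip y)^-1 * (1 + x * ((recip y)^-1 - 1)).
  have near_r : \forall u \near y, (recip u)^-1 = psum a u.
    exists (r - `|y|); first by rewrite /= subr_gt0.
    move=> u /= uy; apply/esym/psa.
    by have := ler_normB y (y - u); rewrite subKr; lra.
  have [_ <-] := derive_psum Ca yr'.
  by have [_ ->] := near_eq_is_derive near_r (derive_recipV yrho).
have L0 : psum (pseries_diffs a) y -
    (psum a y + x * (psum a y * psum a y - psum a y)) = 0.
  by rewrite D psa//; ring.
have := cvgB H2 (cvgD H1 (cvgMr (a := x) (cvgB H3 H1))); rewrite L0 => Hc.
suff -> : pseries (fun n => n.+1%:R * a n.+1 - (a n + x * (cauchy_prod a a n - a n))) y =
  (fun n => pseries (pseries_diffs a) y n -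
    (pseries a y n + x * (pseries (cauchy_prod a a) y n - pseries a y n)))
  by exact: Hc.
apply/funext => n; rewrite /pseries /series /= -sumrB mulr_sumr -big_split -sumrB /=.
by apply: eq_bigr => i _; rewrite /pseries_diffs; ring.
Qed.

Lemma euler_coef0 : a 0%N = 1.
Proof.
have := euler_coef_recip 0; rewrite /cauchy_prod big_nat1 subnn /recip_coef.
rewrite mulr1n expr0 fact0 divr1 divff ?mulr1//.
Qed.

Lemma euler_coef1 : a 1%N = 1.
Proof.
have := euler_coefS 0.
by rewrite mul1r /cauchy_prod big_nat1 subnn euler_coef0 mulr1 subrr mulr0 addr0.
Qed.

(** Since [a 0 = 1], the first term of the Cauchy square cancels [- a n] in the recurrence, and only
    nonnegative products remain. *)
Lemma euler_coef_ge0 n : 0 <= a n.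
Proof.
elim/ltn_ind: n => -[_|n IH]; first by rewrite euler_coef0.
rewrite -(pmulr_rge0 _ (ltr0Sn R n)) euler_coefS addr_ge0 ?IH//.
rewrite mulr_ge0 ?(ltW x_gt0)// /cauchy_prod big_nat_recl//= euler_coef0 mul1r subn0.
rewrite addrC addKr big_nat; apply: sumr_ge0 => i /andP[_ ilt].
by rewrite mulr_ge0 ?IH//; lia.
Qed.

(* [f = 1 / recip] solves [f' = f (1 + x (f - 1))], and by nonnegativity of the
   coefficients each partial sum has derivative at most
   [S (1 + x (S - 1))], [S] being the preceding partial sum. *)
Lemma pseries_euler_le N u : 0 <= u < rho -> pseries a u N <= (recip u)^-1.
Proof.
move=> /andP[u0 ur]; elim: N => [|N IH] in u u0 ur *.
  by rewrite /pseries /series /= big_nil invr_ge0 ltW// recip_gt0.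
have aX v i : 0 <= v -> 0 <= a i * v ^+ i.
  by move=> v0; rewrite mulr_ge0 ?euler_coef_ge0// exprn_ge0.
have dD (v : R) : 0 <= v < rho -> pseries (pseries_diffs a) v N <=
    (recip v)^-1 * (1 + x * ((recip v)^-1 - 1)).
  move=> /andP[v0 vr]; have {}IH := IH v v0 vr.
  have f1 : 1 <= (recip v)^-1 by rewrite invf_ge1 ?recip_gt0// recip_le1.
  have xf : 1 <= 1 + x * ((recip v)^-1 - 1).
    by rewrite lerDl mulr_ge0 ?(ltW x_gt0)// subr_ge0.
  case: N IH => [_|N IH].
    by rewrite {1}/pseries /series /= big_nil mulr_ge0// ?(le_trans ler01).
  have S1 : 1 <= pseries a v N.+1.
    rewrite /pseries /series /= big_nat_recl//= euler_coef0 mulr1 lerDl.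
    by apply: sumr_ge0 => i _; exact: aX.
  have S0 : 0 <= pseries a v N.+1 by exact: le_trans S1.
  apply: (@le_trans _ _ (pseries a v N.+1 * (1 + x * (pseries a v N.+1 - 1)))).
    have conv : pseries (cauchy_prod a a) v N.+1 <= pseries a v N.+1 ^+ 2.
      by rewrite expr2; apply: pseries_cauchy_prod_le => //; exact: euler_coef_ge0.
    have -> : pseries (pseries_diffs a) v N.+1 = pseries a v N.+1 +
        x * (pseries (cauchy_prod a a) v N.+1 - pseries a v N.+1).
      rewrite /pseries /series /= -sumrB mulr_sumr -big_split /=.
      by apply: eq_bigr => i _; rewrite /pseries_diffs euler_coefS; ring.
    have : x * pseries (cauchy_prod a a) v N.+1 <= x * pseries a v N.+1 ^+ 2.
      by rewrite ler_pM2l.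
    lra.
  apply: ler_pM => //; first by rewrite addr_ge0// mulr_ge0 ?(ltW x_gt0)// subr_ge0.
  by rewrite lerD2l ler_pM2l// lerB.
have : pseries a u N.+1 - (recip u)^-1 <= pseries a 0 N.+1 - (recip 0)^-1.
  apply: (@dini_le_le R (fun v => pseries a v N.+1 + - (recip v)^-1)) => // v Hv.
    apply: left_lscD; apply: derivable_left_lsc; first by case: (derive_pseries a N v).
    have vr : v < rho by lra.
    by case: (derive_opp (derive_recipV vr)).
  have vr : v < rho by lra.
  apply: dini_le_trans (dini_leD (is_derive_dini_le (derive_pseries a N v))
     (is_derive_dini_le (derive_opp (derive_recipV vr)))).
  by rewrite subr_le0; apply: dD; lra.
rewrite [pseries a 0 _]pseries_shift mul0r addr0 euler_coef0 /recip mulr0 expR0.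
by rewrite divff// invr1 subrr subr_le0.
Qed.

Lemma cvg_on_euler : cvg_on a rho.
Proof. exact: (cvg_on_ge0 euler_coef_ge0 pseries_euler_le). Qed.

Lemma psum_euler u : `|u| < rho -> psum a u = (recip u)^-1.
Proof.
move=> ur; have H := pseries_cauchy_prod cvg_on_euler (@cvg_on_recip rho) ur.
have : psum a u * recip u = 1.
  rewrite -psum_recip -(cvg_lim _ H)//; apply: cvg_lim => //.
  rewrite -(cvg_shiftS (pseries _ _)); under eq_fun do rewrite pseries_shift.
  rewrite euler_coef_recip; apply: cvg_near_cst; apply: nearW => n.
  rewrite /pseries /series /= big1 ?mulr0 ?addr0// => i _.
  by rewrite euler_coef_recip mul0r.
by move=> /(canRL (mulfK _)) -> //; [rewrite mul1r|rewrite gt_eqF// recip_gt0// (le_lt_trans _ ur)// ler_norm].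
Qed.

End EulerianSeries.

(** * Powers of formal series *)

Section FormalPowers.
Context {R : realType}.
Implicit Types b : nat -> R.

Fixpoint formal_pow b (i n : nat) : R :=
  if i is j.+1 then cauchy_prod b (formal_pow b j) n else (n == 0%N)%:R.

Lemma formal_pow0 b n : formal_pow b 0 n = (n == 0%N)%:R. Proof. by []. Qed.

Lemma formal_powS b i n :
  formal_pow b i.+1 n = cauchy_prod b (formal_pow b i) n.
Proof. by []. Qed.

(** Coefficients up to [N] depend only on the truncation at degree [N], which gives access to the
    algebra of polynomials. *)
Lemma formal_powE b i N n : (n <= N)%N ->
  formal_pow b i n = ((\poly_(k < N.+1) b k) ^+ i)`_n.
Proof.
elim: i n => [|i IH] n nN; first by rewrite expr0 coef1.
rewrite exprS coefM /= /cauchy_prod big_mkord; apply: eq_bigr => -[j jn] _ /=.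
rewrite coef_poly IH ?(leq_trans (leq_subr _ _))//.
by rewrite ltnS (leq_trans _ nN).
Qed.

Lemma formal_pow_eq0 b h i n : (forall k, (k < h)%N -> b k = 0) ->
  (n < h * i)%N -> formal_pow b i n = 0.
Proof.
move=> b0; elim: i n => [|i IH] n; first by rewrite muln0.
rewrite mulnS => nlt /=; rewrite /cauchy_prod big_nat big1// => j /andP[_ jn].
have [jh|hj] := ltnP j h; first by rewrite b0// mul0r.
by rewrite IH ?mulr0//; lia.
Qed.

(** The binomial theorem for [b = X + b2]; the factor [X ^ (i + 1 - j)] shifts the degree to
    [j + n - (i + 1)], an honest subtraction since [i < n]. *)
Lemma formal_pow_shift b b2 i n : b 0%N = 0 -> b 1%N = 1 -> b2 0%N = 0 ->
  b2 1%N = 0 -> (forall k, (1 < k)%N -> b2 k = b k) -> (i < n)%N ->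
  formal_pow b i.+1 n =
  \sum_(0 <= j < i.+2) 'C(i.+1, j)%:R * formal_pow b2 j (j + n - i.+1).
Proof.
move=> b0 b1 b20 b21 b2b lin.
rewrite (@formal_powE b i.+1 n n)//.
have -> : \poly_(k < n.+1) b k = 'X + \poly_(k < n.+1) b2 k :> {poly R}.
  apply/polyP => k; rewrite coefD coefX !coef_poly.
  case: k => [|[|k]]; rewrite ?b0 ?b20 ?addr0//=.
    by rewrite b1 b21 if_same addr0 ifT// ltnS (leq_trans _ lin).
  by rewrite add0r b2b.
rewrite exprDn coef_sum big_mkord; apply: eq_bigr => -[j ji] _ /=.
rewrite coefMn coefXnM ltnNge mulr_natl; congr (_ *+ _).
have ij : (i.+1 - j <= n)%N by lia.
rewrite ij /= (@formal_powE b2 j n)//; last by lia.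
by congr (_`_ _); lia.
Qed.

End FormalPowers.

Arguments formal_pow : simpl never.

(** * The coefficients [theta] *)

Section Theta.
Context {R : realType}.
Variables (A : nat -> {poly R}) (d : nat) (la mu : R).
Local Notation E n := (A n).[mu / la].
Hypothesis eulerian_ratio1 : E 1%N = 1.

(** With [a = sum_n A_n(mu / la) X^n], the series [tail1] is [a - 1] and [tail2] is [a - 1 - X], as
    [A_1 = 1]. *)
Definition tail1 (n : nat) : R := if (1 <= n)%N then E n else 0.
Definition tail2 (n : nat) : R := if (2 <= n)%N then E n else 0.

(** Distributing the [j]-th power gives a sum over all tuples; those with an entry below 2
    contribute 0. *)
Lemma Q_formal_pow j m : Q A la mu j m = formal_pow tail2 j m.
Proof.
rewrite (formal_powE _ _ (leqnn m)) -[in RHS](card_ord j) -prodr_const.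
rewrite poly_def (eq_bigr (fun=> \sum_(s < m.+1) tail2 s *: 'X^s))//.
rewrite bigA_distr_bigA coef_sum /Q big_mkcond /=; apply: eq_bigr => s _.
have -> : \prod_(i < j) (tail2 (s i) *: 'X^(s i)) =
    (\prod_(i < j) tail2 (s i)) *: 'X^(\sum_(i < j) s i) :> {poly R}.
  by rewrite scaler_prod -expr_sum.
rewrite coefZ coefXn; case: ifP => [/andP[/forallP s2 /eqP sm]|].
  rewrite sm eqxx mulr1; apply: eq_bigr => i _.
  by rewrite /tail2 s2.
move=> /negbT; rewrite negb_and => /orP[/forallPn[i si]|sm].
  rewrite (bigD1 i)//= /tail2 (negbTE si) !mul0r//.
by rewrite eq_sym (negbTE sm) mulr0.
Qed.

(** The coefficient of [X ^ n] in [(a - 1) / (1 - (d - 1) (a - 1))]; the geometric series stops at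
    [i < n] because [(a - 1) ^ (i + 1)] has order at least [i + 1]. *)
Definition theta_coef (n : nat) : R :=
  \sum_(0 <= i < n) (d%:R - 1) ^+ i * formal_pow tail1 i.+1 n.

(** The terms [i = 0] and [i = n - 1] are [A_n] and [(d - 1) ^ (n - 1)]. In between,
    [a - 1 = X + tail2] produces the [Q]: the index [j = 0] vanishes as its degree is positive, and
    [j >= n - i] as [tail2 ^ j] has order at least [2 j]. *)
Lemma theta_coefE n : (1 < n)%N -> theta A d la mu n = theta_coef n.
Proof.
move=> n1; rewrite /theta /theta_coef.
have tail1_1 : formal_pow tail1 1 n = E n.
  rewrite formal_powS /cauchy_prod big_nat_recr//= subnn formal_pow0 eqxx mulr1 big_nat big1.
    by rewrite add0r /tail1 (ltnW n1).
  by move=> i /andP[_ ilt]; rewrite formal_pow0 subn_eq0 leqNgt ilt mulr0.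
have powE i : (i < n)%N -> formal_pow tail1 i.+1 n =
    \sum_(0 <= j < i.+2) 'C(i.+1, j)%:R * Q A la mu j (j + n - i.+1).
  move=> lin; rewrite (@formal_pow_shift _ _ tail2)//.
  - by apply: eq_bigr => j _; rewrite Q_formal_pow.
  - by move=> k k1; rewrite /tail2 /tail1 k1 (ltnW k1).
rewrite [RHS]big_ltn ?(ltnW n1)// expr0 mul1r tail1_1.
case: n n1 tail1_1 powE => // -[//|n] _ _ powE.
rewrite [X in _ = _ + X]big_nat_recr//= addrCA addrA; congr (_ + _ + _).
  rewrite !big_nat; apply: eq_bigr => i /andP[i1 ilt]; congr (_ * _).
  rewrite powE; last by lia.
  have Q0 j : (n.+2 - i <= j)%N -> Q A la mu j (j + n.+2 - i.+1) = 0.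
    move=> jn; rewrite Q_formal_pow (@formal_pow_eq0 _ _ 2)//; last by lia.
    by move=> k k2; rewrite /tail2 leqNgt k2.
  have Q00 : Q A la mu 0 (0 + n.+2 - i.+1) = 0.
    by rewrite Q_formal_pow formal_pow0 subn_eq0 leqNgt; case: ltnP => //; lia.
  rewrite [RHS]big_ltn// Q00 mulr0 add0r.
  (* Both ranges of [j] are extended to the larger one: past the one end the [Q] vanish, past the
     other the binomial coefficients. *)
  pose M := maxn (n.+2 - i) i.+2.
  transitivity (\sum_(1 <= j < M) 'C(i.+1, j)%:R * Q A la mu j (j + n.+2 - i.+1)).
    rewrite [RHS](@big_cat_nat _ _ _ (n.+2 - i)); [|lia|by rewrite leq_maxl].
    rewrite [X in _ = _ + X]big_nat [X in _ = _ + X]big1 ?addr0.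
      by apply: eq_bigr => j _; congr (_ * Q _ _ _ _ _); lia.
    by move=> j /andP[jn _]; rewrite Q0 ?mulr0.
  rewrite [LHS](@big_cat_nat _ _ _ i.+2); [|lia|by rewrite leq_maxr].
  rewrite [X in _ + X = _]big_nat [X in _ + X = _]big1 ?addr0//.
  by move=> j /andP[jn _]; rewrite bin_small ?mul0r.
rewrite powE// big_ltn// big_nat big1 ?addr0.
  by rewrite bin0 Q_formal_pow formal_pow0 add0n subnn mul1r mulr1.
move=> j /andP[j1 _]; rewrite Q_formal_pow (@formal_pow_eq0 _ _ 2) ?mulr0//; last by lia.
by move=> k k2; rewrite /tail2 leqNgt k2.
Qed.

(* The coefficients of [p(0, t)] in powers [(- la t) ^ n / n!]. *)
Definition origin_coef (n : nat) : R := if n == 0%N then 1 else d%:R * theta_coef n.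

Lemma theta_coef_rec n : (0 < n)%N ->
  theta_coef n = E n + (d%:R - 1) * cauchy_prod tail1 theta_coef n.
Proof.
move=> n0; have thetaN m : (m <= n)%N ->
    theta_coef m = \sum_(0 <= i < n) (d%:R - 1) ^+ i * formal_pow tail1 i.+1 m.
  move=> mn; rewrite [RHS](@big_cat_nat _ _ _ m)//= [X in _ = _ + X]big_nat.
  rewrite [X in _ = _ + X]big1 ?addr0// => i /andP[mi _].
  rewrite (@formal_pow_eq0 _ _ 1) ?mulr0// ?mul1n//.
  by case=> // _; rewrite /tail1.
have -> : cauchy_prod tail1 theta_coef n =
    \sum_(0 <= i < n) (d%:R - 1) ^+ i * formal_pow tail1 i.+2 n.
  rewrite {1}/cauchy_prod big_nat.
  rewrite (eq_bigr (fun j => \sum_(0 <= i < n)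
      (d%:R - 1) ^+ i * (tail1 j * formal_pow tail1 i.+1 (n - j)))); last first.
    move=> j _; rewrite thetaN ?leq_subr// mulr_sumr.
    by apply: eq_bigr => i _; rewrite mulrCA.
  rewrite -big_nat exchange_big /=; apply: eq_bigr => i _.
  by rewrite -mulr_sumr.
rewrite thetaN//.
have -> : \sum_(0 <= i < n) (d%:R - 1) ^+ i * formal_pow tail1 i.+1 n =
   \sum_(0 <= i < n.+1) (d%:R - 1) ^+ i * formal_pow tail1 i.+1 n.
  rewrite [RHS]big_nat_recr//=.
  rewrite (@formal_pow_eq0 _ _ 1 n.+1) ?mulr0 ?addr0// ?mul1n//.
  by case=> // _; rewrite /tail1.
rewrite big_nat_recl//= expr0 mul1r mulr_sumr; congr (_ + _).
  rewrite formal_powS /cauchy_prod big_nat_recr//= subnn formal_pow0 eqxx mulr1 big_nat big1.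
    by rewrite add0r /tail1 n0.
  by move=> i /andP[_ ilt]; rewrite formal_pow0 subn_eq0 leqNgt ilt mulr0.
by apply: eq_bigr => i _; rewrite exprS mulrA.
Qed.

(** With [theta = (a - 1) + (d - 1) (a - 1) theta], the series [c = 1 + d theta] satisfies
    [c = a + (d - 1) (a - 1) c]. *)
Lemma origin_coef_rec n : (0 < n)%N ->
  origin_coef n = E n + (d%:R - 1) * cauchy_prod tail1 origin_coef n.
Proof.
move=> n0; rewrite {1}/origin_coef gtn_eqF// theta_coef_rec//.
have -> : cauchy_prod tail1 origin_coef n = E n + d%:R * cauchy_prod tail1 theta_coef n.
  rewrite /cauchy_prod !big_nat_recr//= !subnn {2}/theta_coef big_nil.
  rewrite mulr0 addr0 mulr1 {2}/tail1 n0 addrC; congr (_ + _).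
  rewrite mulr_sumr; apply: eq_big_nat => i /andP[_ ilt].
  by rewrite /origin_coef subn_eq0 leqNgt ilt mulrCA.
ring.
Qed.

End Theta.

(** * Convergence of the series of [p(0, t)] *)

Section OriginSeries.
Context {R : realType}.
Variables (A : nat -> {poly R}) (d : nat) (la mu : R).
Hypotheses (d_gt0 : (0 < d)%N) (la_gt0 : 0 < la) (mu_gt0 : 0 < mu) (mu_neq : mu != la).
Hypothesis A_eulerian : eulerian A.

Local Notation x := (mu / la).
Local Notation E n := (A n).[mu / la].
Local Notation D := (d%:R - 1 : R).
Local Notation a := (euler_coef (fun n : nat => E n)).
Local Notation rho := (eulerian_radius x).
Local Notation c := (origin_coef A d la mu).

Lemma ratio_gt0 : 0 < x. Proof. by rewrite divr_gt0. Qed.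

Lemma ratio_neq1 : x != 1.
Proof.
apply: contra_neq mu_neq => /(canRL (divfK _)); rewrite mul1r; apply.
by rewrite gt_eqF.
Qed.

Lemma eulerian_ratio_gf : \forall u \near (0 : R),
  (fun n => \sum_(0 <= i < n) E i * u ^+ i / i`!%:R) @ \oo -->
    (x - 1) / (x - expR (u * (x - 1))).
Proof. exact: (A_eulerian ratio_neq1). Qed.

Let x0 := ratio_gt0.
Let x1 := ratio_neq1.
Let gf := eulerian_ratio_gf.

Let D0 : 0 <= D. Proof. by rewrite subr_ge0 ler1n. Qed.

Lemma euler_coefE n : E n = n`!%:R * a n.
Proof. by rewrite /euler_coef [RHS]mulrC divfK// pnatr_eq0 -lt0n fact_gt0. Qed.

Lemma eulerian_ratio1 : E 1%N = 1.
Proof. by rewrite euler_coefE (euler_coef1 x0 x1 gf) mulr1. Qed.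

Lemma eulerian_ratio_ge0 n : 0 <= E n.
Proof. by rewrite euler_coefE mulr_ge0// (euler_coef_ge0 x0 x1 gf). Qed.

Lemma origin_coef_step n :
  c n.+1 = E n.+1 + D * \sum_(0 <= i < n.+1) E i.+1 * c (n - i)%N.
Proof.
rewrite origin_coef_rec ?eulerian_ratio1//; congr (_ + _ * _).
rewrite /cauchy_prod big_nat_recl//= {1}/tail1 mul0r add0r.
by apply: eq_bigr => i _; rewrite subSS.
Qed.

Lemma origin_coef_ge0 n : 0 <= c n.
Proof.
elim/ltn_ind: n => -[_|n IH]; first by rewrite /origin_coef ler01.
rewrite origin_coef_step addr_ge0 ?eulerian_ratio_ge0//; apply: mulr_ge0 => //.
by rewrite big_nat sumr_ge0// => i /andP[_ ilt]; rewrite mulr_ge0 ?eulerian_ratio_ge0// IH; lia.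
Qed.

Definition origin_egf n := c n / n`!%:R.
Local Notation gam := origin_egf.
Local Notation del := (pseries_diffs a).

Lemma origin_egf_ge0 n : 0 <= gam n.
Proof. by rewrite divr_ge0 ?origin_coef_ge0. Qed.

Lemma diffs_euler_ge0 n : 0 <= del n.
Proof. by rewrite mulr_ge0// (euler_coef_ge0 x0 x1 gf). Qed.

Lemma eulerian_ratioS n : E n.+1 = n`!%:R * del n.
Proof. by rewrite euler_coefE /pseries_diffs factS natrM; ring. Qed.

Lemma origin_coefE n : c n = n`!%:R * gam n.
Proof. by rewrite /origin_egf [RHS]mulrC divfK. Qed.

(** The recurrence convolves [E] and [c] without binomial weights, whereas a product of exponential
    generating functions carries them; all terms being nonnegative, [i! (n - i)! <= n!] gives the
    inequality. *)
Lemma diffs_origin_le n :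
  pseries_diffs gam n <= del n + D * cauchy_prod del gam n.
Proof.
rewrite /pseries_diffs {1}/origin_egf origin_coef_step factS natrM.
have -> : n.+1%:R * ((E n.+1 + D * \sum_(0 <= i < n.+1) E i.+1 * c (n - i)%N) /
     (n.+1%:R * n`!%:R)) =
   E n.+1 / n`!%:R + D * ((\sum_(0 <= i < n.+1) E i.+1 * c (n - i)%N) / n`!%:R).
  have := pnatr_eq0 R n.+1; move: (n.+1%:R : R) (natfact_neq0 (R := R) n) => k n0 k0.
  by field; rewrite n0 k0.
rewrite eulerian_ratioS mulrC mulKf// lerD2l ler_wpM2l//.
rewrite ler_pdivrMr ?ltr0n ?fact_gt0// /cauchy_prod mulr_suml.
apply: ler_sum_nat => i /andP[_ ilt].
rewrite eulerian_ratioS origin_coefE.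
have -> : i`!%:R * del i * ((n - i)`!%:R * gam (n - i)) =
   del i * gam (n - i)%N * (i`! * (n - i)`!)%:R by rewrite natrM; ring.
rewrite ler_wpM2l//; first by rewrite mulr_ge0 ?diffs_euler_ge0 ?origin_egf_ge0.
rewrite ler_nat -(bin_fact (ilt : i <= n)%N) leq_pmull// bin_gt0.
exact: ilt.
Qed.

Let f (u : R) := (recip x u)^-1.
Let f' (u : R) := f u * (1 + x * (f u - 1)).

Let f_ge1 u : 0 <= u < rho -> 1 <= f u.
Proof.
move=> /andP[u0 ur]; rewrite /f invf_ge1 ?(recip_gt0 x0 x1)//.
exact: (recip_le1 x1).
Qed.

Let f'_ge0 u : 0 <= u < rho -> 0 <= f' u.
Proof.
move=> /f_ge1 f1; apply: mulr_ge0; first exact: le_trans f1.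
by rewrite addr_ge0// mulr_ge0 ?(ltW x0)// subr_ge0.
Qed.

Lemma psum_diffs_euler u : `|u| < rho -> psum del u = f' u.
Proof.
move=> ur; have Ca := cvg_on_euler x0 x1 gf.
have near_eq : \forall v \near u, f v = psum a v.
  exists (rho - `|u|); first by rewrite /= subr_gt0.
  move=> v /= uv; apply/esym/(psum_euler x0 x1 gf).
  by have := ler_normB u (u - v); rewrite subKr; lra.
have [_ <-] := derive_psum Ca ur.
have ur' : u < rho by rewrite (le_lt_trans _ ur)// ler_norm.
by have [_ ->] := near_eq_is_derive near_eq (derive_recipV x0 x1 ur').
Qed.

(* The partial sums [S] satisfy [S' <= f' (1 + (d - 1) S)], the binomial
   coefficients being at least 1, and [f exp ((d - 1) (f - 1))] satisfies the
   reverse inequality. *)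
Lemma pseries_origin_le N u : 0 <= u < rho ->
  pseries gam u N <= f u * expR (D * (f u - 1)).
Proof.
move=> /andP[u0 ur]; elim: N => [|N IH] in u u0 ur *.
  rewrite /pseries /series /= big_nil mulr_ge0 ?expR_ge0//.
  by rewrite (le_trans ler01)// f_ge1// u0.
have dF (v : R) : 0 <= v < rho -> is_derive v 1 (fun w => f w * expR (D * (f w - 1)))
    (f' v * expR (D * (f v - 1)) + f v * (expR (D * (f v - 1)) * (D * f' v))).
  move=> /andP[v0 vr]; have df := derive_recipV x0 x1 vr.
  apply: (derive_eq (derive_mul df (derive_comp (is_derive_expR _)
    (derive_scale D (derive_sub df (derive_cst 1 v)))))).
  by rewrite /f' /f subr0.
have dS (v : R) : 0 <= v < rho -> pseries (pseries_diffs gam) v N <=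
    f' v * expR (D * (f v - 1)) + f v * (expR (D * (f v - 1)) * (D * f' v)).
  move=> v0r; have /andP[v0 vr] := v0r; have {}IH := IH v v0 vr.
  have del_le : pseries del v N <= f' v.
    have vr' : `|v| < rho by rewrite ger0_norm.
    rewrite -psum_diffs_euler//; apply: nondecreasing_cvgn_le.
      by apply: pseries_mono => //; exact: diffs_euler_ge0.
    exact: (cvg_on_diffs (cvg_on_euler x0 x1 gf)).
  have S0 : 0 <= pseries gam v N by apply: pseries_ge0 => //; exact: origin_egf_ge0.
  have del0 : 0 <= pseries del v N by apply: pseries_ge0 => //; exact: diffs_euler_ge0.
  apply: (@le_trans _ _ (pseries del v N + D * pseries (cauchy_prod del gam) v N)).
    rewrite /pseries /series /= mulr_sumr -big_split /=; apply: ler_sum => i _.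
    by have := ler_wpM2r (exprn_ge0 i v0) (diffs_origin_le i); rewrite mulrDl mulrA.
  have conv := pseries_cauchy_prod_le N diffs_euler_ge0 origin_egf_ge0 v0.
  have e1 : 1 <= expR (D * (f v - 1)).
    by rewrite -[leLHS]expR0 ler_expR mulr_ge0// subr_ge0 f_ge1.
  have f0 := f'_ge0 v0r.
  apply: lerD; first by apply: le_trans del_le _; rewrite ler_peMr.
  rewrite (_ : f v * _ = D * (f' v * (f v * expR (D * (f v - 1))))); last by ring.
  by rewrite ler_wpM2l// (le_trans conv)// ler_pM.
have : pseries gam u N.+1 - f u * expR (D * (f u - 1)) <=
    pseries gam 0 N.+1 - f 0 * expR (D * (f 0 - 1)).
  apply: (@dini_le_le R (fun v => pseries gam v N.+1 + - (f v * expR (D * (f v - 1))))) => // v Hv.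
    have vr : 0 <= v < rho by lra.
    apply: left_lscD; apply: derivable_left_lsc; first by case: (derive_pseries gam N v).
    by case: (derive_opp (dF v vr)).
  have vr : 0 <= v < rho by lra.
  apply: dini_le_trans (dini_leD (is_derive_dini_le (derive_pseries gam N v))
     (is_derive_dini_le (derive_opp (dF v vr)))).
  by rewrite subr_le0 dS.
rewrite [pseries gam 0 _]pseries_shift mul0r addr0 {2}/origin_egf /origin_coef eqxx.
have -> : f 0 = 1 by rewrite /f /recip mulr0 expR0 divff ?invr1// subr_eq0.
by rewrite fact0 divr1 subrr mulr0 expR0 mulr1 subrr subr_le0.
Qed.

Lemma cvg_on_origin : cvg_on gam rho.
Proof. exact: (cvg_on_ge0 origin_egf_ge0 pseries_origin_le). Qed.

End OriginSeries.

(** * The Volterra equation *)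

(* Repeated integration by parts: each [gam n.+1] is a primitive of [gam n],
   and the sum is a primitive of [s ^ n / n! * gam 0 '(t - s)]. *)
Lemma derive_iterated_primitive {R : realType} (gam : nat -> R -> R) (dgam t s : R) n :
  (forall k, is_derive (t - s) 1 (gam k.+1) (gam k (t - s))) ->
  is_derive (t - s) 1 (gam 0%N) dgam ->
  is_derive s 1
    (fun r => - \sum_(0 <= j < n.+1) r ^+ j / j`!%:R * gam (n - j)%N (t - r))
    (s ^+ n / n`!%:R * dgam).
Proof.
move=> dS d0.
have shift (f : R -> R) (l : R) : is_derive (t - s) 1 f l -> is_derive s 1 (fun r => f (t - r)) (- l).
  move=> fl; apply: (derive_eq (derive_comp (g := fun r => t - r) fl
    (derive_sub (derive_cst t s) (derive_id s)))).
  by rewrite sub0r mulrN1.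
have mono j : is_derive s 1 (fun r => r ^+ j / j`!%:R)
    (if j is i.+1 then s ^+ i / i`!%:R else 0).
  case: j => [|j]; last exact: derive_exp_fact.
  by under eq_fun do rewrite expr0; exact: derive_cst.
elim: n => [|n IH].
  under eq_fun do rewrite big_nat1 expr0 fact0 divr1 mul1r subn0.
  apply: (derive_eq (derive_opp (shift _ _ d0))).
  by rewrite opprK expr0 fact0 divr1 mul1r.
(* The derivative telescopes: up to index [m] a single boundary term is left. The disjunct
   [n.+1 < m] lets the induction run past the last index. *)
suff H m : is_derive s 1
    (fun r => \sum_(0 <= j < m.+1) r ^+ j / j`!%:R * gam (n.+1 - j)%N (t - r))
    (if (m <= n)%N then - (s ^+ m / m`!%:R * gam (n - m)%N (t - s))
     else (if m == n.+1 then - (s ^+ n.+1 / n.+1`!%:R * dgam) else 0)) \/ (n.+1 < m)%N.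
  have [H1|] := H n.+1; last by rewrite ltnn.
  apply: (derive_eq (derive_opp H1)).
  by rewrite ltnn eqxx opprK.
elim: m => [|m [IHm|]]; last by right; lia.
  left; under eq_fun do rewrite big_nat1 expr0 fact0 divr1 mul1r subn0.
  apply: (derive_eq (shift _ _ (dS n))).
  by rewrite ?leq0n expr0 fact0 divr1 mul1r subn0.
have [mn|nm] := leqP m n; last by right.
left; under eq_fun do rewrite big_nat_recr//=.
have [mn'|nm'] := ltnP m n.
  have E : (n.+1 - m.+1)%N = (n - m.+1).+1 by lia.
  rewrite E.
  apply: (derive_eq (derive_add IHm (derive_mul (mono m.+1) (shift _ _ (dS (n - m.+1)%N))))).
  rewrite mn (_ : (n - m.+1).+1 = n - m)%N; last by lia.
  ring.
have {mn nm'} E : m = n by lia.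
rewrite E in IHm *; rewrite subnn.
apply: (derive_eq (derive_add IHm (derive_mul (mono n.+1) (shift _ _ d0)))).
by rewrite leqnn eqxx subnn; ring.
Qed.

(** * The probability of the origin as a power series *)

Section OriginProbability.
Context {R : realType}.
Variables (A : nat -> {poly R}) (d : nat) (la mu : R).
Hypotheses (d_gt0 : (0 < d)%N) (la_gt0 : 0 < la) (mu_gt0 : 0 < mu) (mu_neq : mu != la).
Hypothesis A_eulerian : eulerian A.
Variable p : R -> state d -> state d -> R.
Hypotheses (tf : transition_function p).
Hypothesis rates : has_transition_rates p (rate la la mu).

Local Notation x := (mu / la).
Local Notation E n := (A n).[mu / la].
Local Notation D := (d%:R - 1 : R).
Local Notation a := (euler_coef (fun n : nat => E n)).
Local Notation del := (pseries_diffs a).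
Local Notation rho := (eulerian_radius x).
Local Notation c := (origin_coef A d la mu).
Local Notation gam := (origin_egf A d la mu).
Local Notation o := (origin d).
Local Notation T := (semigroup_op p).

Let x0 := ratio_gt0 la_gt0 mu_gt0.
Let x1 := ratio_neq1 la_gt0 mu_neq.
Let gf := eulerian_ratio_gf la_gt0 mu_neq A_eulerian.
Let D0 : 0 <= D. Proof. by rewrite subr_ge0 ler1n. Qed.
Let L0 : 0 <= D * la. Proof. by rewrite mulr_ge0// ltW. Qed.
Let gam0 := origin_egf_ge0 d_gt0 la_gt0 mu_gt0 mu_neq A_eulerian.
Let del0 := diffs_euler_ge0 la_gt0 mu_gt0 mu_neq A_eulerian.
Let cgam := cvg_on_origin d_gt0 la_gt0 mu_gt0 mu_neq A_eulerian.
Let cdel : cvg_on del rho := cvg_on_diffs (cvg_on_euler x0 x1 gf).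

Let lan0 : la != 0. Proof. by rewrite gt_eqF. Qed.
Let mula : mu + -1 * la != 0. Proof. by rewrite mulN1r subr_eq0. Qed.

Definition time_radius := ln x / (mu - la).

Lemma time_radiusE : la * time_radius = rho.
Proof.
rewrite /time_radius /eulerian_radius; field.
by rewrite lan0 mula.
Qed.

Lemma time_radius_lt t : 0 <= t < time_radius -> `|la * t| < rho.
Proof.
move=> /andP[t0 tr]; rewrite ger0_norm ?mulr_ge0 ?(ltW la_gt0)//.
by rewrite -time_radiusE ltr_pM2l.
Qed.

Lemma recip_growth t : recip x (- la * t) = 1 + la * (1 - 0) * growth la mu t.
Proof.
rewrite /recip /growth (_ : (x - 1) * (- la * t) = - (mu - la) * t); last first.
  by field; rewrite gt_eqF.
by field; rewrite lan0 subr_eq0 mu_neq.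
Qed.

Lemma imm_pgf_psum t : 0 <= t < time_radius ->
  imm_pgf la mu 0 t = psum a (- la * t).
Proof.
move=> tr; rewrite (psum_euler x0 x1 gf) ?recip_growth//.
by rewrite mulNr normrN time_radius_lt.
Qed.

Lemma imm_pgf'_psum t : 0 <= t < time_radius ->
  imm_pgf' la mu 0 t = - la * psum del (- la * t).
Proof.
move=> tr; rewrite (psum_diffs_euler la_gt0 mu_gt0 mu_neq A_eulerian); last first.
  by rewrite mulNr normrN time_radius_lt.
rewrite recip_growth /imm_pgf' /bd_pgf /imm_pgf.
have := @imm_pgf_den_gt0 R la mu la_gt0 0 t ler01; case/andP: tr => t0 _ /(_ t0).
move: (growth la mu t) => g /lt0r_neq0 g0; field.
by move: g0; rewrite subr0 mulr1 => ->; rewrite ?lan0.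
Qed.

(* Truncation of the product of the two power series along total degree. *)
Let conv (t s : R) (N : nat) := \sum_(0 <= i < N.+1)
  (gam i * (- la * s) ^+ i) * (del (N - i)%N * (- la * (t - s)) ^+ (N - i)).

Let tail (t : R) (K : nat) :=
  psum gam (la * t) * psum del (la * t) - pseries (cauchy_prod gam del) (la * t) K.

Let tail_cvg t : 0 <= t < time_radius -> tail t K @[K --> \oo] --> 0.
Proof.
move=> /time_radius_lt tr; have H := pseries_cauchy_prod cgam cdel tr.
rewrite -(subrr (psum gam (la * t) * psum del (la * t))).
by apply: cvgB H; exact: cvg_cst.
Qed.

(** For [0 <= s <= t] both arguments are at most [la t] in absolute value, so the terms of total
    degree [N] are dominated by those of the product of the series at [la t], uniformly in [s]. *)
Let conv_tail t s K : 0 <= s <= t -> t < time_radius ->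
  `|psum gam (- la * s) * psum del (- la * (t - s)) - \sum_(0 <= N < K) conv t s N|
    <= tail t K.
Proof.
move=> /andP[s0 st] tr; have t0 : 0 <= t by lra.
have tr' : `|la * t| < rho by rewrite time_radius_lt// t0.
have sr : `| - la * s| < rho by rewrite mulNr normrN time_radius_lt//; lra.
have tsr : `| - la * (t - s)| < rho by rewrite mulNr normrN time_radius_lt//; lra.
have cu : cvgn [normed series (fun i => gam i * (- la * s) ^+ i)].
  have := cvg_on_norm cgam sr; rewrite /pseries /normed_series_of /series /=.
  by under eq_fun do under eq_bigr do rewrite -normrX -normrM.
have := mertens cu (cdel tsr).
rewrite (_ : series _ = (fun K => \sum_(0 <= N < K) conv t s N))// => H.
have H1 := pseries_cauchy_prod cgam cdel tr'.
have la_t0 : 0 <= la * t by rewrite mulr_ge0// ltW.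
have cp0 i : 0 <= cauchy_prod gam del i.
  by apply: sumr_ge0 => j _; rewrite mulr_ge0.
have Hm := pseries_mono cp0 la_t0.
apply/ler_addgt0Pr => e e0.
have /cvgrPdist_le /(_ e e0) := H; case=> M0 _ HM.
pose M := maxn M0 K; have := HM M (leq_maxl _ _).
rewrite -[limn _]/(psum gam (- la * s)) -[limn _]/(psum del (- la * (t - s))).
have KM : (K <= M)%N by exact: leq_maxr.
rewrite [X in `|_ - X| <= _ -> _](@big_cat_nat _ _ _ K)//=.
have step : `|\sum_(K <= N < M) conv t s N| <= tail t K.
  apply: le_trans (ler_norm_sum _ _ _) _.
  apply: (@le_trans _ _ (\sum_(K <= N < M) cauchy_prod gam del N * (la * t) ^+ N)).
    apply: ler_sum => N _; apply: le_trans (ler_norm_sum _ _ _) _.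
    rewrite /cauchy_prod mulr_suml; apply: ler_sum_nat => i /andP[_ iN].
rewrite (_ : _ * (_ * _) = gam i * del (N - i)%N *
      ((- la * s) ^+ i * (- la * (t - s)) ^+ (N - i))); last by ring.
    have gd0 : 0 <= gam i * del (N - i)%N by rewrite mulr_ge0.
    rewrite normrM (ger0_norm gd0) ler_wpM2l//.
    rewrite normrM !normrX !mulNr !normrN -[leRHS](_ : (la * t) ^+ i * (la * t) ^+ (N - i) = _).
      have nt r : 0 <= r <= t -> `|la * r| <= la * t.
        move=> /andP[r0 rt]; rewrite normrM (gtr0_norm la_gt0) (ger0_norm r0).
        by rewrite ler_pM2l.
      by apply: ler_pM; rewrite ?exprn_ge0// lerXn2r ?nnegrE// nt//; lra.
    by rewrite -exprD subnKC.
  have : pseries (cauchy_prod gam del) (la * t) M <=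
      psum gam (la * t) * psum del (la * t).
    by rewrite -(cvg_lim _ H1)//; apply: nondecreasing_cvgn_le => //; exact: cvgP H1.
  rewrite {1}/pseries /series /= (@big_cat_nat _ _ _ K)//= /tail /pseries /series /=.
  lra.
move: step; rewrite !ler_norml; lra.
Qed.

Let psi (t s : R) (K : nat) := D * (- la) * \sum_(0 <= N < K) conv t s N.

Let mono_seq (m k : nat) (r : R) := r ^+ (k + m).+1 / ((k + m).+1)`!%:R.

(** A primitive of [psi] in [s], each product [s ^ i (t - s) ^ (N - i)] being integrated by parts
    along the primitives [mono_seq]. *)
Let Psi (t s : R) (K : nat) := D * \sum_(0 <= N < K) \sum_(0 <= i < N.+1)
  c i * E (N - i).+1 * (- la) ^+ N.+1 *
  - \sum_(0 <= j < i.+1) s ^+ j / j`!%:R * mono_seq (N - i) (i - j) (t - s).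

Let derive_Psi (t s : R) K : is_derive s 1 (fun r => Psi t r K) (psi t s K).
Proof.
rewrite /psi -mulrA mulr_sumr; apply: derive_scale; apply: derive_sum_nat => N _.
rewrite /conv mulr_sumr; apply: derive_sum_nat => i /andP[_ iN].
have step : is_derive s 1
   (fun r => - \sum_(0 <= j < i.+1) r ^+ j / j`!%:R * mono_seq (N - i) (i - j) (t - r))
   (s ^+ i / i`!%:R * ((t - s) ^+ (N - i) / (N - i)`!%:R)).
  by apply: derive_iterated_primitive => [k|]; exact: derive_exp_fact.
apply: (derive_eq (derive_scale (c i * E (N - i).+1 * (- la) ^+ N.+1) step)).
rewrite (origin_coefE A d la mu) (eulerian_ratioS A la mu) !exprMn.
have -> : (- la) ^+ N.+1 = - la * ((- la) ^+ i * (- la) ^+ (N - i)).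
  by rewrite exprS -exprD subnKC.
by field; rewrite !natfact_neq0.
Qed.

(** At [s = t] all terms vanish and at [s = 0] only [j = 0] remains, giving the Beta integral
    [t ^ (N + 1) / (N + 1)!]; by the recurrence of [c], the series solves the Volterra equation
    degree by degree. *)
Let Psi_diff (t : R) K :
  Psi t t K - Psi t 0 K = pseries gam (- la * t) K.+1 - pseries a (- la * t) K.+1.
Proof.
have Ptt : Psi t t K = 0.
  rewrite /Psi big1 ?mulr0// => N _; rewrite big1// => i _.
  rewrite big1 ?oppr0 ?mulr0// => j _.
  by rewrite /mono_seq subrr exprS !mul0r mulr0.
have Pt0 : Psi t 0 K = - (D * \sum_(0 <= N < K) \sum_(0 <= i < N.+1)
    c i * E (N - i).+1 * ((- la * t) ^+ N.+1 / N.+1`!%:R)).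
  rewrite /Psi -mulrN -sumrN; congr (_ * _); apply: eq_bigr => N _.
  rewrite -sumrN; apply: eq_big_nat => i /andP[_ iN].
  rewrite big_nat_recl//= big1 ?addr0; last by move=> j _; rewrite exprS !mul0r.
  rewrite expr0 fact0 divr1 mul1r /mono_seq !subn0 subr0 subnKC// exprMn.
  by ring.
rewrite Ptt Pt0 sub0r opprK !pseries_shift.
have -> : gam 0%N = 1 by rewrite /origin_egf /origin_coef eqxx fact0 divr1.
rewrite (euler_coef0 x0 x1 gf) opprD addrACA subrr add0r -mulrBr.
rewrite /pseries /series /= -sumrB !mulr_sumr; apply: eq_bigr => N _.
rewrite -mulr_suml big_nat_rev /= add0n.
rewrite (eq_big_nat _ _ (F2 := fun i => E i.+1 * c (N - i)%N)); last first.
  by move=> i /andP[_ iN]; rewrite subSS subKn// mulrC.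
have H := origin_coef_step A d la mu N.
rewrite mulrA (_ : D * _ = c N.+1 - E N.+1); last by rewrite H; ring.
rewrite /origin_egf /euler_coef exprS; ring.
Qed.

Let excess_bound (t : R) : 0 <= t -> `|excess d la mu 0 t| <= D * la.
Proof.
move=> t0; have z01 : 0 <= (0 : R) <= 1 by rewrite lexx ler01.
have := excess_le0 d_gt0 la_gt0 mu_neq z01 t0.
have := excess_ge d_gt0 la_gt0 mu_gt0 mu_neq z01 t0.
rewrite ler_norml; lra.
Qed.

(** One Picard step: the error is weighted by a kernel of size at most [(d - 1) la], and integrating
    the old bound gives the new one. *)
Let step_bound (M t1 : R) k : t1 < time_radius ->
  (forall s, 0 <= s <= t1 ->
     `|p s o o - psum gam (- la * s)| <= M * ((D * la * s) ^+ k / k`!%:R)) ->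
  forall t, 0 <= t <= t1 ->
  `|p t o o - psum gam (- la * t)| <= M * ((D * la * t) ^+ k.+1 / k.+1`!%:R).
Proof.
move=> t1r IH t /andP[t0 tt1]; have z01 : 0 <= (0 : R) <= 1 by rewrite lexx ler01.
have tr : 0 <= t < time_radius by rewrite t0 (le_lt_trans tt1).
have tr' : `|- la * t| < rho by rewrite mulNr normrN time_radius_lt.
apply/ler_addgt0Pr => e e0.
(* The margin [e] is shared by two truncated series, [e1] each, and by the truncated product under
   the integral, [(d - 1) la t e1]. *)
have t1' : 0 < D * la * t + 2 by rewrite ltr_wpDl// mulr_ge0.
have e' : 0 < e / (D * la * t + 2) by rewrite divr_gt0.
set e1 := e / _ in e'.
have e1E : e1 * (D * la * t + 2) = e by rewrite divfK// gt_eqF.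
near \oo => K.
have H1 : `|tail t K| <= e1.
  by near: K; have /cvgr0Pnorm_le := tail_cvg tr; apply.
have H2 : `|psum gam (- la * t) - pseries gam (- la * t) K.+1| <= e1.
  near: K; have := cvg_on_psum cgam tr'; rewrite -(cvg_shiftS (pseries _ _)).
  by move/cvgrPdist_le; apply.
have H3 : `|psum a (- la * t) - pseries a (- la * t) K.+1| <= e1.
  near: K; have := cvg_on_psum (cvg_on_euler x0 x1 gf) tr'.
  by rewrite -(cvg_shiftS (pseries _ _)) => /cvgrPdist_le; apply.
have deta (s : R) : is_derive s 1 (fun r => M * ((D * la * r) ^+ k.+1 / k.+1`!%:R) + D * la * e1 * r)
    (M * ((D * la * s) ^+ k / k`!%:R * (D * la)) + D * la * e1).
  apply: derive_add; last exact: derive_linear.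
  apply: derive_scale.
  exact: (derive_comp (derive_exp_fact k (D * la * s)) (derive_linear (D * la) s)).
have := duhamel d_gt0 la_gt0 mu_gt0 mu_neq tf rates z01 t0
  (Psi := fun r => Psi t r K) (psi := fun s => psi t s K)
  (fun s _ => derive_Psi t s K) (fun s _ => deta s).
have -> : T t (fun y => 0 ^+ level y) o = p t o o.
  have -> : (fun y : state d => 0 ^+ level y : R) = (fun y => (y == o)%:R).
    by apply/funext => y; rewrite -level0 expr0n.
  exact: semigroup_op_delta.
rewrite Psi_diff imm_pgf_psum// !mulr0 expr0n mul0r mulr0 addr0 subr0 => H.
have {H} : `|p t o o - psum a (- la * t) -
    (pseries gam (- la * t) K.+1 - pseries a (- la * t) K.+1)| <=
    M * ((D * la * t) ^+ k.+1 / (k.+1)`!%:R) + D * la * e1 * t.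
  apply: H => s /andP[s0 st].
  have ts0 : 0 <= t - s by lra.
  have Hs := IH s ltac:(lra).
  have Hb := excess_bound ts0.
  have Hc := @conv_tail t s K ltac:(lra) ltac:(lra).
  have bE : excess d la mu 0 (t - s) = D * (- la) * psum del (- la * (t - s)).
    by rewrite /excess imm_pgf'_psum ?mulrA//; lra.
  rewrite (_ : _ - _ = (p s o o - psum gam (- la * s)) * excess d la mu 0 (t - s) +
     D * (- la) * (psum gam (- la * s) * psum del (- la * (t - s)) -
       \sum_(0 <= N < K) conv t s N)); last first.
    by rewrite bE /psi; ring.
  apply: (le_trans (ler_normD _ _)); apply: lerD.
    rewrite normrM mulrA ler_pM//.
  rewrite normrM mulrN normrN (ger0_norm L0) ler_wpM2l//.
  by apply: (le_trans Hc); exact: le_trans (ler_norm _) H1.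
move: H1 H2 H3; rewrite !ler_norml; lra.
Unshelve. all: by end_near. Qed.

(** The crude bound [1 + psum gam (la * t)] starts the Picard iteration, whose factor
    [((d - 1) la t) ^ k / k!] tends to 0. *)
Lemma origin_probability t : 0 <= t < time_radius ->
  p t o o = psum gam (- la * t).
Proof.
move=> /[dup] tr /andP[t0 tr'].
have tr0 := time_radius_lt tr.
have la_t0 : 0 <= la * t by rewrite mulr_ge0// ltW.
have bound k s : 0 <= s <= t -> `|p s o o - psum gam (- la * s)| <=
    (1 + psum gam (la * t)) * ((D * la * s) ^+ k / k`!%:R).
  elim: k s => [|k IH] s st; last exact: (step_bound tr' IH).
  rewrite expr0 fact0 divr1 mulr1; case/andP: st => s0 st.
  apply: (le_trans (ler_normB _ _)); apply: lerD.
    have <- := semigroup_op_delta tf o o s0; rewrite ger0_norm; last first.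
      by rewrite semigroup_op_delta// (tf_ge0 tf).
    apply: (semigroup_op_le_cst tf) => // y.
    by case: eqP; rewrite ?lexx ?ler01.
  have sr : `|- la * s| < rho by rewrite mulNr normrN time_radius_lt//; lra.
  have H := cvg_on_psum cgam sr.
  rewrite -(cvg_lim _ (cvg_norm H))//; apply: limr_le; first exact: cvgP (cvg_norm H).
  near=> n; apply: (@le_trans _ _ (pseries gam (la * t) n)); last first.
    by apply: nondecreasing_cvgn_le; [exact: pseries_mono|exact: cgam].
  rewrite /pseries /series /=; apply: le_trans (ler_norm_sum _ _ _) _.
  apply: ler_sum => i _; rewrite normrM (ger0_norm (gam0 i)) ler_wpM2l//.
  rewrite normrX lerXn2r ?nnegrE// mulNr normrN ger0_norm ?mulr_ge0 ?(ltW la_gt0)//.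
  by rewrite ler_pM2l.
apply/eqP; rewrite -subr_eq0 -normr_le0; apply/ler_addgt0Pr => e e0; rewrite add0r.
have H : (1 + psum gam (la * t)) * ((D * la * t) ^+ k / k`!%:R) @[k --> \oo] --> 0.
  rewrite -(mulr0 (1 + psum gam (la * t))); apply: cvgMr.
  exact: (cvg_series_cvg_0 (is_cvg_series_exp_coeff _)).
near \oo => k; apply: le_trans (bound k t _) _; first by rewrite t0 lexx.
apply: le_trans (ler_norm _) _.
by near: k; move/cvgr0Pnorm_le : H; apply.
Unshelve. all: by end_near. Qed.

Let psum_tail t s K : 0 <= s <= t -> t < time_radius ->
  `|psum gam (- la * s) - pseries gam (- la * s) K| <=
  psum gam (la * t) - pseries gam (la * t) K.
Proof.
move=> /andP[s0 st] tr; have t0 : 0 <= t by lra.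
have tr' : `|la * t| < rho by rewrite time_radius_lt// t0.
have sr : `| - la * s| < rho by rewrite mulNr normrN time_radius_lt//; lra.
have la_t0 : 0 <= la * t by rewrite mulr_ge0// ltW.
have Hm := pseries_mono gam0 la_t0.
apply/ler_addgt0Pr => e e0.
have /cvgrPdist_le /(_ e e0) [M0 _ HM] := cvg_on_psum cgam sr.
pose M := maxn M0 K; have := HM M (leq_maxl _ _).
have KM : (K <= M)%N by exact: leq_maxr.
have MM : pseries gam (la * t) M <= psum gam (la * t).
  by apply: nondecreasing_cvgn_le => //; exact: cgam.
have step : `|pseries gam (- la * s) M - pseries gam (- la * s) K| <=
    pseries gam (la * t) M - pseries gam (la * t) K.
  rewrite !pseries_sub//.
  apply: le_trans (ler_norm_sum _ _ _) _; apply: ler_sum => i _.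
  rewrite normrM (ger0_norm (gam0 i)) ler_wpM2l//.
  rewrite normrX lerXn2r ?nnegrE// mulNr normrN ger0_norm ?mulr_ge0 ?(ltW la_gt0)//.
  by rewrite ler_pM2l.
move: step; rewrite !ler_norml; lra.
Qed.

(** As [p(0, s)] is now a known series, its partial sums times [excess] have an explicit primitive
    built from the iterated primitives [g] of [G']. The endpoint [s = t] vanishes by [g k 0 = 0],
    and the tail of the series bounds the error uniformly in [s]. *)
Lemma pgf_series (z t : R) (g : nat -> R -> R) : 0 <= z <= 1 -> 0 <= t < time_radius ->
  (forall r, 0 <= r <= t -> is_derive r 1 (g 0%N) (imm_pgf' la mu z r)) ->
  (forall k r, 0 <= r <= t -> is_derive r 1 (g k.+1) (g k r)) ->
  (forall k, g k 0 = 0) ->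
  \sum_(0 <= n < K) D * (c n * (- la) ^+ n * g n t) @[K --> \oo] -->
    T t (fun y => z ^+ level y) o - imm_pgf la mu z t.
Proof.
move=> z01 /andP[t0 tr] dg0 dgS gz.
pose P s K := \sum_(0 <= n < K) D * (c n * (- la) ^+ n) *
  - \sum_(0 <= j < n.+1) s ^+ j / j`!%:R * g (n - j)%N (t - s).
have dP K s : 0 <= s <= t -> is_derive s 1 (fun r => P r K)
    (pseries gam (- la * s) K * excess d la mu z (t - s)).
  move=> st; have ts : 0 <= t - s <= t by lra.
  rewrite /pseries /series /= mulr_suml; apply: derive_sum_nat => n _.
  apply: (derive_eq (derive_scale (D * (c n * (- la) ^+ n))
    (derive_iterated_primitive n (fun k => dgS k _ ts) (dg0 _ ts)))).
  by rewrite (origin_coefE A d la mu) exprMn /excess; field; exact: natfact_neq0.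
have Ptt K : P t K = 0.
  rewrite /P big1// => n _; rewrite big1 ?oppr0 ?mulr0// => j _.
  by rewrite subrr gz mulr0.
have Pt0 K : P 0 K = - \sum_(0 <= n < K) D * (c n * (- la) ^+ n * g n t).
  rewrite /P -sumrN; apply: eq_bigr => n _.
  rewrite big_nat_recl//= big1 ?addr0; last by move=> j _; rewrite exprS !mul0r.
  by rewrite expr0 fact0 divr1 mul1r !subn0 subr0; ring.
have tr' : `|la * t| < rho by rewrite time_radius_lt// t0.
apply/cvgrPdist_le => e e0.
have e1 : 0 < e / (D * la * t + 1) by rewrite divr_gt0// ltr_wpDl// mulr_ge0.
have /cvgrPdist_le /(_ _ e1) := cvg_on_psum cgam tr'.
apply: filterS => K; set tl := `|_| => Htl.
have := duhamel d_gt0 la_gt0 mu_gt0 mu_neq tf rates z01 t0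
  (Psi := fun r => P r K) (psi := fun s => pseries gam (- la * s) K * excess d la mu z (t - s))
  (eta := fun s => tl * (D * la) * s) (eta' := fun=> tl * (D * la))
  (fun s => dP K s) (fun s _ => derive_linear _ s).
rewrite Ptt Pt0 sub0r opprK mulr0 subr0 => H.
apply: (@le_trans _ _ (tl * (D * la) * t)).
  apply: H => s /andP[s0 st]; rewrite -mulrBl normrM; apply: ler_pM => //.
    rewrite origin_probability; last by rewrite s0 (lt_trans st).
    have := @psum_tail t s K; rewrite s0 (ltW st) tr => /(_ isT isT) /le_trans; apply.
    exact: ler_norm.
  have ts0 : 0 <= t - s by lra.
  have := excess_le0 d_gt0 la_gt0 mu_neq z01 ts0.
  have := excess_ge d_gt0 la_gt0 mu_gt0 mu_neq z01 ts0.
  rewrite ler_norml; lra.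
rewrite -mulrA; have DLt : 0 <= D * la * t by rewrite mulr_ge0.
apply: (@le_trans _ _ (tl * (D * la * t + 1))).
  by rewrite ler_wpM2l ?normr_ge0// lerDl.
by rewrite -ler_pdivlMr// ltr_wpDl.
Qed.

End OriginProbability.

(** * Polylogarithms *)

Section Analytic.
Context {R : realType}.
Implicit Types (f g : R -> R) (x y : R).

Definition analytic_at f x0 :=
  exists a, \forall x \near x0, pseries a (x - x0) @ \oo --> f x.

Lemma analytic_atP f x0 : analytic_at f x0 ->
  exists a r, 0 < r /\ forall y, `|y| < r -> pseries a y @ \oo --> f (x0 + y).
Proof.
move=> [a [r /= r0 Ha]]; exists a, r; split=> // y yr.
have := Ha (x0 + y); rewrite /= opprD addNKr normrN => /(_ yr).
by rewrite addrC addKr.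
Qed.

Lemma analytic_at_intro f x0 a r : 0 < r ->
  (forall y, `|y| < r -> pseries a y @ \oo --> f (x0 + y)) -> analytic_at f x0.
Proof.
move=> r0 Ha; exists a, r => // x /=; rewrite distrC => xr.
by have := Ha _ xr; rewrite (addrC x0) subrK.
Qed.

Lemma analytic_at_is_derive f x0 a r y : `|y| < r ->
  (forall y, `|y| < r -> pseries a y @ \oo --> f (x0 + y)) ->
  is_derive (x0 + y) 1 f (psum (pseries_diffs a) y).
Proof.
move=> yr Ha; have Ca : cvg_on a r by move=> z /Ha /cvgP.
have d1 := derive_psum Ca yr.
have d2 : is_derive (x0 + y) 1 (fun x => psum a (- x0 + x)) (psum (pseries_diffs a) y).
  by apply: derive_shift; rewrite addKr.
apply: near_eq_is_derive d2.
exists (r - `|y|); first by rewrite /= subr_gt0.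
move=> x /= xy; have xr : `|- x0 + x| < r.
  have := ler_normB y (x0 + y - x); rewrite (_ : y - _ = - x0 + x); last by ring.
  by lra.
by have := Ha _ xr; rewrite addNKr => /(cvg_lim _); apply.
Qed.

Lemma analytic_at_derivable f x0 : analytic_at f x0 -> derivable f x0 1.
Proof.
move=> /analytic_atP[a [r [r0 Ha]]].
have z0 : `|0 : R| < r by rewrite normr0.
by have [] := analytic_at_is_derive z0 Ha; rewrite addr0.
Qed.

Lemma analytic_at_derive f x0 : analytic_at f x0 -> analytic_at ('D_1 f) x0.
Proof.
move=> /analytic_atP[a [r [r0 Ha]]].
apply: (@analytic_at_intro _ _ (pseries_diffs a) r) => // y yr.
have [_ ->] := analytic_at_is_derive yr Ha.
by apply: (cvg_on_psum _ yr); apply: cvg_on_diffs => z /Ha /cvgP.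
Qed.

Lemma analytic_at_sub f g x0 : analytic_at f x0 -> analytic_at g x0 ->
  analytic_at (fun x => f x - g x) x0.
Proof.
move=> /analytic_atP[a [r [r0 Ha]]] /analytic_atP[b [s [s0 Hb]]].
apply: (@analytic_at_intro _ _ (fun i => a i - b i) (Num.min r s)).
  by rewrite lt_min r0.
move=> y; rewrite lt_min => /andP[yr ys].
have -> : pseries (fun i => a i - b i) y = pseries a y \- pseries b y.
  apply/funext => n; rewrite /pseries /series /= -sumrB.
  by apply: eq_bigr => i _; ring.
by apply: cvgB; [exact: Ha|exact: Hb].
Qed.

Lemma analytic_at_cst c x0 : analytic_at (fun=> c) x0.
Proof.
apply: (@analytic_at_intro _ _ (fun i => if i is 0%N then c else 0) 1) => // y _.
rewrite -(cvg_shiftS (pseries _ _)); under eq_fun do rewrite pseries_shift.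
apply: cvg_near_cst; apply: nearW => n; rewrite /pseries /series /= big1 ?mulr0 ?addr0//.
by move=> i _; rewrite mul0r.
Qed.

Lemma analytic_at_mulX f x0 : analytic_at f x0 -> analytic_at (fun x => x * f x) x0.
Proof.
move=> /analytic_atP[a [r [r0 Ha]]].
apply: (@analytic_at_intro _ _ (fun i => x0 * a i + (if i is j.+1 then a j else 0)) r) => // y yr.
rewrite -(cvg_shiftS (pseries _ _)).
have -> : (fun n => pseries (fun i => x0 * a i + (if i is j.+1 then a j else 0)) y n.+1) =
    (fun n => x0 * pseries a y n.+1 + y * pseries a y n).
  apply/funext => n; rewrite !pseries_shift addr0 mulrDr -addrA; congr (_ + _).
  rewrite mulrCA -mulrDr; congr (_ * _); rewrite /pseries /series /= mulr_sumr -big_split.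
  by apply: eq_bigr => i _ /=; ring.
rewrite mulrDl; apply: cvgD; last by apply: cvgMr; exact: Ha.
by apply: cvgMr; rewrite (cvg_shiftS (pseries a y)); exact: Ha.
Qed.

(* Continuing the zero set leftwards: just right of its left end the function
   vanishes, so all Taylor coefficients there do. *)
Lemma analytic_eq0 f : (forall x, x < 1 -> analytic_at f x) ->
  (forall x, `|x| < 1 -> f x = 0) -> forall x, x < 1 -> f x = 0.
Proof.
move=> fan f0 x x1; have [x0|x0] := leP 0 x; first by apply: f0; rewrite ger0_norm.
suff H s : 0 <= s -> f (- s) = 0 by rewrite -(opprK x) H// oppr_ge0 ltW.
have key r : 0 <= r -> (forall u, 0 <= u < r -> f (- u) = 0) ->
    \forall h \near 0, f (- r + h) = 0.
  move=> r0 Hr; have /fan/analytic_atP[a [e [e0 Ha]]] : - r < 1 by lra.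
  have a0 : forall n, a n = 0.
    (* The function vanishes on a right neighbourhood of [- r] of this length: by [f0] if [r = 0],
       by [Hr] otherwise. *)
    pose e' := Num.min e (if r == 0 then 1 else r).
    have e'0 : 0 < e'.
      rewrite /e' lt_min e0 /=; have [_|rn0] := eqVneq r 0; first exact: ltr01.
      by rewrite lt0r rn0.
    apply: (@pseries_cvg0_eq0 _ a e') => // y /andP[y0].
    rewrite /e' lt_min => /andP[ye yr].
    have := Ha y; rewrite gtr0_norm// => /(_ ye).
    suff -> : f (- r + y) = 0 by [].
    move: yr; case: eqP => [->|_] yr; first by rewrite oppr0 add0r f0// gtr0_norm.
    rewrite (_ : - r + y = - (r - y)); last by ring.
    by apply: Hr; lra.
  exists e => // h /=; rewrite sub0r normrN => /Ha H.
  have : pseries a h @ \oo --> 0.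
    apply: cvg_near_cst; apply: nearW => n.
    by rewrite /pseries /series /= big1// => i _; rewrite a0 mul0r.
  by move=> H'; exact: (cvg_unique _ H H').
move=> s0; apply: (@real_induction _ s (fun s => f (- s) = 0)) => //.
- by rewrite oppr0 f0// normr0.
- move=> r /andP[r0 rs] Hr; have [e e0 He] := key r r0 (fun u hu => Hr u ltac:(lra)).
  exists e => // h /= he h0; rewrite opprD; apply: He => /=.
  by move: he; rewrite !sub0r !normrN.
- move=> r /andP[r0 rs] Hr; have := key r (ltW r0) Hr.
  by move/nbhs_singleton; rewrite addr0.
Qed.

End Analytic.

Section Polylog.
Context {R : realType}.
Variable Li : nat -> R -> R.
Hypothesis Li_polylog : forall k : nat, (0 < k)%N -> polylog k (Li k).

(** At [i = 0] the inverse of 0 is 0 when [k > 0], so the series may start at index 0. *)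
Let coef k (i : nat) : R := (i%:R ^+ k)^-1.

Let coef0 k : (0 < k)%N -> coef k 0 = 0.
Proof. by case: k => // k _; rewrite /coef exprS mul0r invr0. Qed.

Let Li_pseries k x : (0 < k)%N -> `|x| < 1 -> pseries (coef k) x @ \oo --> Li k x.
Proof.
move=> k0 x1; have := (Li_polylog k0).1 x x1.
rewrite -(cvg_shiftS (pseries _ _)) -(cvg_shiftS (fun n => \sum_(1 <= j < n) _)).
rewrite (_ : (fun n => \sum_(1 <= j < n.+1) _) = (fun n => pseries (coef k) x n.+1))//.
apply/funext => n; rewrite pseries_shift coef0// add0r big_add1 /=.
rewrite /pseries /series /= mulr_sumr; apply: eq_bigr => i _.
by rewrite /coef exprS; ring.
Qed.

Let Li_analytic k x : (0 < k)%N -> x < 1 -> analytic_at (Li k) x.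
Proof. by move=> k0 x1; exact: (Li_polylog k0).2. Qed.

Let diffs_coef k : pseries_diffs (coef k.+1) = fun i => coef k i.+1.
Proof.
by apply/funext => i; rewrite /pseries_diffs /coef exprS invfM mulrA divff ?mul1r.
Qed.

Let Li_derive_in k (x : R) : `|x| < 1 ->
  is_derive x 1 (Li k.+1) (psum (fun i => coef k i.+1) x) /\
  pseries (fun i => coef k i.+1) x @ \oo --> psum (fun i => coef k i.+1) x.
Proof.
move=> x1; have Ca : cvg_on (coef k.+1) 1.
  by move=> y y1; apply: cvgP; exact: Li_pseries.
split; last by rewrite -diffs_coef; exact: (cvg_on_psum (cvg_on_diffs Ca) x1).
rewrite -diffs_coef.
have H y : `|y| < 1 -> pseries (coef k.+1) y @ \oo --> Li k.+1 (0 + y).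
  by rewrite add0r; exact: Li_pseries.
by have := analytic_at_is_derive x1 H; rewrite add0r.
Qed.

Lemma polylog_derivable k (x : R) : (0 < k)%N -> x < 1 -> is_derive x 1 (Li k) ('D_1 (Li k) x).
Proof.
by move=> k0 x1; apply: derivableP; apply: analytic_at_derivable; exact: Li_analytic.
Qed.

(** The products by [x] here and by [1 - x] in [polylog_derive1] keep both sides analytic on all of
    [x < 1] without dividing series, ready for [analytic_eq0]. *)
Lemma polylog_deriveS k (x : R) : (0 < k)%N -> x < 1 -> x * 'D_1 (Li k.+1) x = Li k x.
Proof.
move=> k0 x1; apply/eqP; rewrite -subr_eq0; apply/eqP.
apply: (@analytic_eq0 _ (fun x => x * 'D_1 (Li k.+1) x - Li k x)) => // y y1.
  apply: analytic_at_sub; last exact: Li_analytic.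
  by apply: analytic_at_mulX; apply: analytic_at_derive; exact: Li_analytic.
have [[_ ->] H] := Li_derive_in k y1.
apply/eqP; rewrite subr_eq0; apply/eqP.
have H1 : pseries (coef k) y n.+1 @[n --> \oo] --> y * psum (fun i => coef k i.+1) y.
  under eq_fun do rewrite pseries_shift coef0// add0r.
  exact: cvgMr.
have H2 : pseries (coef k) y n.+1 @[n --> \oo] --> Li k y.
  by rewrite cvg_shiftS; exact: Li_pseries.
exact: (cvg_unique _ H1 H2).
Qed.

Lemma polylog_derive1 (x : R) : x < 1 -> (1 - x) * 'D_1 (Li 1) x = 1.
Proof.
move=> x1; apply/eqP; rewrite -subr_eq0; apply/eqP.
apply: (@analytic_eq0 _ (fun x => (1 - x) * 'D_1 (Li 1) x - 1)) => // y y1.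
  apply: analytic_at_sub; last exact: analytic_at_cst.
  have -> : (fun x => (1 - x) * 'D_1 (Li 1) x) =
      (fun x => 'D_1 (Li 1) x - x * 'D_1 (Li 1) x) by apply/funext => u; ring.
  have H : analytic_at ('D_1 (Li 1)) y by apply: analytic_at_derive; exact: Li_analytic.
  by apply: analytic_at_sub => //; exact: analytic_at_mulX.
have [[_ ->] H] := Li_derive_in 0 y1.
have H1 : pseries (fun i => coef 0 i.+1) y n.+1 @[n --> \oo] -->
    1 + y * psum (fun i => coef 0 i.+1) y.
  under eq_fun do rewrite pseries_shift.
  have -> : (fun i => coef 0 i.+2) = (fun i => coef 0 i.+1) by [].
  have -> : coef 0 1 = 1 by rewrite /coef expr0 invr1.
  by apply: cvgD; [exact: cvg_cst|exact: cvgMr].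
have H2 : pseries (fun i => coef 0 i.+1) y n.+1 @[n --> \oo] -->
    psum (fun i => coef 0 i.+1) y by rewrite cvg_shiftS.
by rewrite mulrBl mul1r {1}(cvg_unique _ H2 H1)//; ring.
Qed.

End Polylog.

(** * Iterated primitives built from polylogarithms *)

Section PolylogPrimitive.
Context {R : realType}.
Variable Li : nat -> R -> R.
Hypothesis Li_polylog : forall k : nat, (0 < k)%N -> polylog k (Li k).
Variables (eta A0 : R).

(* Common form of [g_subcritical] and [g_supercritical]: [eta = - |mu - lambda|],
   and [A0 / (A0 - eta)] is the argument of the polylogarithms. *)
Definition polylog_prim (k : nat) (t : R) : R :=
  (eta ^+ k.+1)^-1 *
  (A0 * eta ^+ k.-1 * t ^+ k
   + k`!%:R * (Li k (A0 * expR (eta * t) / (A0 - eta)) - Li k (A0 / (A0 - eta)))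
   - \sum_(1 <= r < k) k`!%:R / r`!%:R * (eta * t) ^+ r * Li (k - r)%N (A0 / (A0 - eta))).

Local Notation w := (A0 / (A0 - eta)).
Local Notation arg t := (A0 * expR (eta * t) / (A0 - eta)).

Hypotheses (eta_neq0 : eta != 0) (den_neq0 : A0 - eta != 0).

Let derive_arg (t : R) : is_derive t 1 (fun r => arg r) (eta * arg t).
Proof.
apply: (derive_eq (derive_mul (derive_scale A0 (derive_expR eta t))
  (derive_cst (A0 - eta)^-1 t))).
ring.
Qed.

Let derive_Li k (t : R) : arg t < 1 ->
  is_derive t 1 (fun r => Li k.+1 (arg r)) ('D_1 (Li k.+1) (arg t) * (eta * arg t)).
Proof.
by move=> w1; exact: (derive_comp (g := fun r => arg r) (polylog_derivable Li_polylog (ltn0Sn k) w1) (derive_arg t)).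
Qed.

Lemma polylog_prim0 k : (0 < k)%N -> polylog_prim k 0 = 0.
Proof.
case: k => // k _; rewrite /polylog_prim big_nat big1; last first.
  by case=> // r _; rewrite mulr0 exprS !mul0r mulr0 mul0r.
by rewrite !mulr0 expR0 mulr1 subrr expr0n /= !mulr0 addr0 subr0 mulr0.
Qed.

Lemma derive_polylog_prim1 (t : R) : arg t < 1 ->
  is_derive t 1 (polylog_prim 1) ((eta ^+ 2)^-1 * (A0 + eta * arg t / (1 - arg t))).
Proof.
move=> w1.
have H : is_derive t 1 (fun r => (eta ^+ 2)^-1 * (A0 * r + (Li 1 (arg r) - Li 1 w)))
    ((eta ^+ 2)^-1 * (A0 + ('D_1 (Li 1) (arg t) * (eta * arg t) - 0))).
  apply: derive_scale; apply: derive_add; first exact: derive_linear.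
  exact: (derive_sub (derive_Li 0 w1) (derive_cst _ _)).
have -> : polylog_prim 1 = (fun r => (eta ^+ 2)^-1 * (A0 * r + (Li 1 (arg r) - Li 1 w))).
  apply/funext => r; rewrite /polylog_prim big_geq// expr0 mulr1 expr1.
  by rewrite mul1r subr0.
apply: (derive_eq H); have := polylog_derive1 Li_polylog w1.
have : 1 - arg t != 0 by rewrite gt_eqF// subr_gt0.
move: ('D_1 (Li 1) (arg t)) => L; move: (arg t) => v v1 vL.
have -> : L = (1 - v)^-1 by apply: (mulfI v1); rewrite vL divff.
by rewrite subr0; congr (_ * (_ + _)); field.
Qed.

(** By the chain rule [Li (k + 1)] at the moving argument has derivative [eta Li k]; the term
    [r = 1] of the sum supplies the matching [- Li k] at the initial argument, and the others shift
    down by one index. *)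
Lemma derive_polylog_primS k (t : R) : (0 < k)%N -> arg t < 1 ->
  is_derive t 1 (polylog_prim k.+1) (k.+1%:R * polylog_prim k t).
Proof.
move=> k0 w1.
have dsum : is_derive t 1 (fun v => \sum_(1 <= r < k.+1)
      k.+1`!%:R / r`!%:R * (eta * v) ^+ r * Li (k.+1 - r)%N w)
    (\sum_(1 <= r < k.+1) k.+1`!%:R / r.-1`!%:R * eta * (eta * t) ^+ r.-1 * Li (k.+1 - r)%N w).
  apply: derive_sum_nat => -[//|r] _.
  apply: (derive_eq (derive_mul (derive_scale (k.+1`!%:R / r.+1`!%:R)
    (derive_pow r.+1 (derive_linear eta t))) (derive_cst (Li (k.+1 - r.+1)%N w) t))).
  rewrite mulr0 addr0 /= (factS r) natrM.
  have := natfact_neq0 (R := R) r; have := pnatr_eq0 R r.+1.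
  move: (r.+1%:R : R) (r`!%:R : R) => u v u0 v0.
  by field; rewrite v0 u0.
have dLi := derive_scale (k.+1`!%:R) (derive_sub (derive_Li k w1) (derive_cst (Li k.+1 w) t)).
have dmono := derive_scale (A0 * eta ^+ k) (derive_pow k.+1 (derive_id t)).
apply: (derive_eq (derive_scale (eta ^+ k.+2)^-1 (derive_sub (derive_add dmono dLi) dsum))).
rewrite big_ltn// fact0 expr0 subSS subn0 big_add1 /=.
rewrite (_ : 'D_1 (Li k.+1) (arg t) * (eta * arg t) = eta * Li k (arg t)); last first.
  by rewrite -(polylog_deriveS Li_polylog k0 w1); ring.
have -> : \sum_(1 <= r < k) k.+1`!%:R / r`!%:R * eta * (eta * t) ^+ r * Li (k.+1 - r.+1)%N w =
    k.+1%:R * eta * \sum_(1 <= r < k) k`!%:R / r`!%:R * (eta * t) ^+ r * Li (k - r)%N w.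
  rewrite mulr_sumr; apply: eq_bigr => r _; rewrite factS natrM subSS; ring.
rewrite /polylog_prim; move: (\sum_(1 <= r < k) _) => S.
rewrite factS natrM; move: (Li k (arg t)) (Li k w) (k`!%:R : R) => L1 L2 F.
case: k k0 S {dsum dLi dmono} => // k _ S; rewrite /= !(exprS eta).
have := expf_neq0 k eta_neq0; move: (eta ^+ k) (k.+2%:R : R) => e N e0.
by field; rewrite e0 eta_neq0.
Qed.

End PolylogPrimitive.

(** Induction comparing both signs of [g n.+1] with [r ^ (n + 1) / (n + 1)!]; it serves to dominate
    the final series. *)
Lemma iterated_primitive_le {R : realType} (g : nat -> R -> R) (t : R) :
  (forall r, 0 <= r <= t -> `|g 0%N r| <= 1) ->
  (forall k r, 0 <= r <= t -> is_derive r 1 (g k.+1) (g k r)) ->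
  (forall k, g k 0 = 0) ->
  forall n r, 0 <= r <= t -> `|g n r| <= r ^+ n / n`!%:R.
Proof.
move=> g0 dg gz; elim=> [|n IH] r /andP[r0 rt].
  by rewrite expr0 fact0 divr1 g0// r0.
suff H c : c = 1 \/ c = -1 ->
    c * g n.+1 r + (-1) * (r ^+ n.+1 / n.+1`!%:R) <=
    c * g n.+1 0 + (-1) * (0 ^+ n.+1 / n.+1`!%:R).
  have := H 1 (or_introl erefl); have := H (-1) (or_intror erefl).
  by rewrite gz expr0n mul0r !mulr0 addr0 ler_norml; lra.
move=> c1.
have dtot (u : R) : 0 <= u <= t -> is_derive u 1
    (fun v => c * g n.+1 v + (-1) * (v ^+ n.+1 / n.+1`!%:R))
    (c * g n u + (-1) * (u ^+ n / n`!%:R)).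
  by move=> ut; exact: (derive_add (derive_scale c (dg n u ut)) (derive_scale (-1) (derive_exp_fact n u))).
apply: (@dini_le_le R (fun v => c * g n.+1 v + (-1) * (v ^+ n.+1 / n.+1`!%:R))) => // u Hu.
  have ut : 0 <= u <= t by lra.
  by apply: derivable_left_lsc; case: (dtot u ut).
have ut : 0 <= u <= t by lra.
apply: dini_le_trans (is_derive_dini_le (dtot u ut)).
by have := IH u ut; rewrite ler_norml; case: (c1) => ->; lra.
Qed.

(** * The formula for the generating function *)

Section Assembly.
Context {R : realType}.
Variables (A : nat -> {poly R}) (Li : nat -> R -> R) (d : nat) (la mu : R).
Hypotheses (d_gt0 : (0 < d)%N) (la_gt0 : 0 < la) (mu_gt0 : 0 < mu) (mu_neq : mu != la).
Hypothesis A_eulerian : eulerian A.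
Hypothesis Li_polylog : forall k : nat, (0 < k)%N -> polylog k (Li k).
Variable p : R -> state d -> state d -> R.
Hypotheses (tf : transition_function p).
Hypothesis rates : has_transition_rates p (rate la la mu).
Variables (z t : R).
Hypotheses (z01 : 0 <= z <= 1) (t_range : 0 <= t < time_radius la mu).
Hypothesis z_regular : mu < la -> z != mu / la /\ z != 1.

Let eta := if la < mu then la - mu else mu - la.
Let A0 := if la < mu then la * (1 - z) else mu - la * z.
(** Up to the factor [d (d - 1)], the coefficient of the bracket in the formula; it makes
    [kappa * polylog_prim 1] a primitive of [G - 1]. *)
Let kappa := - (mu - la) ^+ 2 / (mu - la * z).

Let z1 : z <= 1. Proof. by case/andP: z01. Qed.

Let laz : la * z <= la.
Proof. by rewrite ger_pMr. Qed.

Let mu_lt : ~~ (la < mu) -> mu < la.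
Proof. by rewrite -leNgt => lemu; rewrite lt_neqAle mu_neq. Qed.

Let eta_lt0 : eta < 0.
Proof.
by rewrite /eta; case: ifPn => [|/mu_lt]; rewrite subr_lt0.
Qed.

Let den_gt0 : 0 < A0 - eta.
Proof.
rewrite /A0 /eta; have := laz; case: ifPn => [lamu|/mu_lt mula] lz; first by lra.
have [_ zn1] := z_regular mula.
have zlt : z < 1 by rewrite lt_neqAle zn1.
have : la * z < la by rewrite gtr_pMr.
lra.
Qed.

Let K_neq0 : mu - la * z != 0.
Proof.
have [lamu|] := boolP (la < mu); first by rewrite gt_eqF//; have := laz; lra.
move=> /mu_lt mula; have [zn _] := z_regular mula.
rewrite subr_eq0; apply: contra zn => /eqP ->.
by rewrite mulrAC divff ?mul1r// gt_eqF.
Qed.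

Let kappa_neq0 : kappa != 0.
Proof. by rewrite /kappa mulf_neq0 ?invr_eq0// oppr_eq0 expf_eq0 /= subr_eq0. Qed.

Let g_polylog k (r : R) : g Li la mu k z r = polylog_prim Li eta A0 k r.
Proof.
rewrite /g /eta /A0 /polylog_prim; case: ifP => _.
  rewrite /g_subcritical (_ : la * (1 - z) - (la - mu) = mu - la * z); last by ring.
  by rewrite (_ : - (mu - la) = la - mu) ?opprB.
rewrite /g_supercritical (_ : mu - la * z - (mu - la) = la * (1 - z)); last by ring.
by rewrite (_ : - (la - mu) = mu - la) ?opprB.
Qed.

Let arg_lt1 (r : R) : 0 <= r -> A0 * expR (eta * r) / (A0 - eta) < 1.
Proof.
move=> r0; rewrite ltr_pdivrMr// mul1r.
have e1 : expR (eta * r) <= 1.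
  by rewrite -expR0 ler_expR mulr_le0_ge0// ltW.
have e0 := expR_gt0 (eta * r); have := den_gt0; have := eta_lt0.
(* [A0 < 0] happens when [mu < la] and [z > mu / la]; the argument is then negative, and possibly
   below -1. *)
have [A00|A00] := leP 0 A0.
  have : A0 * expR (eta * r) <= A0 by rewrite ler_piMr.
  lra.
have : A0 * expR (eta * r) < 0 by rewrite nmulr_rlt0.
lra.
Qed.

(** Dividing by [k!] turns [g_k' = k g_(k-1)] into successive primitives, which begin with [G - 1]
    and vanish at 0. *)
Let gg (k : nat) (r : R) : R :=
  if k is 0%N then imm_pgf la mu z r - 1 else kappa * (polylog_prim Li eta A0 k r / k`!%:R).

Let imm_pgfE (r : R) : 0 <= r ->
  imm_pgf la mu z r = (mu - la) / (mu - la * z - la * (1 - z) * expR (- (mu - la) * r)).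
Proof.
move=> r0; rewrite /imm_pgf -[RHS]invf_div; congr (_^-1).
by rewrite -expR_growth//; field; rewrite subr_eq0.
Qed.

Let gg_deriv1 (r : R) : 0 <= r ->
  kappa * ((eta ^+ 2)^-1 * (A0 + eta * (A0 * expR (eta * r) / (A0 - eta)) /
    (1 - A0 * expR (eta * r) / (A0 - eta)))) = imm_pgf la mu z r - 1.
Proof.
move=> r0; rewrite imm_pgfE//.
have := arg_lt1 r0; rewrite ltr_pdivrMr// mul1r -subr_gt0 => /lt0r_neq0.
have eta0 : eta != 0 by rewrite lt_eqF.
have e0 := lt0r_neq0 (expR_gt0 (eta * r)).
have := lt0r_neq0 den_gt0; have := K_neq0.
move: eta0 e0; rewrite /kappa /eta /A0; case: ifP => _ eta0 e0.
  rewrite (_ : - (mu - la) = la - mu); last by ring.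
  rewrite (_ : la * (1 - z) - (la - mu) = mu - la * z); last by ring.
  move: (expR _) e0 => e e0 K0 _ D0.
  field.
  by rewrite D0 K0 eta0.
rewrite (mulNr (mu - la) r) expRN.
rewrite (_ : mu - la * z - (mu - la) = la * (1 - z)); last by ring.
move: (expR _) e0 => e e0 K0 C0 D0.
have C1 : 1 - z != 0 by apply: contraNneq C0 => ->; rewrite mulr0.
have D1 : (mu - la * z) * e - la * (1 - z) != 0 by rewrite -opprB oppr_eq0.
by field; rewrite e0 D1 C1 D0 eta0 K0 gt_eqF.
Qed.

Let t0 : 0 <= t. Proof. by case/andP: t_range. Qed.

Let gg_derive0 (r : R) : 0 <= r <= t -> is_derive r 1 (gg 0) (imm_pgf' la mu z r).
Proof.
move=> /andP[r0 _].
by apply: (derive_eq (derive_sub (derive_imm_pgf la_gt0 mu_neq z1 r0) (derive_cst 1 r)));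
  rewrite subr0.
Qed.

Let gg_deriveS k (r : R) : 0 <= r <= t -> is_derive r 1 (gg k.+1) (gg k r).
Proof.
move=> /andP[r0 _]; have w1 := arg_lt1 r0.
have eta0 : eta != 0 by rewrite lt_eqF.
case: k => [|k].
  have H := derive_polylog_prim1 Li_polylog w1.
  apply: (derive_eq (derive_scale kappa (derive_mul H (derive_cst (1%N`!%:R)^-1 r)))).
  by rewrite /= -gg_deriv1// invr1; ring.
have H := derive_polylog_primS Li_polylog eta0 (ltn0Sn k) w1.
apply: (derive_eq (derive_scale kappa (derive_mul H (derive_cst (k.+2`!%:R)^-1 r)))).
rewrite /= (factS k.+1) natrM mulr0 addr0.
have := natfact_neq0 (R := R) k.+1.
have := pnatr_eq0 R k.+2.
move: (polylog_prim _ _ _ _ _) (k.+2%:R : R) (k.+1`!%:R : R) => G u v u0 v0.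
by field; rewrite v0 u0.
Qed.

Let gg0 k : gg k 0 = 0.
Proof.
case: k => [|k]; first by rewrite /= imm_pgf0 subrr.
by rewrite /gg polylog_prim0// mul0r mulr0.
Qed.

Let gg_le n : `|gg n t| <= t ^+ n / n`!%:R.
Proof.
apply: (@iterated_primitive_le R gg t) => //; last by rewrite t0 lexx.
move=> r /andP[r0 _] /=; rewrite ler_norml.
have := imm_pgf_gt0 mu la_gt0 z1 r0; have := imm_pgf_le1 mu la_gt0 z1 r0; lra.
Qed.

Local Notation c := (origin_coef A d la mu).
Local Notation E n := (A n).[mu / la].
Local Notation T := (semigroup_op p).

Let U K := \sum_(0 <= n < K) c n * (- la) ^+ n * gg n t.

(** Dominated through [gg_le] by the series [origin_egf] at [la * t], inside its disc of
    convergence. *)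
Let U_cvg : cvgn U.
Proof.
apply: (@cvgn_norm_le _ _ (fun n => origin_egf A d la mu n * (la * t) ^+ n)).
  move=> n; rewrite normrM normrM normrX normrN (gtr0_norm la_gt0).
  have c0 := origin_coef_ge0 d_gt0 la_gt0 mu_gt0 mu_neq A_eulerian n.
  rewrite (ger0_norm c0) /origin_egf exprMn.
  have -> : c n / n`!%:R * (la ^+ n * t ^+ n) = c n * la ^+ n * (t ^+ n / n`!%:R) by ring.
  by rewrite ler_wpM2l// mulr_ge0// exprn_ge0// ltW.
apply: (cvg_on_origin d_gt0 la_gt0 mu_gt0 mu_neq A_eulerian).
exact: time_radius_lt.
Qed.

Let coef0 : c 0%N = 1. Proof. by rewrite /origin_coef eqxx. Qed.

Let coef1 : c 1%N = d%:R.
Proof.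
rewrite origin_coef_step big_nat1 subnn coef0 (eulerian_ratio1 la_gt0 mu_gt0 mu_neq A_eulerian).
ring.
Qed.

Let coefS n : (1 < n)%N -> c n = d%:R * theta A d la mu n.
Proof.
move=> n1; rewrite /origin_coef gtn_eqF ?(ltnW n1)// theta_coefE//.
exact: (eulerian_ratio1 la_gt0 mu_gt0 mu_neq A_eulerian).
Qed.

Let S n := \sum_(2 <= i < n) series_term A Li d la mu z t i.

(** By [c 0 = 1] and [c 1 = d], the terms 0 and 1 give [G - 1] and the [g_1] term; the former turns
    [G + (d - 1) (G - 1)] into [1 - d + d G]. *)
Let U_S n : U n.+2 = imm_pgf la mu z t - 1 +
  d%:R * kappa * (- la * g Li la mu 1 z t + S n.+2).
Proof.
have -> : U n.+2 = c 0%N * (- la) ^+ 0 * gg 0 t + (c 1%N * (- la) ^+ 1 * gg 1 t +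
    \sum_(2 <= i < n.+2) c i * (- la) ^+ i * gg i t).
  by rewrite /U big_ltn// [X in _ + X]big_ltn.
have -> : \sum_(2 <= i < n.+2) c i * (- la) ^+ i * gg i t = d%:R * kappa * S n.+2.
  rewrite /S mulr_sumr; apply: eq_big_nat => i /andP[i2 _].
  rewrite coefS// /series_term g_polylog.
  by case: i i2 => // i _; rewrite /gg; ring.
rewrite coef0 coef1 expr0 expr1 g_polylog /gg invr1.
ring.
Qed.

Let d_neq0 : d%:R != 0 :> R. Proof. by rewrite pnatr_eq0 -lt0n. Qed.

Lemma series_term_cvg : cvgn S.
Proof.
apply/cvg_ex; exists ((limn U - (imm_pgf la mu z t - 1)) / (d%:R * kappa) + la * g Li la mu 1 z t).
rewrite -(cvg_shiftn 2).
have -> : (fun n => S (n + 2)%N) = (fun n =>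
    (U (n + 2)%N - (imm_pgf la mu z t - 1)) / (d%:R * kappa) + la * g Li la mu 1 z t).
  by apply/funext => n; rewrite addn2 U_S; field; rewrite kappa_neq0 d_neq0.
apply: cvgD; last exact: cvg_cst.
apply: cvgMl; apply: cvgB; last exact: cvg_cst.
by rewrite (cvg_shiftn 2 U).
Qed.

Lemma semigroup_op_formula :
  T t (fun y => z ^+ level y) (origin d) = pgf_formula A Li d la mu z t.
Proof.
have H1 := pgf_series d_gt0 la_gt0 mu_gt0 mu_neq A_eulerian tf rates z01 t_range
  gg_derive0 gg_deriveS gg0.
have H2 : \sum_(0 <= n < K) (d%:R - 1) * (c n * (- la) ^+ n * gg n t) @[K --> \oo] -->
    (d%:R - 1) * limn U.
  by under eq_fun do rewrite -mulr_sumr; exact: cvgMr.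
have H3 : limn U = imm_pgf la mu z t - 1 + d%:R * kappa * (- la * g Li la mu 1 z t + limn S).
  have H : (fun n => U (n + 2)%N) @ \oo --> imm_pgf la mu z t - 1 +
      d%:R * kappa * (- la * g Li la mu 1 z t + limn S).
    have -> : (fun n => U (n + 2)%N) = (fun n => imm_pgf la mu z t - 1 +
       d%:R * kappa * (- la * g Li la mu 1 z t + S (n + 2)%N)).
      by apply/funext => n; rewrite addn2 U_S.
    apply: cvgD; first exact: cvg_cst.
    apply: cvgMr; apply: cvgD; first exact: cvg_cst.
    by rewrite (cvg_shiftn 2 S); exact: series_term_cvg.
  by move: H; rewrite (cvg_shiftn 2 U) => /(cvg_lim _); apply.
have HE : T t (fun y => z ^+ level y) (origin d) - imm_pgf la mu z t =
    (d%:R - 1) * limn U by exact: (cvg_unique _ H1 H2).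
rewrite -[LHS](subrK (imm_pgf la mu z t)) HE.
rewrite H3 /pgf_formula -/S imm_pgfE// /kappa; ring.
Qed.

End Assembly.

Theorem proposition4p5 (R : realType) (disp : measure_display)
    (Omega : measurableType disp) (P : probability Omega R)
    (d : nat) (alpha lambda mu : R) (X : R -> Omega -> state d)
    (A : nat -> {poly R}) (Li : nat -> R -> R)
    (d_gt0 : (0 < d)%N) (lambda_gt0 : 0 < lambda) (mu_gt0 : 0 < mu)
    (alpha_eq : alpha = lambda) (mu_neq : mu != lambda)
    (X_ctmc : nonexplosive_ctmc P X (rate alpha lambda mu))
    (X_start : starts_at_0 P X)
    (A_eulerian : eulerian A)
    (Li_polylog : forall k : nat, (0 < k)%N -> polylog k (Li k))
    (t : R) (t_ge0 : 0 <= t) (t_lt : t < ln (mu / lambda) / (mu - lambda)) :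
  (* every z at which no denominator of the formula vanishes *)
  (forall z : R, 0 <= z <= 1 ->
     (mu < lambda -> z != mu / lambda /\ z != 1) ->
     cvgn (fun n => \sum_(2 <= i < n) series_term A Li d lambda mu z t i) /\
     pgf P X z t = pgf_formula A Li d lambda mu z t) /\
  (* the two removable singularities of the formula when mu < lambda *)
  (mu < lambda -> forall z : R, z = mu / lambda \/ z = 1 ->
     pgf_formula A Li d lambda mu x t @[x --> within `[0, 1] z^']
       --> pgf P X z t).
Proof.
subst alpha; case: X_ctmc => _ [p [tf rates mk]].
have tr : 0 <= t < time_radius lambda mu by rewrite t_ge0.
have regular z : 0 <= z <= 1 -> (mu < lambda -> z != mu / lambda /\ z != 1) ->
     cvgn (fun n => \sum_(2 <= i < n) series_term A Li d lambda mu z t i) /\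
     pgf P X z t = pgf_formula A Li d lambda mu z t.
  move=> z01 zr; split; first exact: (series_term_cvg d_gt0 lambda_gt0 mu_gt0 mu_neq A_eulerian Li_polylog z01 tr zr).
  by rewrite (pgf_semigroup_op tf mk X_start z01 t_ge0) 
    (semigroup_op_formula d_gt0 lambda_gt0 mu_gt0 mu_neq A_eulerian Li_polylog tf rates z01 tr zr).
split=> // mula z zE.
have r1 : mu / lambda < 1 by rewrite ltr_pdivrMr// mul1r.
have r0 : 0 < mu / lambda by rewrite divr_gt0.
have z01 : 0 <= z <= 1 by case: zE => ->; lra.
(* The other singular point: near [z] and away from [z'], every point of [0, 1] except [z] is
   regular. *)
pose z' := if z == 1 then mu / lambda else 1.
have zz' : z != z'.
  by rewrite /z'; have [->|//] := eqVneq z 1; rewrite gt_eqF.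
have /cvgrPdist_le H := pgf_continuous tf mk X_start z01 t_ge0.
apply/cvgrPdist_le => e /H; rewrite !near_withinE => {}H.
have H' : \forall x \near z, x != z'.
  exists `|z - z'| => /=; first by rewrite normr_gt0 subr_eq0.
  by move=> x /=; apply: contraTneq => ->; rewrite ltxx.
near=> x => xz x01.
have xz' : x != z' by near: x.
have x01' : 0 <= x <= 1 by move: x01; rewrite /= in_itv.
have xr : mu < lambda -> x != mu / lambda /\ x != 1.
  move=> _; move: xz xz'; rewrite /z'; case: zE => ->.
    by rewrite (lt_eqF r1).
  by rewrite eqxx.
have [_ <-] := regular x x01' xr.
by move: x01; near: x.
Unshelve. all: by end_near. Qed.
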